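(* Let $p\in(\tfrac{10}{3},6]$, $\gamma>0$, $a>0$. Then the function $c\mapsto\gamma^-(c)$ is strictly decreasing on $(0,c_1)$.
   Context: $H^1(\mathbb{R}^3)$ is the usual Sobolev space of real-valued functions. For $u\in H^1(\mathbb{R}^3)$, $$A(u)=\int_{\mathbb{R}^3}|\nabla u|^2dx,\quad B(u)=\int_{\mathbb{R}^3}\int_{\mathbb{R}^3}\frac{|u(x)|^2|u(y)|^2}{|x-y|}dxdy,\quad C(u)=\int_{\mathbb{R}^3}|u|^pdx,$$ $F(u)=\frac12A(u)-\frac\gamma4B(u)-\frac apC(u)$, and $\sigma=\frac{3(p-2)}{2}\in(2,6]$. $S(c)=\{u\in H^1(\mathbb{R}^3):\|u\|_{L^2}^2=c\}$. $K_H,K_{GN}>0$ are fixed constants, independent of $u$ and $c$, such that for every $c>0$ and $u\in S(c)$: $B(u)\le K_H\sqrt{A(u)}\,c^{3/2}$ and $C(u)\le K_{GN}[A(u)]^{\sigma/2}c^{(6-p)/4}$. Moreover $$c_1=\left(\frac{4}{\gamma K_H}\,\frac{\sigma-2}{\sigma-1}\right)^{\frac{3p-10}{4(p-3)}}\left(\frac{p}{a\sigma(\sigma-1)K_{GN}}\right)^{\frac{1}{2(p-3)}}.$$ For $u\in S(c)$ and $t>0$ put $u^t(x)=t^{3/2}u(tx)$ and $g_u(t)=F(u^t)=\frac12t^2A(u)-\frac\gamma4tB(u)-\frac apt^\sigma C(u)$. Define $\Lambda^-(c)=\{u\in S(c):g_u'(1)=0,\ g_u''(1)<0\}$ and $\gamma^-(c)=\inf_{u\in\Lambda^-(c)}F(u)$.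 *)

(* Defs.v *)
From HB Require Import structures.
From mathcomp Require Import all_boot all_order all_algebra.
From mathcomp Require Import all_classical all_reals all_analysis.
Set Implicit Arguments.
Unset Strict Implicit.
Unset Printing Implicit Defensive.
Import Order.TTheory GRing.Theory Num.Theory.
Import numFieldNormedType.Exports.
Local Open Scope classical_set_scope.
Local Open Scope ring_scope.

Notation R3 R := (R * R * R)%type.

(* measurableTypeR R is R with its Borel sigma-algebra, the structure on which
   lebesgue_measure is defined. *)
Definition leb3 (R : realType) :
    {measure set
       (measurableTypeR R * measurableTypeR R * measurableTypeR R)%type -> \bar R} :=
  (@lebesgue_measure R \x @lebesgue_measure R \x @lebesgue_measure R)%E.

(* The library norm on products is the max norm, hence this definition. *)
Definition enorm (R : realType) (x : R3 R) : R :=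
  Num.sqrt (x.1.1 ^+ 2 + x.1.2 ^+ 2 + x.2 ^+ 2).

Definition basis3 (R : realType) (i : 'I_3) : R3 R :=
  ((i == 0 :> nat)%:R, (i == 1 :> nat)%:R, (i == 2 :> nat)%:R).

Definition partial (R : realType) (i : 'I_3) (f : R3 R -> R) : R3 R -> R :=
  fun x => 'D_(basis3 R i) f x.

Definition smooth (R : realType) (f : R3 R -> R) : Prop :=
  forall s : seq 'I_3, let g := foldr (@partial R) f s in
    continuous g /\ forall i x, derivable g x (basis3 R i).

Definition test_function (R : realType) (f : R3 R -> R) : Prop :=
  smooth f /\ compact (closure [set x | f x != 0]).

Definition is_weak_partial (R : realType) (i : 'I_3) (u v : R3 R -> R) : Prop :=
  forall f, test_function f ->
    Rintegral (leb3 R) setT (fun x => u x * partial i f x) =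
    - Rintegral (leb3 R) setT (fun x => v x * f x).

Definition L2_weak_partials (R : realType) (i : 'I_3) (u : R3 R -> R) :
    set (R3 R -> R) :=
  [set v | v \in Lfun (leb3 R) 2%:E /\ is_weak_partial i u v].

(* Elements are representatives; weak derivatives, and all the functionals
   below, depend only on the class of u modulo almost everywhere equality. *)
Definition H1 (R : realType) : set (R3 R -> R) :=
  [set u | u \in Lfun (leb3 R) 2%:E /\
           forall i : 'I_3, L2_weak_partials i u !=set0].

(* A choice among weak derivatives that agree almost everywhere; it is the
   default value 0 when u has none, which H1 excludes. *)
Definition weak_partial (R : realType) (i : 'I_3) (u : R3 R -> R) :
    R3 R -> R :=
  xget (fun=> 0) (L2_weak_partials i u).

Definition mass (R : realType) (u : R3 R -> R) : \bar R :=
  (\int[leb3 R]_x (`|u x| ^+ 2)%:E)%E.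

Definition Aint (R : realType) (u : R3 R -> R) : \bar R :=
  (\int[leb3 R]_x (\sum_(i < 3) weak_partial i u x ^+ 2)%:E)%E.

(* On the diagonal x = y, a null set, the integrand is 0 since 0^-1 = 0. *)
Definition Bint (R : realType) (u : R3 R -> R) : \bar R :=
  (\int[leb3 R]_x \int[leb3 R]_y
     (`|u x| ^+ 2 * `|u y| ^+ 2 / enorm (x - y))%:E)%E.

Definition Cint (R : realType) (p : R) (u : R3 R -> R) : \bar R :=
  (\int[leb3 R]_x (`|u x| `^ p)%:E)%E.

Definition energy (R : realType) (gam a p : R) (u : R3 R -> R) : R :=
  1 / 2 * fine (Aint u) - gam / 4 * fine (Bint u) - a / p * fine (Cint p u).

Definition sigma (R : realType) (p : R) : R := 3 * (p - 2) / 2.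

Definition sphere (R : realType) (c : R) : set (R3 R -> R) :=
  [set u | H1 u /\ mass u = c%:E].

Definition scale (R : realType) (t : R) (u : R3 R -> R) : R3 R -> R :=
  fun x => t `^ (3 / 2) * u (t *: x).

Definition fiber (R : realType) (gam a p : R) (u : R3 R -> R) : R -> R :=
  fun t => energy gam a p (scale t u).

Definition Lambda_minus (R : realType) (gam a p c : R) : set (R3 R -> R) :=
  [set u | [/\ sphere c u,
        derive1 (fiber gam a p u) 1 = 0 &
        derive1n 2 (fiber gam a p u) 1 < 0]].

(* The infimum is taken in \bar R, so that it is meaningful without knowing
   beforehand that Lambda_minus is nonempty and the energy bounded below. *)
Definition gamma_minus (R : realType) (gam a p c : R) : \bar R :=
  ereal_inf [set (energy gam a p u)%:E | u in Lambda_minus gam a p c].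

Definition c1 (R : realType) (gam a p KH KGN : R) : R :=
  (4 / (gam * KH) * ((sigma p - 2) / (sigma p - 1)))
    `^ ((3 * p - 10) / (4 * (p - 3))) *
  (p / (a * sigma p * (sigma p - 1) * KGN)) `^ (1 / (2 * (p - 3))).

(* Main.v *)
(* The rescaling [x |-> r^-1 u (r^-2 x)] multiplies the mass by [r ^ 4], preserves
   A and multiplies B and C by [r ^ 6] and [r ^ (6 - p)]. Applied to [u] in
   Lambda^-(c) with [c' = r ^ 4 c], it gives a function whose fiber map has, because
   [c' < c1], a critical point [t < 1] in its concave region, hence some [w] in
   Lambda^-(c'); concavity of the derivative of the fiber map yields
     F(w) <= F(u) - gam/4 (1 - r^-6) B(w) - a/p (1 - r^(p-6)) C(w).
   If [p < 6], then C is bounded below on Lambda^-(c') and F is bounded below there,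
   so the infimum drops strictly.

   If [p = 6] only the B term is left. Were the infimum not to drop, B(w) would
   tend to 0 along a minimizing sequence, which forces gamma^-(c) to be at least
   [1 / (3 sqrt (a Q))], where Q = sup C / A^3. This is refuted by functions of H^1
   whose deficit [Q A^3 - C] is small compared with [A^(5/2) B / m^(3/2)], [m] being
   the mass. No extremal function is needed: cutting a near-maximizer [u] with
   [c^2 + s^2 = 1] costs the integral of [u^2 (|grad c|^2 + |grad s|^2)] only. Let
   omega be the mass of [u] in a cube around the concentration cube divided by the
   square of its side. When omega is small, cutting along coordinate planes shows
   that [u ^ 6] concentrates in a cube of a quarter of the size. By absolute
   continuity this stops at a scale where omega first exceeds a threshold [w0]; the
   function cut off there has deficit O(w0), while B^2 / m^3 is at least a multiple
   of [w0]. *)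

Require Import Defs.
From HB Require Import structures.
From mathcomp Require Import all_boot all_order all_algebra.
From mathcomp Require Import all_classical all_reals all_analysis.
From mathcomp Require Import measurable_realfun.
From mathcomp Require Import lra ring.
Set Implicit Arguments.
Unset Strict Implicit.
Unset Printing Implicit Defensive.
Import Order.TTheory GRing.Theory Num.Theory.
Import numFieldNormedType.Exports.
Local Open Scope classical_set_scope.
Local Open Scope ring_scope.

(** * Smooth functions *)

(** The level 1 / (3 sqrt (a Q)) is the maximum of the fiber map of a function with A = 1 and C = Q
    whose Coulomb term is dropped. When B(w) tends to 0 the constraint becomes A = a C + o(1); with
    C <= Q A^3 it forces A >= 1 / sqrt (a Q) up to o(1), and the energy is A / 3 + o(1). Going below
    this level only takes a function with A = 1 and mass c whose B term outweighs Q - C. Amplitude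
    and dilation are two free parameters, so mass and A can be prescribed at will, and only the size
    of the invariant B / (A^(1/2) m^(3/2)) against the relative deficit matters. The obstacle is
    that a near-maximizer of C / A^3 may carry most of its mass far from where u^6 sits, which makes
    this invariant arbitrarily small; hence the truncation. What decides is the balance of powers:
    after truncation the deficit is at most linear in w0, while the invariant is at least of order
    sqrt w0, so that a small w0 wins whatever the constants are. *)

Lemma derive_line (R : realType) (V : normedModType R) (f : V -> R) (x v : V) :
  'D_1 (fun t : R => f (t *: v + x)) 0 = 'D_v f x.
Proof.
apply: (f_equal (fun g : R -> R => lim (g @ 0^'))); apply/funext => t /=.
by rewrite addr0 scale0r add0r [_%:A]mulr1.
Qed.

(** Only the derivative of [f] in the direction [v] is assumed, so the chain rule is applied to the
    restriction of [f] to a line instead of a differential. *)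
Lemma is_derive_comp1 (R : realType) (V : normedModType R) (h : R -> R)
    (f : V -> R) (x v : V) (dh df : R) :
  is_derive (f x) 1 h dh -> is_derive x v f df ->
  is_derive x v (h \o f) (dh * df).
Proof.
move=> hP fP.
pose k (t : R) := f (t *: v + x).
have kP : is_derive (0 : R) (1 : R) k df.
  have [fd <-] := fP.
  by apply: DeriveDef; [move/derivable1P : fd|rewrite derive_line].
have hkP : is_derive (0 : R) (1 : R) (h \o k) (dh * df).
  by apply: is_derive1_comp; rewrite /k scale0r add0r.
have [hkd hke] := hkP.
by apply: DeriveDef; [apply/derivable1P; apply: hkd|rewrite -hke -derive_line].
Qed.

Definition smooth1 (R : realType) (h : R -> R) : Prop :=
  forall n x, derivable (derive1n n h) x 1.

Lemma smooth1_derive (R : realType) (h : R -> R) : smooth1 h -> smooth1 (derive1 h).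
Proof. by move=> hs n x; rewrite -derive1Sn. Qed.

(** Smoothness speaks of all iterated derivatives; it suffices to exhibit an invariant family that
    one differentiation preserves. *)
Lemma smooth1_coind (R : realType) (P : set (R -> R)) :
  (forall h, P h -> (forall x, derivable h x 1) /\ P (derive1 h)) ->
  forall h, P h -> smooth1 h.
Proof.
move=> HP h Ph n; have : P (derive1n n h).
  by elim: n => [|n ih]; [rewrite derive1n0|rewrite derive1nS; apply: (HP _ ih).2].
by move=> Pn x; apply: (HP _ Pn).1.
Qed.

Lemma smooth_coind (R : realType) (P : set (R3 R -> R)) :
  (forall f, P f -> continuous f /\
     forall i, (forall x, derivable f x (basis3 R i)) /\ P (partial i f)) ->
  forall f, P f -> smooth f.
Proof.
move=> HP f Pf s /=; have : P (foldr (@partial R) f s).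
  by elim: s => [//|i s ih] /=; apply: ((HP _ ih).2 i).2.
by move=> Ps; split=> [|i x]; [exact: (HP _ Ps).1|exact: ((HP _ Ps).2 i).1].
Qed.

(* Partial derivatives of a function built by these rules are again built by
   them; this closes the coinduction that yields smoothness. *)
Inductive alg (R : realType) (V : normedModType R) (G : set (V -> R)) :
    (V -> R) -> Prop :=
| alg_gen f of G f : alg G f
| alg_cst c : alg G (fun=> c)
| alg_add f g of alg G f & alg G g : alg G (fun x => f x + g x)
| alg_mul f g of alg G f & alg G g : alg G (fun x => f x * g x)
| alg_inv f of alg G f & (forall x, f x != 0) : alg G (fun x => (f x)^-1)
| alg_comp h f of smooth1 h & alg G f : alg G (fun x => h (f x)).

Section alg_closed.
Context (R : realType) (V : normedModType R) (G : set (V -> R)) (v : V).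
Hypothesis HG : forall f, G f ->
  exists2 df, alg G df & forall x, is_derive x v f (df x).

Lemma alg_closed f : alg G f ->
  exists2 df, alg G df & forall x, is_derive x v f (df x).
Proof.
elim=> {f}.
- exact: HG.
- by move=> c; exists (fun=> 0); [exact: alg_cst|move=> x; exact: is_derive_cst].
- move=> f g _ [df af fP] _ [dg ag gP].
  by exists (fun x => df x + dg x) => [|x]; [exact: alg_add|exact: is_deriveD].
- move=> f g af [df adf fP] ag [dg adg gP].
  exists (fun x => f x * dg x + g x * df x) => [|x].
    by apply: alg_add; apply: alg_mul.
  exact: is_deriveM.
- move=> f af [df adf fP] f0.
  exists (fun x => - 1 * ((f x)^-1 * (f x)^-1 * df x)) => [|x].
    apply: alg_mul; first exact: alg_cst.
    by apply: alg_mul => //; apply: alg_mul; apply: alg_inv.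
  have [fd fe] := fP x.
  apply: DeriveDef; first exact: derivableV.
  rewrite deriveV// fe /GRing.scale/= mulN1r mulNr.
  by rewrite -invfM expr2.
- move=> h f hs af [df adf fP].
  exists (fun x => (derive1 h) (f x) * df x) => [|x].
    by apply: alg_mul => //; exact: (alg_comp (smooth1_derive hs) af).
  apply: is_derive_comp1 => //.
  apply: DeriveDef; first exact: (hs 0%N).
  by rewrite derive1E.
Qed.

End alg_closed.

Lemma smooth1_continuous (R : realType) (h : R -> R) : smooth1 h -> continuous h.
Proof.
move=> hs x; apply: differentiable_continuous; apply/derivable1_diffP.
exact: (hs 0%N).
Qed.

Lemma alg_continuous (R : realType) (V : normedModType R) (G : set (V -> R)) f :
  (forall f, G f -> continuous f) -> alg G f -> continuous f.
Proof.
move=> HG; elim=> {f}.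
- exact: HG.
- by move=> c x; exact: cvg_cst.
- by move=> f g _ cf _ cg x; apply: cvgD; [exact: cf|exact: cg].
- by move=> f g _ cf _ cg x; apply: cvgM; [exact: cf|exact: cg].
- by move=> f _ cf f0 x; apply: cvgV => //; exact: cf.
- move=> h f hs _ cf x; apply: (@continuous_comp _ _ _ f h); first exact: cf.
  exact: smooth1_continuous.
Qed.

Lemma alg_smooth1 (R : realType) (G : set (R -> R)) :
  (forall f, G f -> exists2 df, alg G df & forall x, is_derive x (1 : R) f (df x)) ->
  forall f, alg G f -> smooth1 f.
Proof.
move=> HG; apply: smooth1_coind => f /(alg_closed HG)[df adf fP].
split=> [x|]; first by have [] := fP x.
rewrite (_ : derive1 f = df)//; apply/funext => x; rewrite derive1E.
by have [_ ->] := fP x.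
Qed.

Lemma alg_smooth (R : realType) (G : set (R3 R -> R)) :
  (forall f, G f -> continuous f) ->
  (forall f i, G f ->
     exists2 df, alg G df & forall x, is_derive x (basis3 R i) f (df x)) ->
  forall f, alg G f -> smooth f.
Proof.
move=> cG HG; apply: smooth_coind => f af; split.
  exact: alg_continuous af.
move=> i; have [df adf fP] := alg_closed (fun f => @HG f i) af.
split=> [x|]; first by have [] := fP x.
rewrite (_ : partial i f = df)//; apply/funext => x; rewrite /partial.
by have [_ ->] := fP x.
Qed.

Lemma near_eq_is_derive (R : realType) (V : normedModType R) (f g : V -> R)
    (x v : V) (d : R) :
  (\near x, f x = g x) -> is_derive x v f d -> is_derive x v g d.
Proof.
move=> fg [fd fe]; apply: DeriveDef; first exact: near_eq_derivable fd.
by rewrite -fe; apply/esym; apply: near_eq_derive.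
Qed.

(* Powers of [1/x] are built in so that the family is stable under
   differentiation. *)
Definition flat (R : realType) (k : nat) (x : R) : R :=
  if 0 < x then x^-1 ^+ k * expR (- x^-1) else 0.

Lemma flat_ge0 (R : realType) k (x : R) : 0 <= flat k x.
Proof.
rewrite /flat; case: ifPn => // x0.
by rewrite mulr_ge0 ?expR_ge0// exprn_ge0// invr_ge0 ltW.
Qed.

(** The exponential at y = 1/x dominates y^(k+1) / (k+1)!. The bound serves at 0, where the
    difference quotient of [flat k] is [flat k.+1]. *)
Lemma flat_le (R : realType) k (x : R) : flat k x <= (k.+1)`!%:R * `|x|.
Proof.
rewrite /flat; case: ifPn => [x0|_]; last by rewrite mulr_ge0.
have y0 : 0 < x^-1 by rewrite invr_gt0.
have e : x^-1 ^+ k.+1 <= (k.+1)`!%:R * expR (x^-1).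
  have := expR_ge1Dxn k (ltW y0); set E := expR _ => H.
  rewrite -ler_pdivrMl ?ltr0n ?fact_gt0// mulrC.
  by apply: le_trans H; rewrite lerDr.
rewrite gtr0_norm// expRN ler_pdivrMr ?expR_gt0// mulrAC.
rewrite -[leLHS](@mulrK _ x^-1) ?unitfE ?gt_eqF// -exprSr invrK.
by rewrite ler_pM2r.
Qed.

Lemma is_derive_flat (R : realType) k (x : R) :
  is_derive x (1 : R) (flat k) (flat k.+2 x - k%:R * flat k.+1 x).
Proof.
have [x0|x0|->] := ltrgtP x 0.
- rewrite [X in is_derive _ _ _ X](_ : _ = 0); last first.
    by rewrite /flat (lt_gtF x0) mulr0 subrr.
  apply: near_eq_is_derive (is_derive_cst (0 : R) x (1 : R)).
  near=> y; rewrite /flat ifF//; apply/negbTE; rewrite -leNgt ltW//.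
  by near: y; exact: lt_nbhsl.
- apply: (@near_eq_is_derive R R (fun y => y^-1 ^+ k * expR (- y^-1))).
    near=> y; rewrite /flat ifT//.
    by near: y; exact: lt_nbhsr.
  have xn0 : x != 0 by rewrite gt_eqF.
  have dinv : is_derive x (1 : R) (fun y : R => y^-1) (- x ^- 2).
    apply: DeriveDef; first exact: derivableV.
    by rewrite deriveV// derive_id [_ *: _]mulr1.
  have := is_deriveX k dinv; rewrite exprfctE => dX.
  have dN := is_deriveN dinv.
  have dE := @is_derive_comp1 R R expR (- (fun y : R => y^-1)) x 1 _ _
    (is_derive_expR (- x^-1)) dN.
  have dM := is_deriveM dX dE; apply: (@is_derive_eq R R R _ x 1 _ _ dM).
  rewrite /flat x0 /GRing.scale /= -exprVn.
  have -> : expR ((- (fun y : R => y^-1)) x) = expR (- x^-1) by [].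
  move: (expR _) => E; move: x^-1 => y {dX dN dE dM dinv}.
  by case: k => [|k] /=; rewrite ?exprS; ring.
- rewrite [X in is_derive _ _ _ X](_ : _ = 0); last first.
    by rewrite /flat ltxx mulr0 subrr.
  have H : (fun h : R => h^-1 *: ((flat k \o shift 0) (h *: (1 : R)) - flat k 0)) @ 0^' --> (0 : R).
    apply/cvgr0Pnorm_lt => e e0; near=> h.
    have h0 : h != 0 by near: h; exact: nbhs_dnbhs_neq.
    rewrite /= addr0 [h *: _]mulr1 {2}/flat ltxx subr0 [_ *: _]/GRing.scale/=.
    have -> : h^-1 * flat k h = flat k.+1 h.
      by rewrite /flat; case: ifPn => _; rewrite ?mulr0// mulrA -exprS.
    rewrite ger0_norm ?flat_ge0//; apply: le_lt_trans (flat_le _ _) _.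
    rewrite mulrC -ltr_pdivlMr ?ltr0n ?fact_gt0//.
    near: h; apply: dnbhs0_lt; rewrite divr_gt0// ltr0n fact_gt0//.
  apply: DeriveDef; first by apply/cvg_ex; exists 0.
  exact: cvg_lim H.
Unshelve. all: by end_near. Qed.

Lemma flat_alg_smooth1 (R : realType) (f : R -> R) :
  alg (fun g => g = id \/ exists k, g = flat k) f -> smooth1 f.
Proof.
apply: alg_smooth1 => g [->|[k ->]].
  by exists (fun=> 1); [exact: alg_cst|move=> x; exact: is_derive_id].
exists (fun x => flat k.+2 x + (- k%:R) * flat k.+1 x) => [|x].
  apply: alg_add; [|apply: alg_mul; [exact: alg_cst|]];
    by apply: alg_gen; right; eexists.
by rewrite mulNr; exact: is_derive_flat.
Qed.

(** The usual smooth transition: the two terms of the denominator never vanish together, so the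
    quotient is smooth, exactly 0 up to 0 and exactly 1 from 1 on. *)
Definition step (R : realType) (x : R) : R :=
  flat 0 x / (flat 0 x + flat 0 (1 - x)).

Lemma step_den_gt0 (R : realType) (x : R) : 0 < flat 0 x + flat 0 (1 - x).
Proof.
have f_gt0 (y : R) : 0 < y -> 0 < flat 0 y.
  by move=> y0; rewrite /flat y0 expr0 mul1r expR_gt0.
have [x0|x0] := ltP 0 x.
  by rewrite ltr_wpDr ?flat_ge0// f_gt0.
by rewrite ltr_wpDl ?flat_ge0// f_gt0//; lra.
Qed.

Lemma step_le0 (R : realType) (x : R) : x <= 0 -> step x = 0.
Proof. by move=> x0; rewrite /step {1}/flat ltNge x0 mul0r. Qed.

Lemma step_ge1 (R : realType) (x : R) : 1 <= x -> step x = 1.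
Proof.
move=> x1; have := step_den_gt0 x; rewrite /step [flat 0 (1 - x)]/flat.
by rewrite (_ : 0 < 1 - x = false) ?addr0 => [f0|]; last (by apply/negbTE; rewrite -leNgt; lra); rewrite divff ?gt_eqF.
Qed.

Lemma step_ge0 (R : realType) (x : R) : 0 <= step x.
Proof. by rewrite divr_ge0 ?flat_ge0// ltW// step_den_gt0. Qed.

Lemma step_le1 (R : realType) (x : R) : step x <= 1.
Proof. by rewrite ler_pdivrMr ?step_den_gt0// mul1r lerDl flat_ge0. Qed.

Lemma step_smooth1 (R : realType) : smooth1 (@step R).
Proof.
have ff : smooth1 (@flat R 0).
  by apply: flat_alg_smooth1; apply: alg_gen; right; exists 0%N.
have af : alg (fun g => g = id \/ exists k, g = @flat R k) (flat 0).
  by apply: alg_gen; right; exists 0%N.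
have af1 : alg (fun g => g = id \/ exists k, g = @flat R k) (fun x => flat 0 (1 + (-1) * x)).
  apply: (alg_comp ff); apply: alg_add; first exact: alg_cst.
  by apply: alg_mul; [exact: alg_cst|apply: alg_gen; left].
apply: flat_alg_smooth1; apply: alg_mul => //.
have E : (fun x : R => flat 0 (1 + (-1) * x)) = (fun x => flat 0 (1 - x)).
  by apply/funext => x; rewrite mulN1r.
rewrite E in af1; apply: alg_inv; first exact: alg_add.
by move=> x; rewrite gt_eqF// step_den_gt0.
Qed.

(** * Lebesgue measure on three-dimensional space *)

Notation mR R := (measurableTypeR R).
Notation M3 R := (mR R * mR R * mR R)%type.

(* [leb2] and [vol3] are aliases whose only purpose is to carry the
   sigma-finiteness instances that Fubini requires. *)
Definition leb2 (R : realType) : set (mR R * mR R) -> \bar R := (@lebesgue_measure R \x @lebesgue_measure R)%E.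
HB.instance Definition _ (R : realType) := Measure.copy (@leb2 R) (@lebesgue_measure R \x @lebesgue_measure R)%E.
Definition vol3 (R : realType) : set (mR R * mR R * mR R) -> \bar R := leb3 R.
HB.instance Definition _ (R : realType) := Measure.copy (@vol3 R) (leb3 R).
Definition icube (R : realType) (n : nat) : set R := `[- n%:R, n%:R]%classic.

Lemma lebesgue_icube (R : realType) n : lebesgue_measure (@icube R n) = (n%:R *+ 2)%:E.
Proof.
rewrite /icube lebesgue_measure_itv/= lte_fin.
case: ifPn => [_|]; first by rewrite opprK mulr2n EFinD.
case: n => [|n]; first by rewrite mul0rn.
by rewrite (lt_le_trans _ (ler0n _ _))// oppr_lt0 ltr0n.
Qed.

Lemma bigcup_icube (R : realType) : \bigcup_n (@icube R n) = setT.
Proof.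
apply/seteqP; split=> // x _; have [n xn] : exists n : nat, `|x| <= n%:R.
  by exists (Num.trunc `|x|).+1; rewrite ltW// truncnS_gt.
by exists n => //; rewrite /icube/= in_itv/= -ler_norml.
Qed.

Lemma icube_homo (R : realType) : {homo @icube R : n m / (n <= m)%N >-> n `<=` m}.
Proof.
move=> n m nm x; rewrite /icube/= !in_itv/= -!ler_norml => /le_trans; apply.
by rewrite ler_nat.
Qed.

Lemma leb2E (R : realType) (A B : set (mR R)) : measurable A -> measurable B ->
  leb2 (A `*` B) = (lebesgue_measure A * lebesgue_measure B)%E.
Proof. exact: product_measure1E. Qed.

Lemma vol3E (R : realType) (A B C : set (mR R)) :
  measurable A -> measurable B -> measurable C ->
  vol3 (A `*` B `*` C) = (lebesgue_measure A * lebesgue_measure B * lebesgue_measure C)%E.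
Proof.
move=> mA mB mC; rewrite -leb2E//.
exact: (@product_measure1E _ _ _ _ _ (@leb2 R) (@lebesgue_measure R) _ _ (measurableX mA mB) mC).
Qed.

Lemma leb2_sigma_finite (R : realType) : sigma_finite setT (@leb2 R).
Proof.
exists (fun n => @icube R n `*` @icube R n).
  apply/esym; rewrite -subTset => -[x y] _.
  have [n _ xn] : (\bigcup_n (@icube R n)) x by rewrite bigcup_icube.
  have [m _ ym] : (\bigcup_n (@icube R n)) y by rewrite bigcup_icube.
  exists (maxn n m) => //; split => /=; [apply: icube_homo xn|apply: icube_homo ym].
    exact: leq_maxl.
  exact: leq_maxr.
move=> n; split; first by apply: measurableX; exact: measurable_itv.
by rewrite leb2E ?lebesgue_icube; [exact: ltry|exact: measurable_itv..].
Qed.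
HB.instance Definition _ (R : realType) := Measure_isSigmaFinite.Build _ _ _ (@leb2 R) (@leb2_sigma_finite R).
Definition box0 (R : realType) n := @icube R n `*` @icube R n `*` @icube R n.

Lemma bigcup_box0 (R : realType) : \bigcup_n (@box0 R n) = setT.
Proof.
rewrite -subTset => -[[x y] z] _.
have [n _ xn] : (\bigcup_n (@icube R n)) x by rewrite bigcup_icube.
have [m _ ym] : (\bigcup_n (@icube R n)) y by rewrite bigcup_icube.
have [k _ zk] : (\bigcup_n (@icube R n)) z by rewrite bigcup_icube.
exists (maxn n (maxn m k)) => //; split => /=.
  by split=> /=; [apply: icube_homo xn|apply: icube_homo ym]; rewrite !leq_max leqnn ?orbT.
by apply: icube_homo zk; rewrite !leq_max leqnn ?orbT.
Qed.

Lemma vol3_sigma_finite (R : realType) : sigma_finite setT (@vol3 R).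
Proof.
exists (@box0 R); first by rewrite bigcup_box0.
move=> n; split; first by do 2?apply: measurableX; exact: measurable_itv.
by rewrite vol3E ?lebesgue_icube; [exact: ltry|exact: measurable_itv..].
Qed.
HB.instance Definition _ (R : realType) := Measure_isSigmaFinite.Build _ _ _ (@vol3 R) (@vol3_sigma_finite R).

Lemma measurable_ball3 (R : realType) (c : R3 R) (e : R) :
  measurable (ball c e : set (M3 R)).
Proof.
have -> : ball c e = (ball c.1.1 e `*` ball c.1.2 e `*` ball c.2 e : set (M3 R)).
  by apply/seteqP; split => -[[x y] z]/= [[]].
by do 2?apply: measurableX; exact: measurable_ball.
Qed.

(** Balls of the max norm are products of intervals, hence measurable, and an open set is the union
    of the countably many balls with rational centre and radius an inverse integer that it
    contains. *)
Lemma open_measurable3 (R : realType) (U : set (R3 R)) :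
  open U -> measurable (U : set (M3 R)).
Proof.
move=> oU.
pose B (q : rat * rat * rat * nat) : set (M3 R) :=
  ball ((ratr q.1.1.1, ratr q.1.1.2, ratr q.1.2) : R3 R) (q.2.+1%:R^-1 : R).
pose F q : set (M3 R) := if `[< B q `<=` U >] then B q else set0.
rewrite (_ : U = \bigcup_q F q).
  apply: countable_bigcupT_measurable; first exact: countableP.
  by move=> q; rewrite /F; case: ifPn => // _; exact: measurable_ball3.
apply/seteqP; split => [x Ux|x [q _]]; last first.
  by rewrite /F; case: asboolP => // qU /qU.
have /nbhs_ballP[e /= e0 eU] : nbhs x U by rewrite nbhsE; exists U.
have [n ne] : exists n : nat, n.+1%:R^-1 + n.+1%:R^-1 < e.
  exists (Num.trunc (2 / e)).
  have h : 2 / e < (Num.trunc (2 / e)).+1%:R by rewrite truncnS_gt.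
  rewrite ltr_pdivrMr// in h.
  have N0 : 0 < (Num.trunc (2 / e)).+1%:R :> R by rewrite ltr0n.
  by rewrite -(ltr_pM2l N0) mulrDr mulfV ?gt_eqF.
have n0 : 0 < n.+1%:R^-1 :> R by rewrite invr_gt0 ltr0n.
have rq (y : R) : exists q : rat, `|ratr q - y| < n.+1%:R^-1.
  have [|q] := @rat_in_itvoo R (y - n.+1%:R^-1) (y + n.+1%:R^-1); first by rewrite ltrBlDr -addrA ltrDl addr_gt0.
  by rewrite in_itv/= => yq; exists q; rewrite ltr_distl.
have [q1 h1] := rq x.1.1; have [q2 h2] := rq x.1.2; have [q3 h3] := rq x.2.
have Bx : B (q1, q2, q3, n) x by split; [split|].
exists (q1, q2, q3, n) => //; rewrite /F; case: asboolP => // -[] y qy.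
apply: eU; apply: (@le_ball _ _ _ (n.+1%:R^-1 + n.+1%:R^-1)); first exact: ltW.
by apply: ball_triangle qy; exact: ball_sym.
Qed.

Lemma continuous_measurable3 (R : realType) (f : R3 R -> R) :
  continuous f -> measurable_fun [set: M3 R] f.
Proof.
move=> /continuousP cf; apply: (measurability _ (RGenOpens.measurableE R)).
move=> _ [_ [a [b ->] <-]]; rewrite setTI; apply: open_measurable3.
exact/cf/interval_open.
Qed.

Lemma mule_cancel (R : realType) (r s1 s2 : R) (x y : \bar R) :
  r * (s1 * s2) = 1 -> (r%:E * ((s1%:E * x) * (s2%:E * y)) = x * y)%E.
Proof. move=> rs; rewrite -[(s1%:E * x * _)%E]muleA [(x * (s2%:E * y))%E]muleCA.
by rewrite [(s1%:E * _)%E]muleA [LHS]muleA -!EFinM rs mul1e. Qed.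

Section affine.
Context (R : realType) (b : R) (v : R3 R).
Hypothesis b0 : 0 < b.

Let binv_ge0 n : 0 <= b^-1 ^+ n. Proof. by rewrite exprn_ge0// invr_ge0 ltW. Qed.

Let aff1 (a : R) (x : mR R) : mR R := a + b * x.
Let aff2 (x : mR R * mR R) : (mR R * mR R)%type := (aff1 v.1.1 x.1, aff1 v.1.2 x.2).
Let aff3 (x : M3 R) : M3 R := (aff2 x.1, aff1 v.2 x.2).

Let maff1 a : measurable_fun [set: mR R] (aff1 a).
Proof. by apply: measurable_funD; [exact: measurable_cst|exact: mulrl_measurable]. Qed.

Let maff2 : measurable_fun [set: mR R * mR R] aff2.
Proof.
by apply: measurable_fun_pair; apply: measurableT_comp (maff1 _) _;
  [exact: measurable_fst|exact: measurable_snd].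
Qed.

Let maff3 : measurable_fun [set: M3 R] aff3.
Proof.
apply: measurable_fun_pair; [apply: measurableT_comp maff2 _|apply: measurableT_comp (maff1 _) _];
  [exact: measurable_fst|exact: measurable_snd].
Qed.

(** Uniqueness of Lebesgue measure: [b] times the pushforward gives half-open intervals their
    length. Dimensions two and three follow from uniqueness of product measures. *)
Let lebesgue_affine a (A : set (mR R)) : measurable A ->
  lebesgue_measure (aff1 a @^-1` A) = (b^-1%:E * lebesgue_measure A)%E.
Proof.
move=> mA.
pose m := mscale (NngNum (ltW b0)) (pushforward (@lebesgue_measure R) (aff1 a)).
have mS X : m (maff1 a) X = (b%:E * lebesgue_measure (aff1 a @^-1` X))%E by [].
have mE : lebesgue_measure A = m (maff1 a) A.
  apply: lebesgue_measure_unique => // _ [[x y]] _ <-.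
  change (lebesgue_measure `]x, y] = b%:E * lebesgue_measure (aff1 a @^-1` `]x, y]))%E.
  rewrite (_ : aff1 a @^-1` _ = `]b^-1 * (x - a), b^-1 * (y - a)]%classic); last first.
    apply/seteqP; split => z /=; rewrite !in_itv/= /aff1;
      by rewrite ltr_pdivrMl// ler_pdivlMl// ltrBlDl lerBrDl.
  rewrite !lebesgue_measure_itv/= !lte_fin ltr_pM2l ?invr_gt0// ltrD2r.
  case: ifPn => _; last by rewrite mule0.
  rewrite -!EFinB -EFinM; congr EFin; rewrite -mulrBr mulVKf ?gt_eqF//.
  by rewrite opprB addrA subrK.
rewrite mE mS muleA -EFinM mulVf ?mul1e// gt_eqF//.
Qed.

Let leb2_affine (A : set (mR R * mR R)) : measurable A ->
  leb2 (aff2 @^-1` A) = ((b^-1 ^+ 2)%:E * leb2 A)%E.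
Proof.
move=> mA.
pose m := mscale (NngNum (exprn_ge0 2 (ltW b0))) (pushforward (@leb2 R) aff2).
have mS X : m maff2 X = ((b ^+ 2)%:E * leb2 (aff2 @^-1` X))%E by [].
have mE : leb2 A = m maff2 A.
  apply: (product_measure_unique (m1 := @lebesgue_measure R) (m2 := @lebesgue_measure R)) => // B C mB mC.
  change ((b ^+ 2)%:E * leb2 (aff2 @^-1` (B `*` C)) = lebesgue_measure B * lebesgue_measure C)%E.
  rewrite (_ : aff2 @^-1` _ = (aff1 v.1.1 @^-1` B) `*` (aff1 v.1.2 @^-1` C))//.
  rewrite leb2E; [|by rewrite -[X in measurable X]setTI; exact: maff1..].
  rewrite -[RHS](@mule_cancel _ (b ^+ 2) b^-1 b^-1); last first.
    by rewrite -expr2 -exprMn mulfV ?gt_eqF// expr1n.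
  by congr (_ * (_ * _))%E; exact: lebesgue_affine.
rewrite mE mS muleA -EFinM -exprMn mulVf ?gt_eqF//.
by rewrite expr1n mul1e.
Qed.

Let vol3_affine (A : set (M3 R)) : measurable A ->
  leb3 R (aff3 @^-1` A) = ((b^-1 ^+ 3)%:E * leb3 R A)%E.
Proof.
move=> mA.
pose m := mscale (NngNum (exprn_ge0 3 (ltW b0))) (pushforward (@vol3 R) aff3).
have mS X : m maff3 X = ((b ^+ 3)%:E * leb3 R (aff3 @^-1` X))%E by [].
have mE : leb3 R A = m maff3 A.
  apply: (product_measure_unique (m1 := @leb2 R) (m2 := @lebesgue_measure R)) => // B C mB mC.
  change ((b ^+ 3)%:E * leb3 R (aff3 @^-1` (B `*` C)) = leb2 B * lebesgue_measure C)%E.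
  rewrite (_ : aff3 @^-1` _ = (aff2 @^-1` B) `*` (aff1 v.2 @^-1` C))//.
  rewrite [leb3 R _](@product_measure1E _ _ _ _ _ (@leb2 R) (@lebesgue_measure R));
    [|rewrite -[X in measurable X]setTI; first [exact: maff2|exact: maff1]..].
  rewrite -[RHS](@mule_cancel _ (b ^+ 3) (b^-1 ^+ 2) b^-1); last first.
    by rewrite -exprSr -exprMn mulfV ?gt_eqF// expr1n.
  by congr (_ * (_ * _))%E; [exact: leb2_affine|exact: lebesgue_affine].
rewrite mE mS muleA -EFinM -exprMn mulVf ?gt_eqF//.
by rewrite expr1n mul1e.
Qed.

Lemma measurable_affine : measurable_fun [set: M3 R] (fun x : R3 R => v + b *: x : M3 R).
Proof. exact: maff3. Qed.

Lemma ge0_integral_affine (f : R3 R -> \bar R) :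
  measurable_fun [set: M3 R] f -> (forall x, 0 <= f x)%E ->
  (\int[leb3 R]_x f (v + b *: x)%R = (b^-1 ^+ 3)%:E * \int[leb3 R]_x f x)%E.
Proof.
move=> mf f0.
have := @ge0_integral_pushforward _ _ _ _ _ _ maff3 (leb3 R) setT f measurableT mf (fun x _ => f0 x).
rewrite preimage_setT => <-.
rewrite -(@ge0_integral_mscale _ _ _ (leb3 R) setT measurableT (NngNum (binv_ge0 3)) f mf)//.
by apply: eq_measure_integral => A mA _; exact: vol3_affine.
Qed.

Lemma integral_affine (f : R3 R -> \bar R) :
  (leb3 R).-integrable setT f ->
  (\int[leb3 R]_x f (v + b *: x)%R = (b^-1 ^+ 3)%:E * \int[leb3 R]_x f x)%E.
Proof.
move=> fi; have mf := measurable_int _ fi.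
have h1 := ge0_integral_affine (measurable_funepos mf) (funepos_ge0 f).
have h2 := ge0_integral_affine (measurable_funeneg mf) (funeneg_ge0 f).
transitivity (\int[leb3 R]_x f^\+ (v + b *: x)%R - \int[leb3 R]_x f^\- (v + b *: x)%R)%E.
  rewrite [LHS]integralE; congr (_ - _)%E.
    by apply: eq_integral => x _; rewrite !funeposE.
  by apply: eq_integral => x _; rewrite !funenegE.
rewrite h1 h2 -muleBr//; last exact: integrable_add_def.
by congr (_ * _)%E; rewrite [RHS]integralE.
Qed.

End affine.

Section dilation_translation.
Context (R : realType) (b : R) (v : R3 R).
Hypothesis b0 : 0 < b.

Lemma measurable_dilation : measurable_fun [set: M3 R] (fun x : R3 R => b *: x : M3 R).
Proof.
have := measurable_affine b (0 : R3 R).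
by under eq_fun do rewrite add0r.
Qed.

Lemma ge0_integral_dilation (f : R3 R -> \bar R) :
  measurable_fun [set: M3 R] f -> (forall x, 0 <= f x)%E ->
  (\int[leb3 R]_x f (b *: x)%R = (b^-1 ^+ 3)%:E * \int[leb3 R]_x f x)%E.
Proof.
move=> mf f0; rewrite -(ge0_integral_affine 0 b0 mf f0).
by under [RHS]eq_integral do rewrite add0r.
Qed.

Lemma integral_dilation (f : R3 R -> \bar R) : (leb3 R).-integrable setT f ->
  (\int[leb3 R]_x f (b *: x)%R = (b^-1 ^+ 3)%:E * \int[leb3 R]_x f x)%E.
Proof.
move=> fi; rewrite -(integral_affine 0 b0 fi).
by under [RHS]eq_integral do rewrite add0r.
Qed.

Lemma measurable_translation : measurable_fun [set: M3 R] (fun x : R3 R => v + x : M3 R).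
Proof.
have := measurable_affine 1 v.
by under eq_fun do rewrite scale1r.
Qed.

Lemma integral_translation (f : R3 R -> \bar R) : (leb3 R).-integrable setT f ->
  (\int[leb3 R]_x f (v + x)%R = \int[leb3 R]_x f x)%E.
Proof.
move=> fi; have := integral_affine v ltr01 fi.
rewrite invr1 expr1n mul1e => <-.
by under [RHS]eq_integral do rewrite scale1r.
Qed.

End dilation_translation.

(** * Test functions and the fundamental lemma *)

Section smooth3.
Context (R : realType).
Implicit Types (i j : 'I_3) (x y v : R3 R) (f g u : R3 R -> R).

Definition crd i x : R := if i == 0 :> nat then x.1.1 else if i == 1 :> nat then x.1.2 else x.2.

Lemma crd_basis i j : crd i (basis3 R j) = (i == j)%:R.
Proof. by case: i j => [[|[|[|//]]] ?] [[|[|[|//]]] ?]. Qed.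

Lemma crd_linear i (h : R) v x : crd i (h *: v + x) = h * crd i v + crd i x.
Proof. by rewrite /crd; case: ifP => // _; case: ifP. Qed.

Lemma norm_crd i x : `|crd i x| <= `|x|.
Proof.
rewrite !prod_normE /crd !le_max.
by case: ifP => _; [|case: ifP => _]; rewrite lexx ?orbT.
Qed.

Lemma crd_le x (r : R) : (forall i, `|crd i x| <= r) -> `|x| <= r.
Proof.
move=> H; rewrite !prod_normE !ge_max.
have := H 0; have := H 1; have := H (Ordinal (ltnSn 2)).
by rewrite /crd/= => -> -> ->.
Qed.

Lemma is_derive_crd i x v : is_derive x v (crd i) (crd i v).
Proof.
have E : (fun h : R => h^-1 *: ((crd i \o shift x) (h *: v) - crd i x)) @ 0^'
    --> crd i v.
  apply: cvg_near_cst; near=> h.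
  have h0 : h != 0 by near: h; exact: nbhs_dnbhs_neq.
  by rewrite /= crd_linear addrK /GRing.scale/= mulKf.
by apply: DeriveDef; [apply/cvg_ex; exists (crd i v)|exact: cvg_lim E].
Unshelve. all: by end_near. Qed.

Lemma crd_continuous i : continuous (crd i).
Proof.
case: i => [[|[|[|//]]] p] x.
- by apply: (@continuous_comp _ _ _ fst fst); exact: cvg_fst.
- by apply: (@continuous_comp _ _ _ fst snd); [exact: cvg_fst|exact: cvg_snd].
- exact: cvg_snd.
Qed.

Lemma smooth_continuous f : smooth f -> continuous f.
Proof. by move=> /(_ [::])[]. Qed.

Lemma smooth_is_derive f i x : smooth f -> is_derive x (basis3 R i) f (partial i f x).
Proof. by move=> /(_ [::])[_ /(_ i x)] fd; exact: DeriveDef. Qed.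

Lemma smooth_partial f i : smooth f -> smooth (partial i f).
Proof. by move=> fs s; have := fs (rcons s i); rewrite foldr_rcons. Qed.

Lemma smooth_alg f : alg (fun g => smooth g \/ exists i, g = crd i) f -> smooth f.
Proof.
apply: alg_smooth => [g [gs|[i ->]]|g i [gs|[j ->]]].
- exact: smooth_continuous.
- exact: crd_continuous.
- exists (partial i g) => [|x]; last exact: smooth_is_derive.
  by apply: alg_gen; left; exact: smooth_partial.
- by exists (fun=> crd j (basis3 R i)) => [|x]; [exact: alg_cst|exact: is_derive_crd].
Qed.

Lemma alg_smooth_gen f : smooth f -> alg (fun g => smooth g \/ exists i, g = crd i) f.
Proof. by move=> fs; apply: alg_gen; left. Qed.

Lemma smoothM f g : smooth f -> smooth g -> smooth (fun x => f x * g x).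
Proof. by move=> fs gs; apply: smooth_alg; apply: alg_mul; exact: alg_smooth_gen. Qed.

Lemma smooth_cst (c : R) : smooth (fun _ : R3 R => c).
Proof. by apply: smooth_alg; exact: alg_cst. Qed.

Lemma smooth_crd i : smooth (crd i).
Proof. by apply: smooth_alg; apply: alg_gen; right; exists i. Qed.

Lemma smooth_comp h f : smooth1 h -> smooth f -> smooth (fun x => h (f x)).
Proof. by move=> hs fs; apply: smooth_alg; apply: alg_comp => //; exact: alg_smooth_gen. Qed.

Lemma partialE f (x : R3 R) i (d : R) : is_derive x (basis3 R i) f d -> partial i f x = d.
Proof. by case. Qed.

Lemma partialM f g i x : smooth f -> smooth g ->
  partial i (fun x => f x * g x) x = f x * partial i g x + g x * partial i f x.
Proof.
move=> fs gs; apply: partialE.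
by have := is_deriveM (smooth_is_derive i x fs) (smooth_is_derive i x gs).
Qed.

Lemma partialD f g i x : smooth f -> smooth g ->
  partial i (fun x => f x + g x) x = partial i f x + partial i g x.
Proof.
move=> fs gs; apply: partialE.
by have := is_deriveD (smooth_is_derive i x fs) (smooth_is_derive i x gs).
Qed.

Lemma partial_cst (c : R) i x : partial i (fun _ : R3 R => c) x = 0.
Proof. by apply: partialE; exact: is_derive_cst. Qed.

Lemma partial_crd i j x : partial i (crd j) x = (j == i)%:R.
Proof. by apply: partialE; rewrite -crd_basis; exact: is_derive_crd. Qed.

Lemma partial_comp h f i x : smooth1 h -> smooth f ->
  partial i (fun x => h (f x)) x = derive1 h (f x) * partial i f x.
Proof.
move=> hs fs; apply: partialE; apply: is_derive_comp1; last exact: smooth_is_derive.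
by apply: DeriveDef; [exact: (hs 0%N)|rewrite derive1E].
Qed.

Definition cube y (r : R) : set (R3 R) := [set x | `|x - y| <= r].

Lemma crdB i x y : crd i (x - y) = crd i x - crd i y.
Proof. by rewrite addrC -scaleN1r crd_linear mulN1r addrC. Qed.

Lemma cubeE y r : cube y r =
  (`[y.1.1 - r, y.1.1 + r]%classic `*` `[y.1.2 - r, y.1.2 + r]%classic `*`
   `[y.2 - r, y.2 + r]%classic).
Proof.
have E (a b : R) : (`|a - b| <= r) = (a \in `[b - r, b + r]).
  by rewrite in_itv/= ler_distl.
apply/seteqP; split => x; rewrite /cube /= !prod_normE !ge_max !E.
  by move=> /andP[/andP[]].
by move=> [[-> ->] ->].
Qed.

Lemma compact_cube y r : compact (cube y r).
Proof. by rewrite cubeE; do 2?apply: compact_setX; exact: segment_compact. Qed.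

Lemma closed_cube y r : closed (cube y r).
Proof.
have cn : continuous (fun x : R3 R => `|x - y|).
  by move=> x; apply: cvg_norm; apply: cvgB => //; exact: cvg_cst.
by move/continuous_closedP : cn => H; exact: (H _ (@closed_le R r)).
Qed.

Lemma measurable_cube y r : measurable (cube y r : set (M3 R)).
Proof. by rewrite cubeE; do 2?apply: measurableX; exact: measurable_itv. Qed.

Lemma leb3_cube y r : 0 <= r -> leb3 R (cube y r) = ((r *+ 2) ^+ 3)%:E.
Proof.
move=> r0.
have E (a : R) : lebesgue_measure (`[a - r, a + r]%classic : set R) = (r *+ 2)%:E.
  rewrite lebesgue_measure_itv/= lte_fin ltrD2l.
  case: ifPn => [_|]; first by rewrite -EFinB opprB addrC addrA subrK mulr2n.
  by rewrite -leNgt => h; rewrite (_ : r = 0) ?mul0rn//; lra.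
rewrite cubeE.
have := @vol3E R _ _ _ (measurable_itv `[y.1.1 - r, y.1.1 + r])
  (measurable_itv `[y.1.2 - r, y.1.2 + r]) (measurable_itv `[y.2 - r, y.2 + r]).
rewrite !E -!EFinM => H; rewrite [LHS]H; congr EFin; rewrite !exprS; ring.
Qed.

Lemma test_functionP f : test_function f <->
  smooth f /\ exists M : R, forall x, M < `|x| -> f x = 0.
Proof.
split => [[fs cf]|[fs [M fM]]]; split => //.
  have [M [_ HM]] := compact_bounded cf.
  exists (M + 1) => x; apply: contraTeq => fx0; rewrite -leNgt.
  have M1 : M < M + 1 by rewrite ltrDl.
  by apply: (HM _ M1); exact: subset_closure.
apply: (subclosed_compact _ (@compact_cube 0 M)); first exact: closed_closure.
have -> : cube 0 M = closure (cube 0 M) by apply/closure_id; exact: closed_cube.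
apply: closure_subset => x /= fx0; rewrite /cube /= subr0 leNgt.
by apply: contra fx0 => /fM ->.
Qed.

Lemma test_smooth f : test_function f -> smooth f. Proof. by case. Qed.

Lemma test_functionM g f : smooth g -> test_function f ->
  test_function (fun x => g x * f x).
Proof.
move=> gs /test_functionP[fs [M fM]]; apply/test_functionP; split.
  exact: smoothM.
by exists M => x /fM ->; rewrite mulr0.
Qed.

Lemma test_function_partial f i : test_function f -> test_function (partial i f).
Proof.
move=> /test_functionP[fs [M fM]]; apply/test_functionP; split.
  exact: smooth_partial.
exists M => x Mx; apply: partialE.
apply: near_eq_is_derive (is_derive_cst (0 : R) x (basis3 R i)).
have cn : {for x, continuous (fun x : R3 R => `|x|)} by exact: norm_continuous.
have {}cn : \forall y \near x, M < `|y| by exact: (cn _ (lt_nbhsr Mx)).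
by apply: filterS cn => y /fM ->.
Qed.

Lemma test_function_bounded f : test_function f ->
  exists2 K : R, 0 <= K & forall x, `|f x| <= K.
Proof.
move=> /test_functionP[fs [M fM]].
have [M0|M0] := ltP M 0.
  by exists 0 => // x; rewrite fM ?normr0// (lt_le_trans M0).
have cf : {within cube 0 M, continuous (fun x => `|f x|)}.
  apply: continuous_subspaceT => x; apply: cvg_norm; exact: smooth_continuous.
have c0 : cube 0 M !=set0 by exists 0; rewrite /cube /= subrr normr0.
have [c _ cP] := compact_EVT_max c0 (@compact_cube 0 M) cf.
exists `|f c| => // x; have [xM|xM] := leP `|x| M.
  by apply: cP; rewrite inE /cube /= subr0.
by rewrite fM// normr0.
Qed.

Lemma L2P f : f \in Lfun (leb3 R) 2%:E <->
  measurable_fun [set: M3 R] f /\ (\int[leb3 R]_x (f x ^+ 2)%:E < +oo)%E.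
Proof.
split=> [fL|[mf fi]].
  split; first by move: fL; rewrite inE => /andP[]; rewrite !inE.
  have /integrableP[_] := Lfun2_integrable_sqr fL.
  by under eq_integral do rewrite /= ger0_norm ?sqr_ge0//.
rewrite inE; apply/andP; split; rewrite inE//= /finite_norm unlock /Lnorm.
apply: poweR_lty.
apply: le_lt_trans fi; rewrite le_eqVlt; apply/orP; left; apply/eqP.
apply: eq_integral => x _; by rewrite [LHS]poweR_EFin powR_mulrn// real_normK ?num_real.
Qed.

Lemma L2_measurable f : f \in Lfun (leb3 R) 2%:E -> measurable_fun [set: M3 R] f.
Proof. by move=> /L2P[]. Qed.

Lemma L2_dom f g (K : R) : f \in Lfun (leb3 R) 2%:E -> measurable_fun [set: M3 R] g ->
  (forall x, `|g x| <= K * `|f x|) -> g \in Lfun (leb3 R) 2%:E.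
Proof.
move=> /L2P[mf fi] mg gf; apply/L2P; split=> //.
apply: (@le_lt_trans _ _ (\int[leb3 R]_x (K ^+ 2 * f x ^+ 2)%:E)%E).
  apply: ge0_le_integral => //.
  - by move=> x _; rewrite lee_fin sqr_ge0.
  - by apply/measurable_EFinP; exact: measurable_funX.
  - by apply/measurable_EFinP; apply: measurable_funM => //; exact: measurable_funX.
  move=> x _; rewrite lee_fin -exprMn -[leLHS]real_normK ?num_real//.
  rewrite -[leRHS]real_normK ?num_real// lerXn2r ?nnegrE//.
  by rewrite (le_trans (gf x))// normrM ler_wpM2r// ler_norm.
under eq_integral do rewrite EFinM.
rewrite ge0_integralZl//; first by rewrite lte_mul_pinfty// lee_fin sqr_ge0.
- by apply/measurable_EFinP; exact: measurable_funX.
- by move=> x _; rewrite lee_fin sqr_ge0.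
- by rewrite lee_fin sqr_ge0.
Qed.

Lemma L2_add f g : f \in Lfun (leb3 R) 2%:E -> g \in Lfun (leb3 R) 2%:E ->
  (fun x => f x + g x) \in Lfun (leb3 R) 2%:E.
Proof.
have p1 : (1 <= 2%:E :> \bar R)%E by rewrite lee_fin ler1n.
by move=> fL gL; have [_ /(_ _ _ fL gL)] := @Lfun_addr_closed _ _ _ (leb3 R) _ p1.
Qed.

Lemma L2_mul f g : f \in Lfun (leb3 R) 2%:E -> g \in Lfun (leb3 R) 2%:E ->
  (leb3 R).-integrable setT (fun x => (f x * g x)%:E).
Proof. by move=> fL gL; apply/Lfun1_integrable; exact: Lfun2_mul_Lfun1. Qed.

Lemma L2_indic y (r : R) : 0 <= r -> \1_(cube y r) \in Lfun (leb3 R) 2%:E.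
Proof.
move=> r0; apply/L2P; split.
  by apply: measurable_indic; exact: measurable_cube.
under eq_integral do rewrite indicE -natrX expnS expn1 mulnb andbb -indicE.
by rewrite integral_indic ?setIT ?leb3_cube ?ltry//; exact: measurable_cube.
Qed.

Lemma L2_bounded f y (r K : R) : measurable_fun [set: M3 R] f -> 0 <= r ->
  (forall x, `|f x| <= K) -> (forall x, ~ cube y r x -> f x = 0) ->
  f \in Lfun (leb3 R) 2%:E.
Proof.
move=> mf r0 fK f0; apply: (L2_dom (K := K) (L2_indic y r0) mf) => x.
rewrite indicE; have [/set_mem xc|/negP xc] := boolP (x \in cube y r).
  by rewrite normr1 mulr1.
by rewrite f0 ?normr0 ?mulr0// => /mem_set.
Qed.

Lemma test_L2 f : test_function f -> f \in Lfun (leb3 R) 2%:E.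
Proof.
move=> tf; have [K K0 fK] := test_function_bounded tf.
have /test_functionP[fs [M fM]] := tf.
apply: (@L2_bounded _ 0 `|M| K) => //.
  by apply: continuous_measurable3; exact: smooth_continuous.
move=> x; rewrite /cube /= subr0 => /negP; rewrite -ltNge => h; apply: fM.
by rewrite (le_lt_trans _ h)// ler_norm.
Qed.

End smooth3.

Section fundamental.
Context (R : realType).
Implicit Types (x y a b : R3 R) (w : R3 R -> R).

(** No order between [a] and [b] is imposed: empty boxes keep the family stable under intersection,
    as the Dynkin argument requires. *)
Definition obox a b : set (M3 R) := `]a.1.1, b.1.1[%classic `*` `]a.1.2, b.1.2[%classic `*` `]a.2, b.2[%classic.

Let G : set (set (M3 R)) := [set B | exists a b, B = obox a b].

Lemma measurable_obox a b : measurable (obox a b).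
Proof. by do 2?apply: measurableX; exact: measurable_itv. Qed.

Lemma oboxI a b c d : exists a' b', obox a b `&` obox c d = obox a' b'.
Proof.
exists (Num.max a.1.1 c.1.1, Num.max a.1.2 c.1.2, Num.max a.2 c.2).
exists (Num.min b.1.1 d.1.1, Num.min b.1.2 d.1.2, Num.min b.2 d.2).
apply/seteqP; split => -[[x y] z]; rewrite /obox /= !in_itv/= ?gt_max ?lt_min.
  by move=> [[[/andP[-> ->] /andP[-> ->]] /andP[-> ->]] [[/andP[-> ->] /andP[-> ->]] /andP[-> ->]]].
by move=> [[/andP[/andP[-> ->] /andP[-> ->]] /andP[/andP[-> ->] /andP[-> ->]]] /andP[/andP[-> ->] /andP[-> ->]]].
Qed.

Lemma bigcup_itvoo : \bigcup_n (`]- n%:R, n%:R[%classic : set R) = setT.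
Proof.
apply/seteqP; split=> // x _; exists (Num.trunc `|x|).+1 => //=.
by rewrite in_itv/= -ltr_norml truncnS_gt.
Qed.

Lemma itvoo_homo : {homo (fun n : nat => `]- n%:R, n%:R[%classic : set R) : n m / (n <= m)%N >-> n `<=` m}.
Proof.
move=> n m nm x /=; rewrite !in_itv/= -!ltr_norml => /lt_le_trans; apply.
by rewrite ler_nat.
Qed.

(** The three coordinates are measurable for the sigma-algebra generated by the boxes, since an open
    slab is a countable union of boxes. Hence so is the identity, which is the nontrivial
    inclusion. *)
Lemma sigma_oboxE : measurable = <<s G >> :> set (set (M3 R)).
Proof.
apply/seteqP; split; last first.
  apply: smallest_sub; first exact: sigma_algebra_measurable.
  by move=> _ [a [b ->]]; exact: measurable_obox.
have mG A : <<s G >> A -> measurable (A : set (g_sigma_algebraType G)) by [].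
have mp1 : measurable_fun [set: g_sigma_algebraType G] (fun x : M3 R => x.1.1 : mR R).
  apply: (measurability _ (RGenOpens.measurableE R)) => _ [_ [c [d ->]] <-].
  rewrite setTI (_ : _ @^-1` _ =
    \bigcup_n obox (c, - n%:R, - n%:R) (d, n%:R, n%:R)).
    apply: bigcup_measurable => n _; apply: sub_sigma_algebra.
    by exists (c, - n%:R, - n%:R), (d, n%:R, n%:R).
  apply/seteqP; split => -[[x y] z] /=; last by move=> [n _ [[]]].
  move=> xcd; have [n _ xn] : (\bigcup_n (`]- n%:R, n%:R[%classic : set R)) y by rewrite bigcup_itvoo.
  have [m _ ym] : (\bigcup_n (`]- n%:R, n%:R[%classic : set R)) z by rewrite bigcup_itvoo.
  exists (maxn n m) => //; split; [split=> //|]; apply: itvoo_homo; [exact: leq_maxl|exact: xn|exact: leq_maxr|exact: ym].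
have mp2 : measurable_fun [set: g_sigma_algebraType G] (fun x : M3 R => x.1.2 : mR R).
  apply: (measurability _ (RGenOpens.measurableE R)) => _ [_ [c [d ->]] <-].
  rewrite setTI (_ : _ @^-1` _ =
    \bigcup_n obox (- n%:R, c, - n%:R) (n%:R, d, n%:R)).
    apply: bigcup_measurable => n _; apply: sub_sigma_algebra.
    by exists (- n%:R, c, - n%:R), (n%:R, d, n%:R).
  apply/seteqP; split => -[[x y] z] /=; last by move=> [n _ [[]]].
  move=> xcd; have [n _ xn] : (\bigcup_n (`]- n%:R, n%:R[%classic : set R)) x by rewrite bigcup_itvoo.
  have [m _ ym] : (\bigcup_n (`]- n%:R, n%:R[%classic : set R)) z by rewrite bigcup_itvoo.
  exists (maxn n m) => //; split; [split=> //|]; apply: itvoo_homo; [exact: leq_maxl|exact: xn|exact: leq_maxr|exact: ym].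
have mp3 : measurable_fun [set: g_sigma_algebraType G] (fun x : M3 R => x.2 : mR R).
  apply: (measurability _ (RGenOpens.measurableE R)) => _ [_ [c [d ->]] <-].
  rewrite setTI (_ : _ @^-1` _ =
    \bigcup_n obox (- n%:R, - n%:R, c) (n%:R, n%:R, d)).
    apply: bigcup_measurable => n _; apply: sub_sigma_algebra.
    by exists (- n%:R, - n%:R, c), (n%:R, n%:R, d).
  apply/seteqP; split => -[[x y] z] /=; last by move=> [n _ [[]]].
  move=> xcd; have [n _ xn] : (\bigcup_n (`]- n%:R, n%:R[%classic : set R)) x by rewrite bigcup_itvoo.
  have [m _ ym] : (\bigcup_n (`]- n%:R, n%:R[%classic : set R)) y by rewrite bigcup_itvoo.
  exists (maxn n m) => //; split; [split=> //|]; [| |exact: xcd]; apply: itvoo_homo; [exact: leq_maxl|exact: xn|exact: leq_maxr|exact: ym].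
have mid : measurable_fun [set: g_sigma_algebraType G] (fun x : M3 R => ((x.1.1, x.1.2), x.2) : M3 R).
  by apply: measurable_fun_pair mp3; apply: measurable_fun_pair mp1 mp2.
move=> A mA; have := mid measurableT A mA; rewrite setTI.
by rewrite (_ : _ @^-1` A = A)//; apply/seteqP; split => -[[]].
Qed.

Definition plateau (n : nat) (a b t : R) : R := step (n%:R * (t - a)) * step (n%:R * (b - t)).

Lemma plateau_ge0 n (a b t : R) : 0 <= plateau n a b t.
Proof. by rewrite mulr_ge0// step_ge0. Qed.

Lemma plateau_le1 n (a b t : R) : plateau n a b t <= 1.
Proof. by rewrite mulr_ile1 ?step_ge0 ?step_le1. Qed.

Lemma plateau_out n (a b t : R) : t \notin `]a, b[ -> plateau n a b t = 0.
Proof.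
rewrite in_itv/= negb_and -!leNgt => /orP[h|h]; rewrite /plateau.
  by rewrite step_le0 ?mul0r// mulr_ge0_le0// subr_le0.
by rewrite [X in _ * X]step_le0 ?mulr0// mulr_ge0_le0// subr_le0.
Qed.

Lemma plateau_cvg (a b t : R) : plateau n a b t @[n --> \oo] --> (\1_(`]a, b[%classic) t : R).
Proof.
rewrite indicE; have [/set_mem/=|/negP] := boolP (t \in `]a, b[%classic).
  rewrite in_itv/= => /andP[at_ tb]; apply: cvg_near_cst.
  have E (d : R) : 0 < d -> \forall n \near \oo, 1 <= n%:R * d.
    move=> d0; near=> n; rewrite -ler_pdivrMr// mul1r ltW//.
    by near: n; exact: nbhs_infty_gtr.
  have /E h1 : 0 < t - a by rewrite subr_gt0.
  have /E h2 : 0 < b - t by rewrite subr_gt0.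
  near=> n; rewrite /plateau !step_ge1 ?mulr1//; [near: n; exact: h2|near: n; exact: h1].
move=> h; apply: cvg_near_cst; apply: nearW => n; apply: plateau_out.
by apply/negP => k; apply: h; exact/mem_set.
Unshelve. all: by end_near. Qed.

Lemma smooth1_affine (c d : R) : smooth1 (fun t => c * t + d).
Proof.
apply: flat_alg_smooth1; apply: alg_add; last exact: alg_cst.
by apply: alg_mul; [exact: alg_cst|apply: alg_gen; left].
Qed.

Lemma smooth_affine (c d : R) i : smooth (fun x : R3 R => c * crd i x + d).
Proof. by apply: (@smooth_comp R (fun t => c * t + d)); [exact: smooth1_affine|exact: smooth_crd]. Qed.

Lemma smooth_plateau n (a b : R) i : smooth (fun x : R3 R => plateau n a b (crd i x)).
Proof.
have E1 : (fun x : R3 R => n%:R * (crd i x - a)) = (fun x => n%:R * crd i x + - (n%:R * a)).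
  by apply/funext => x; rewrite mulrBr.
have E2 : (fun x : R3 R => n%:R * (b - crd i x)) = (fun x => - n%:R * crd i x + n%:R * b).
  by apply/funext => x; rewrite mulrBr addrC mulNr.
rewrite /plateau; apply: smoothM; apply: (@smooth_comp _ (@step R)); try exact: step_smooth1.
  by rewrite E1; exact: smooth_affine.
by rewrite E2; exact: smooth_affine.
Qed.

Definition plateau3 n a b x : R := plateau n a.1.1 b.1.1 (crd 0 x) *
  (plateau n a.1.2 b.1.2 (crd 1 x) * plateau n a.2 b.2 (crd (Ordinal (ltnSn 2)) x)).

Lemma plateau3_out n a b x : ~ obox a b x -> plateau3 n a b x = 0.
Proof.
rewrite /plateau3 /crd /= => h.
have [h1|/plateau_out->] := boolP (x.1.1 \in `]a.1.1, b.1.1[); last by rewrite mul0r.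
have [h2|/plateau_out->] := boolP (x.1.2 \in `]a.1.2, b.1.2[); last by rewrite mul0r mulr0.
have [h3|/plateau_out->] := boolP (x.2 \in `]a.2, b.2[); last by rewrite !mulr0.
by exfalso; apply: h.
Qed.

Lemma plateau3_ge0 n a b x : 0 <= plateau3 n a b x.
Proof. by apply: mulr_ge0; [|apply: mulr_ge0]; exact: plateau_ge0. Qed.

Lemma plateau3_le1 n a b x : plateau3 n a b x <= 1.
Proof. by apply: mulr_ile1; [exact: plateau_ge0|apply: mulr_ge0; exact: plateau_ge0|exact: plateau_le1|
  apply: mulr_ile1; rewrite ?plateau_ge0 ?plateau_le1]. Qed.

Lemma plateau3_test n a b : test_function (plateau3 n a b).
Proof.
apply/test_functionP; split.
  by rewrite /plateau3; apply: smoothM; [|apply: smoothM]; exact: smooth_plateau.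
exists (`|a| + `|b|) => x xab; apply: plateau3_out => -[[]] /=.
rewrite !in_itv/= => /andP[h1 h2] /andP[h3 h4] /andP[h5 h6].
have E (i : 'I_3) : crd i a < crd i x -> crd i x < crd i b -> `|crd i x| <= `|a| + `|b|.
  have := norm_crd i a; have := norm_crd i b; rewrite !ler_norml => /andP[? ?] /andP[? ?] ? ?.
  by apply/andP; split; have := normr_ge0 a; have := normr_ge0 b; lra.
move: xab; rewrite ltNge => /negP; apply; apply: crd_le => i; apply: E.
  by case: i => [[|[|[|//]]] ?].
by case: i => [[|[|[|//]]] ?].
Qed.

Lemma plateau3_cvg a b x : plateau3 n a b x @[n --> \oo] --> (\1_(obox a b) x : R).
Proof.
have -> : \1_(obox a b) x = \1_(`]a.1.1, b.1.1[%classic) x.1.1 *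
    (\1_(`]a.1.2, b.1.2[%classic) x.1.2 * \1_(`]a.2, b.2[%classic) x.2) :> R.
  rewrite !indicE -!natrM !mulnb; congr (_ %:R); congr nat_of_bool.
  apply/idP/idP => [/set_mem[[h1 h2] h3]|/and3P[/set_mem h1 /set_mem h2 /set_mem h3]].
    by apply/and3P; split; exact/mem_set.
  exact/mem_set.
by apply: cvgM; [exact: plateau_cvg|apply: cvgM; exact: plateau_cvg].
Qed.

Lemma obox_cube a b : exists2 M : R, 0 <= M & obox a b `<=` cube 0 M.
Proof.
exists (`|a| + `|b|); first exact: addr_ge0.
move=> x xab; rewrite /cube /= subr0 leNgt; apply/negP => h.
have := plateau3_test 1 a b; rewrite test_functionP => -[_ _].
move: h; apply/negP; rewrite -leNgt; apply: crd_le => i.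
case: xab => -[] /=.
rewrite !in_itv/= => /andP[h1 h2] /andP[h3 h4] /andP[h5 h6].
have E : crd i a < crd i x -> crd i x < crd i b -> `|crd i x| <= `|a| + `|b|.
  have := norm_crd i a; have := norm_crd i b; rewrite !ler_norml => /andP[? ?] /andP[? ?] ? ?.
  by apply/andP; split; have := normr_ge0 a; have := normr_ge0 b; lra.
by apply: E; case: i => [[|[|[|//]]] ?].
Qed.

(** The indicator of a box is the pointwise limit of the test functions [plateau3 n], all bounded by
    1 and supported in one fixed cube. *)
Lemma integral_obox0 w a b : w \in Lfun (leb3 R) 2%:E ->
  (forall f, test_function f -> Rintegral (leb3 R) setT (fun x => w x * f x) = 0) ->
  (\int[leb3 R]_(x in obox a b) (w x)%:E = 0)%E.
Proof.
move=> wL w0; have mw := L2_measurable wL.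
have [M M0 abM] := obox_cube a b.
rewrite integral_mkcond.
have E n : (\int[leb3 R]_x (w x * plateau3 n a b x)%:E = 0)%E.
  rewrite -[LHS]fineK; first by congr EFin; exact: w0 (plateau3_test n a b).
  by apply: integrable_fin_num => //; apply: L2_mul => //; apply: test_L2; exact: plateau3_test.
have H : (\int[leb3 R]_x (w x * plateau3 n a b x)%:E)%E @[n --> \oo] -->
    (\int[leb3 R]_x ((fun x => (w x)%:E) \_ (obox a b)) x)%E.
  apply: (@dominated_cvg _ (M3 R) R (leb3 R) setT measurableT
    (fun n x => (w x * plateau3 n a b x)%:E) _ (fun x => (`|w x * \1_(cube 0 M) x|)%:E)) => //.
  - move=> n; apply/measurable_EFinP; apply: measurable_funM => //.
    by apply: continuous_measurable3; apply: smooth_continuous; apply: test_smooth; exact: plateau3_test.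
  - move=> x _; have -> : ((fun x => (w x)%:E) \_ (obox a b)) x = (w x * \1_(obox a b) x)%:E.
      by rewrite patchE indicE; case: (x \in _); rewrite ?mulr1 ?mulr0.
    apply: cvg_EFin; first exact: nearW.
    by apply: cvgM; [exact: cvg_cst|exact: plateau3_cvg].
  - have := L2_mul wL (L2_indic 0 M0).
    by move=> /integrable_norm; apply: eq_integrable.
  - move=> n x _; rewrite lee_fin [X in X <= _]normrM [X in _ <= X]normrM ler_wpM2l// ger0_norm ?plateau3_ge0//.
    rewrite indicE; have [h|/negP h] := boolP (x \in cube 0 M); first by rewrite normr1 plateau3_le1.
    by rewrite plateau3_out// => /abM /mem_set.
have <- := cvg_lim (@ereal_hausdorff R) H.
by apply: lim_near_cst => //; exact: nearW.
Qed.

(** The integral of [w] vanishes on boxes. The sets on which it vanishes form a Dynkin system and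
    the boxes a generating family stable under intersection, so it vanishes on every measurable
    subset of a bounded box. *)
Lemma fundamental_lemma w : w \in Lfun (leb3 R) 2%:E ->
  (forall f, test_function f -> Rintegral (leb3 R) setT (fun x => w x * f x) = 0) ->
  {ae leb3 R, forall x, w x = 0}.
Proof.
move=> wL w0; have mw := L2_measurable wL.
(* A function of L^2 is only locally integrable, so the argument runs inside bounded boxes
   exhausting the space. *)
pose K (n : nat) := obox (- n%:R, - n%:R, - n%:R) (n%:R, n%:R, n%:R).
have wK n : (leb3 R).-integrable (K n) (fun x => (w x)%:E).
  have [M M0 abM] := obox_cube (- n%:R, - n%:R, - n%:R) (n%:R, n%:R, n%:R).
  apply: (@integrableS _ (M3 R) R (leb3 R) (cube 0 M)) => //; [exact: measurable_cube|exact: measurable_obox|].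
  have := L2_mul wL (L2_indic 0 M0).
  rewrite (_ : (fun x => (w x * \1_(cube 0 M) x)%:E) = (fun x => (w x)%:E) \_ (cube 0 M)).
    by move=> /(integrable_mkcond _ (measurable_cube 0 M)).
  by apply/funext => x; rewrite patchE indicE; case: (x \in _); rewrite ?mulr1 ?mulr0.
have P0 n A : measurable A -> (\int[leb3 R]_(x in A `&` K n) (w x)%:E = 0)%E.
  move=> mA; have : <<s G >> A by rewrite -sigma_oboxE.
  move: A {mA}; apply: (@dynkin_induction _ (M3 R) G
    (fun A => (\int[leb3 R]_(x in A `&` K n) (w x)%:E = 0)%E)).
  - exact: sigma_oboxE.
  - by move=> _ _ [a [b ->]] [c [d ->]]; have [a' [b' ->]] := oboxI a b c d; exists a', b'.
  - by rewrite setTI; exact: integral_obox0.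
  - move=> _ [a [b ->]]; rewrite /K; have [a' [b' ->]] := oboxI a b (- n%:R, - n%:R, - n%:R) (n%:R, n%:R, n%:R).
    exact: integral_obox0.
  - move=> S mS S0.
    have KE : K n = (S `&` K n) `|` (~` S `&` K n) by rewrite -setIUl setUv setTI.
    have := @integral_setU _ (M3 R) R (leb3 R) (S `&` K n) (~` S `&` K n) (fun x => (w x)%:E).
    rewrite -KE S0 add0e (integral_obox0 _ _ wL w0) => -> //.
    + by apply: measurableI => //; exact: measurable_obox.
    + by apply: measurableI; [exact: measurableC|exact: measurable_obox].
    + by apply/measurable_EFinP; exact: measurable_funTS.
    + by apply/disj_setPS => x [[Sx _] [nSx _]]; exact: nSx.
  - move=> F mF tF F0; rewrite setI_bigcupl integral_bigcup.
    + by rewrite eseries0.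
    + exact: trivIset_setIr.
    + by move=> k; apply: measurableI => //; exact: measurable_obox.
    + apply: integrableS (wK n); [exact: measurable_obox| |].
        by apply: bigcup_measurable => k _; apply: measurableI => //; exact: measurable_obox.
      by move=> x [k _ []].
have aeK n : \forall x \ae leb3 R, K n x -> (w x)%:E = 0%E.
  apply: (@integral_ae_eq _ (M3 R) R (leb3 R) (K n) (measurable_obox _ _) (cst 0%E) (fun x => (w x)%:E)).
  - exact: wK.
  - exact: measurable_cst.
  - move=> E EK mE; rewrite integral0 -[RHS](P0 n E mE).
    by congr (integral _ _ _); apply/esym/setIidl.
have := @ae_foralln _ _ _ (leb3 R) _ aeK; apply: filterS => x xP.
have [n xn] : exists n, K n x.
  exists (Num.trunc `|x|).+1.
  have h i : `|crd i x| < (Num.trunc `|x|).+1%:R.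
    exact: le_lt_trans (norm_crd i x) (truncnS_gt _).
  rewrite /K /obox /=; split; [split|]; rewrite /= in_itv/= -ltr_norml.
  - exact: (h 0).
  - exact: (h 1).
  - exact: (h (Ordinal (ltnSn 2))).
by have [] := xP n xn.
Qed.

End fundamental.

(** * Weak gradients *)

Lemma is_derive_lineP (R : realType) (V : normedModType R) (f : V -> R) (x v : V) (d : R) :
  is_derive x v f d <-> is_derive (0 : R) (1 : R) (fun t => f (t *: v + x)) d.
Proof.
split=> -[fd fe]; apply: DeriveDef.
- by move/derivable1P : fd.
- by rewrite derive_line.
- by apply/derivable1P.
- by rewrite -derive_line.
Qed.

Lemma ae3_imp (R : realType) (P Q : R3 R -> Prop) : (forall x, P x -> Q x) ->
  {ae leb3 R, forall x, P x} -> {ae leb3 R, forall x, Q x}.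
Proof. by move=> PQ; exact: (@filterS _ _ (ae_filter_ringOfSetsType (leb3 R)) _ _ PQ). Qed.

Lemma ae3_all (R : realType) (P : 'I_3 -> R3 R -> Prop) :
  (forall i, {ae leb3 R, forall x, P i x}) -> {ae leb3 R, forall x, forall i, P i x}.
Proof.
move=> aeP; apply: (@filterS3 _ _ (ae_filter_ringOfSetsType (leb3 R)) _ _ _ _ _
  (aeP 0) (aeP 1) (aeP (Ordinal (ltnSn 2)))) => x h0 h1 h2 -[[|[|[|//]]] p].
- by rewrite (_ : Ordinal p = 0)//; exact: val_inj.
- by rewrite (_ : Ordinal p = 1)//; exact: val_inj.
- by rewrite (_ : Ordinal p = Ordinal (ltnSn 2))//; exact: val_inj.
Qed.

Section weak_partials.
Context (R : realType).
Implicit Types (i : 'I_3) (x y : R3 R) (u v w : R3 R -> R) (G : 'I_3 -> R3 R -> R).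

Lemma weak_partial_unique i u v w : L2_weak_partials i u v -> L2_weak_partials i u w ->
  {ae leb3 R, forall x, v x = w x}.
Proof.
move=> [vL vP] [wL wP].
have nwL : (fun x => - 1 * w x) \in Lfun (leb3 R) 2%:E.
  apply: (L2_dom (K := 1) wL); last by move=> x; rewrite mulN1r normrN mul1r.
  by apply: measurable_funM => //; exact: L2_measurable.
have dL := L2_add vL nwL.
suff : {ae leb3 R, forall x, v x + - 1 * w x = 0}.
  by apply: ae3_imp => x; rewrite mulN1r => /eqP; rewrite subr_eq0 => /eqP.
apply: fundamental_lemma => // f tf.
have fL := test_L2 tf.
under eq_Rintegral do rewrite mulN1r mulrDl mulNr.
rewrite RintegralB//; [|exact: L2_mul..].
by apply/eqP; rewrite subr_eq0; apply/eqP; apply: oppr_inj; rewrite -vP// -wP.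
Qed.

(** Computations carry an explicit gradient: [weak_partial] is an arbitrary choice, equal to [G]
    only almost everywhere, which is enough for [Aint] by [Aint_grad]. *)
Definition is_grad u G := u \in Lfun (leb3 R) 2%:E /\ forall i, L2_weak_partials i u (G i).

Lemma is_grad_H1 u G : is_grad u G -> H1 u.
Proof. by move=> [uL uG]; split => // i; exists (G i). Qed.

Lemma H1_is_grad u : H1 u -> is_grad u (fun i => weak_partial i u).
Proof. by move=> [uL uP]; split=> // i; apply: xgetPex; exact: uP. Qed.

Lemma is_grad_measurable u G i : is_grad u G -> measurable_fun [set: M3 R] (G i).
Proof. by move=> [_ /(_ i)[/L2_measurable]]. Qed.

Lemma measurable_sum3 (F : 'I_3 -> R3 R -> R) :
  (forall i, measurable_fun [set: M3 R] (F i)) ->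
  measurable_fun [set: M3 R] (fun x => \sum_(i < 3) F i x).
Proof. by move=> mF; apply: measurable_sum. Qed.

Lemma Aint_grad u G : is_grad u G ->
  Aint u = (\int[leb3 R]_x (\sum_(i < 3) G i x ^+ 2)%:E)%E.
Proof.
move=> uG; have uW := H1_is_grad (is_grad_H1 uG).
have M (F : 'I_3 -> R3 R -> R) : is_grad u F -> measurable_fun [set: M3 R] (fun x => (\sum_(i < 3) F i x ^+ 2)%:E).
  move=> uF; apply/measurable_EFinP; apply: measurable_sum3 => i.
  by apply: measurable_funX; exact: is_grad_measurable uF.
apply: ge0_ae_eq_integral => //; [exact: M|exact: M|..].
- by move=> x _; rewrite lee_fin sumr_ge0// => i _; rewrite sqr_ge0.
- by move=> x _; rewrite lee_fin sumr_ge0// => i _; rewrite sqr_ge0.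
have H i : {ae leb3 R, forall x, weak_partial i u x = G i x}.
  exact: weak_partial_unique (uW.2 i) (uG.2 i).
by apply: ae3_imp (ae3_all H) => x xH _; congr EFin; apply: eq_bigr => i _; rewrite xH.
Qed.

Lemma L2_mass u : u \in Lfun (leb3 R) 2%:E -> (mass u < +oo)%E.
Proof.
move=> /L2P[_]; rewrite /mass.
by under [in X in _ -> X]eq_integral do rewrite real_normK ?num_real//.
Qed.

(** If [f] is a test function then so is [g * f], and the weak derivative of [u] may be tested
    against it; the Leibniz rule for smooth functions does the rest. *)
Lemma is_grad_mul u G (g : R3 R -> R) (K : R) : is_grad u G -> smooth g ->
  (forall x, `|g x| <= K) -> (forall i x, `|partial i g x| <= K) ->
  is_grad (fun x => g x * u x) (fun i x => g x * G i x + partial i g x * u x).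
Proof.
move=> [uL uG] gs gK dgK.
have mg : measurable_fun [set: M3 R] g.
  by apply: continuous_measurable3; exact: smooth_continuous.
have mdg i : measurable_fun [set: M3 R] (partial i g).
  by apply: continuous_measurable3; apply: smooth_continuous; exact: smooth_partial.
have mul_L2 (h v : R3 R -> R) : measurable_fun [set: M3 R] h -> (forall x, `|h x| <= K) ->
    v \in Lfun (leb3 R) 2%:E -> (fun x => h x * v x) \in Lfun (leb3 R) 2%:E.
  move=> mh hK vL; apply: (L2_dom (K := K) vL).
    by apply: measurable_funM => //; exact: L2_measurable.
  by move=> x; rewrite normrM ler_wpM2r.
split; first exact: mul_L2.
move=> i; have [GL GP] := uG i; split.
  by apply: L2_add; exact: mul_L2.
move=> f tf.
have tgf := test_functionM gs tf.
have fs := test_smooth tf.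
have E : (fun x => g x * u x * partial i f x) =
    (fun x => u x * partial i (fun x => g x * f x) x - (partial i g x * u x) * f x).
  by apply/funext => x; rewrite partialM//; ring.
rewrite E RintegralB//; last 2 first.
- by apply: L2_mul => //; apply: test_L2; exact: test_function_partial.
- by apply: L2_mul; [exact: mul_L2|exact: test_L2].
rewrite (GP _ tgf) -opprD; congr (- _).
rewrite -RintegralD//; last 2 first.
- by apply: L2_mul => //; exact: test_L2.
- by apply: L2_mul; [exact: mul_L2|exact: test_L2].
by apply: eq_Rintegral => x _; ring.
Qed.

Lemma is_derive_dilation (c : R) (f : R3 R -> R) i x : smooth f ->
  is_derive x (basis3 R i) (fun x => f (c *: x)) (c * partial i f (c *: x)).
Proof.
move=> fs.
have hL := (is_derive_lineP _ _ _ _).1 (smooth_is_derive i (c *: x) fs).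
apply/is_derive_lineP.
have dc : is_derive (0 : R) (1 : R) (fun t => c * t) c.
  have := is_deriveZ c (is_derive_id (0 : R) (1 : R)).
  by rewrite [_ *: _]mulr1.
have dk : is_derive (0 : R) (1 : R) (fun t : R => f ((c * t) *: basis3 R i + c *: x)) (partial i f (c *: x) * c).
  apply: (@is_derive_comp1 _ _ (fun t => f (t *: basis3 R i + c *: x)) (fun t => c * t)) => //.
  by rewrite mulr0.
rewrite mulrC; move: dk.
by under eq_fun do rewrite -scalerA -scalerDr.
Qed.

Lemma partial_dilation (c : R) (f : R3 R -> R) i x : smooth f ->
  partial i (fun x => f (c *: x)) x = c * partial i f (c *: x).
Proof. by move=> fs; apply: partialE; exact: is_derive_dilation. Qed.

Lemma smooth_dilation (c : R) (f : R3 R -> R) : smooth f -> smooth (fun x => f (c *: x)).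
Proof.
move=> fs; apply: (@smooth_coind _ (fun g => exists k h, smooth h /\ g = (fun x => k * h (c *: x)))).
  move=> _ [k [h [hs ->]]]; split.
    move=> x; apply: cvgMr; apply: (@continuous_comp _ _ _ (fun x : R3 R => c *: x) h).
      exact: scaler_continuous.
    exact: smooth_continuous.
  move=> i; have H x : is_derive x (basis3 R i) (fun x => k * h (c *: x)) (k * c * partial i h (c *: x)).
    by have := is_deriveZ k (is_derive_dilation c i x hs); rewrite /GRing.scale /= mulrA.
  split; first by move=> x; have [] := H x.
  exists (k * c), (partial i h); split; first exact: smooth_partial.
  by apply/funext => x; exact: partialE.
by exists 1, f; split => //; apply/funext => x; rewrite mul1r.
Qed.

End weak_partials.

(** * Rescaling *)

Section rescaling.
Context (R : realType) (al be : R).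
Hypotheses (al0 : 0 < al) (be0 : 0 < be).
Implicit Types (i : 'I_3) (x y : R3 R) (u v w : R3 R -> R) (G : 'I_3 -> R3 R -> R).

(** Amplitude and dilation are kept independent: the fiber action [scale], the change of mass and
    the normalization of near-maximizers are all instances. *)
Definition rescale u : R3 R -> R := fun x => al * u (be *: x).

Let bei3 : R := be^-1 ^+ 3.

Lemma measurable_rescale u : measurable_fun [set: M3 R] u -> measurable_fun [set: M3 R] (rescale u).
Proof.
move=> mu; apply: measurable_funM => //.
exact: (measurableT_comp mu (measurable_dilation be)).
Qed.

(** Infinite values are allowed because it is applied to the inner Coulomb integral, whose
    finiteness is not known at that point. *)
Lemma ge0_integral_rescale_ereal (J : R3 R -> \bar R) (k : R) : 0 <= k ->
  measurable_fun [set: M3 R] J -> (forall x, 0 <= J x)%E ->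
  (\int[leb3 R]_x (k%:E * J (be *: x)) = (k * bei3)%:E * \int[leb3 R]_x J x)%E.
Proof.
move=> k0 mJ J0.
have mJb : measurable_fun [set: M3 R] (fun x => J (be *: x)).
  exact: (measurableT_comp mJ (measurable_dilation be)).
rewrite ge0_integralZl//.
by rewrite (@ge0_integral_dilation R be be0 J)// EFinM muleA.
Qed.

Lemma ge0_integral_rescale (f : R3 R -> R) (k : R) : 0 <= k ->
  measurable_fun [set: M3 R] f -> (forall x, 0 <= f x) ->
  (\int[leb3 R]_x (k * f (be *: x))%:E = (k * bei3)%:E * \int[leb3 R]_x (f x)%:E)%E.
Proof.
move=> k0 mf f0; rewrite -(@ge0_integral_rescale_ereal (fun x => (f x)%:E))//.
exact/measurable_EFinP.
Qed.

Lemma integrable_dilation (f : R3 R -> R) : (leb3 R).-integrable setT (EFin \o f) ->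
  (leb3 R).-integrable setT (fun x => (f (be *: x))%:E).
Proof.
move=> /integrableP[/measurable_EFinP mf fi]; apply/integrableP; split.
  by apply/measurable_EFinP; exact: (measurableT_comp mf (measurable_dilation be)).
rewrite (@ge0_integral_dilation R be be0 (fun x => `|(f x)%:E|%E))//.
  by rewrite lte_mul_pinfty// lee_fin exprn_ge0// invr_ge0 ltW.
by apply/measurable_EFinP; exact: measurableT_comp.
Qed.

Lemma Rintegral_dilation (f : R3 R -> R) : (leb3 R).-integrable setT (EFin \o f) ->
  Rintegral (leb3 R) setT (fun x => f (be *: x)) = bei3 * Rintegral (leb3 R) setT f.
Proof.
move=> fi; rewrite /Rintegral (@integral_dilation R be be0 (EFin \o f))// fineM//.
exact: integrable_fin_num.
Qed.

Lemma L2_rescale u : u \in Lfun (leb3 R) 2%:E -> rescale u \in Lfun (leb3 R) 2%:E.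
Proof.
move=> /L2P[mu ui]; apply/L2P; split; first exact: measurable_rescale.
under eq_integral do rewrite exprMn.
rewrite (@ge0_integral_rescale (fun x => u x ^+ 2)) ?sqr_ge0//.
- by rewrite lte_mul_pinfty// lee_fin mulr_ge0 ?sqr_ge0// exprn_ge0// invr_ge0 ltW.
- exact: measurable_funX.
- by move=> x; rewrite sqr_ge0.
Qed.

Lemma is_grad_rescale u G : is_grad u G ->
  is_grad (rescale u) (fun i x => be * rescale (G i) x).
Proof.
move=> [uL uG]; split; first exact: L2_rescale.
move=> i; have [GL GP] := uG i; split.
  apply: (L2_dom (K := be) (L2_rescale GL)).
    by apply: measurable_funM => //; apply: measurable_rescale; exact: L2_measurable.
  by move=> x; rewrite normrM gtr0_norm.
move=> f tf; have fs := test_smooth tf.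
(* The dilation is moved onto the test function, so that the weak derivative of [u] itself is
   tested. *)
pose g x := f (be^-1 *: x).
have tg : test_function g.
  have /test_functionP[_ [M fM]] := tf; apply/test_functionP; split.
    exact: smooth_dilation.
  exists (be * M) => x xM; apply: fM.
  by rewrite normrZ gtr0_norm ?invr_gt0// ltr_pdivlMl.
have gE x : g (be *: x) = f x by rewrite /g scalerA mulVf ?scale1r ?gt_eqF.
have pgE x : be * partial i g (be *: x) = partial i f x.
  by rewrite /g partial_dilation// mulrA mulfV ?gt_eqF// mul1r scalerA mulVf ?scale1r ?gt_eqF.
have h1 : (leb3 R).-integrable setT (fun x => (u x * partial i g x)%:E).
  by apply: L2_mul => //; apply: test_L2; exact: test_function_partial.
have h2 : (leb3 R).-integrable setT (fun x => (G i x * g x)%:E).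
  by apply: L2_mul => //; exact: test_L2.
have e1 := GP _ tg.
have E1 : (fun x => rescale u x * partial i f x) =
    (fun x => (al * be) * (fun x => u x * partial i g x) (be *: x)).
  by apply/funext => x; rewrite /rescale -pgE; ring.
have E2 : (fun x => be * rescale (G i) x * f x) =
    (fun x => (al * be) * (fun x => G i x * g x) (be *: x)).
  by apply/funext => x; rewrite /rescale -gE; ring.
rewrite E1 E2 !RintegralZl//; last 2 first.
- exact: (@integrable_dilation (fun x => G i x * g x)).
- exact: (@integrable_dilation (fun x => u x * partial i g x)).
rewrite (@Rintegral_dilation (fun x => u x * partial i g x))// (@Rintegral_dilation (fun x => G i x * g x))//.
by rewrite e1 !mulrN.
Qed.

Lemma mass_rescale u : u \in Lfun (leb3 R) 2%:E ->
  mass (rescale u) = ((al ^+ 2 * bei3)%:E * mass u)%E.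
Proof.
move=> uL; rewrite /mass.
under eq_integral do rewrite normrM exprMn (gtr0_norm al0).
rewrite (@ge0_integral_rescale (fun x => `|u x| ^+ 2)) ?sqr_ge0//.
- by apply: measurable_funX; apply: measurableT_comp => //; exact: L2_measurable.
Qed.

Lemma Aint_rescale u : H1 u -> Aint (rescale u) = ((al ^+ 2 * be ^+ 2 * bei3)%:E * Aint u)%E.
Proof.
move=> /H1_is_grad uG; rewrite (Aint_grad (is_grad_rescale uG)) (Aint_grad uG).
rewrite -(@ge0_integral_rescale (fun x => \sum_(i < 3) weak_partial i u x ^+ 2)).
- apply: eq_integral => x _; congr EFin; rewrite mulr_sumr; apply: eq_bigr => i _.
  by rewrite /rescale !exprMn; ring.
- by rewrite mulr_ge0 ?sqr_ge0.
- by apply: measurable_sum3 => i; apply: measurable_funX; exact: is_grad_measurable uG.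
- by move=> x; rewrite sumr_ge0// => i _; rewrite sqr_ge0.
Qed.

Lemma Cint_rescale p u : 0 <= p -> u \in Lfun (leb3 R) 2%:E ->
  Cint p (rescale u) = ((al `^ p * bei3)%:E * Cint p u)%E.
Proof.
move=> p0 uL; rewrite /Cint.
under eq_integral do rewrite normrM powRM// (gtr0_norm al0).
rewrite (@ge0_integral_rescale (fun x => `|u x| `^ p)) ?powR_ge0//.
- by apply: (measurableT_comp (measurable_powR p)); apply: measurableT_comp => //; exact: L2_measurable.
Qed.

Lemma enormZ (c : R) x : 0 <= c -> enorm (c *: x) = c * enorm x.
Proof.
move=> c0; rewrite /enorm /= !exprMn -!mulrDr sqrtrM ?sqr_ge0//.
by rewrite sqrtr_sqr ger0_norm.
Qed.

Definition coulomb u x y : R := `|u x| ^+ 2 * `|u y| ^+ 2 / enorm (x - y).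

Lemma coulomb_ge0 u x y : 0 <= coulomb u x y.
Proof. by rewrite /coulomb !mulr_ge0 ?sqr_ge0// invr_ge0 sqrtr_ge0. Qed.

Lemma measurable_coulomb u : measurable_fun [set: M3 R] u ->
  measurable_fun [set: M3 R * M3 R] (fun z => coulomb u z.1 z.2).
Proof.
move=> mu.
have msq : measurable_fun [set: M3 R] (fun x => `|u x| ^+ 2).
  by apply: measurable_funX; exact: measurableT_comp.
have m1 := measurableT_comp msq (@measurable_fst _ _ (M3 R) (M3 R)).
have m2 := measurableT_comp msq (@measurable_snd _ _ (M3 R) (M3 R)).
have mc i : measurable_fun [set: M3 R * M3 R] (fun z => (crd i z.1 - crd i z.2) ^+ 2).
  have mi' : measurable_fun [set: M3 R] (crd i).
    by apply: continuous_measurable3; exact: crd_continuous.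
  apply: measurable_funX; apply: measurable_funB.
    exact: (measurableT_comp mi' (@measurable_fst _ _ (M3 R) (M3 R))).
  exact: (measurableT_comp mi' (@measurable_snd _ _ (M3 R) (M3 R))).
apply: measurable_funM; first exact: measurable_funM.
(* The inverse is written as a power to use the measurability of [powR]; both conventions give 0 on
   the diagonal. *)
rewrite (_ : (fun z => _^-1) = (fun z : M3 R * M3 R => enorm (z.1 - z.2) `^ (-1))); last first.
  by apply/funext => z; rewrite powR_inv1// sqrtr_ge0.
apply: (measurableT_comp (measurable_powR _)).
have -> : (fun z : M3 R * M3 R => enorm (z.1 - z.2)) = (fun z => Num.sqrt ((crd 0 z.1 - crd 0 z.2) ^+ 2 +
   (crd 1 z.1 - crd 1 z.2) ^+ 2 + (crd (Ordinal (ltnSn 2)) z.1 - crd (Ordinal (ltnSn 2)) z.2) ^+ 2)) by [].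
apply: measurableT_comp; first by apply: continuous_measurable_fun; exact: sqrt_continuous.
by do 2?apply: measurable_funD; exact: mc.
Qed.

Lemma measurable_coulomb_l u x : measurable_fun [set: M3 R] u ->
  measurable_fun [set: M3 R] (coulomb u x).
Proof.
move=> mu.
have mp : measurable_fun [set: M3 R] (fun y : M3 R => (x : M3 R, y)).
  by apply: measurable_fun_pair.
exact: (measurableT_comp (measurable_coulomb mu) mp).
Qed.

Lemma measurable_coulomb_int u : measurable_fun [set: M3 R] u ->
  measurable_fun [set: M3 R] (fun x => \int[leb3 R]_y (coulomb u x y)%:E)%E.
Proof.
move=> mu.
apply: (@measurable_fun_fubini_tonelli_F _ _ (M3 R) (M3 R) R (@vol3 R) (fun z => (coulomb u z.1 z.2)%:E)).
  by apply/measurable_EFinP; exact: measurable_coulomb.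
by move=> z; rewrite lee_fin coulomb_ge0.
Qed.

Lemma Bint_rescale u : measurable_fun [set: M3 R] u ->
  Bint (rescale u) = ((al ^+ 4 * be * bei3 * bei3)%:E * Bint u)%E.
Proof.
move=> mu.
have E x y : `|rescale u x| ^+ 2 * `|rescale u y| ^+ 2 / enorm (x - y) =
    al ^+ 4 * be * coulomb u (be *: x) (be *: y).
  rewrite /coulomb -scalerBr enormZ ?ltW// /rescale !normrM (gtr0_norm al0) !exprMn invfM.
  by move: (enorm _)^-1 => e; field; rewrite gt_eqF.
have c0 : 0 <= al ^+ 4 * be by rewrite mulr_ge0 ?exprn_ge0 ?ltW.
have h1 x : (\int[leb3 R]_y (al ^+ 4 * be * coulomb u (be *: x) (be *: y))%:E =
    (al ^+ 4 * be * bei3)%:E * \int[leb3 R]_y (coulomb u (be *: x) y)%:E)%E.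
  rewrite (@ge0_integral_rescale (coulomb u (be *: x)))//.
    exact: measurable_coulomb_l.
  by move=> y; exact: coulomb_ge0.
have c1 : 0 <= al ^+ 4 * be * bei3.
  by rewrite mulr_ge0// exprn_ge0// invr_ge0 ltW.
have mI := measurable_coulomb_int mu.
have I0 x : (0 <= \int[leb3 R]_y (coulomb u x y)%:E)%E.
  by apply: integral_ge0 => y _; rewrite lee_fin coulomb_ge0.
transitivity (\int[leb3 R]_x ((al ^+ 4 * be * bei3)%:E * \int[leb3 R]_y (coulomb u (be *: x) y)%:E))%E.
  apply: eq_integral => x _; rewrite -h1; apply: eq_integral => y _.
  by rewrite E.
exact: (ge0_integral_rescale_ereal c1 mI I0).
Qed.

End rescaling.

(** * Gradients of test functions and lower bounds on B *)

Section parts.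
Context (R : realType).
Implicit Types (i : 'I_3) (x y : R3 R) (f u : R3 R -> R).

Lemma smooth_MVT f i x (h : R) : smooth f -> 0 < h ->
  exists2 c : R, 0 < c < h & f (h *: basis3 R i + x) - f x = h * partial i f (c *: basis3 R i + x).
Proof.
move=> fs h0; pose k (t : R) := f (t *: basis3 R i + x).
have dk t : is_derive t (1 : R) k (partial i f (t *: basis3 R i + x)).
  have := (is_derive_lineP _ _ _ _).1 (smooth_is_derive i (t *: basis3 R i + x) fs).
  rewrite /k => H; apply/is_derive_lineP; move: H.
  rewrite (_ : (fun _ => _) = (fun s : R => f ((s *: (1 : R) + t) *: basis3 R i + x)))//.
  by apply/funext => s; rewrite scalerDl addrA [s *: 1]mulr1.
have ck : {within `[0, h], continuous k}.
  apply: continuous_subspaceT => t; apply: differentiable_continuous.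
  by apply/derivable1_diffP; have [] := dk t.
have [c ch cE] := MVT h0 (fun t _ => dk t) ck.
exists c; first by rewrite in_itv in ch.
by move: cE; rewrite /k scale0r add0r subr0 mulrC.
Qed.

Lemma harmonic_dnbhs : (fun n => n.+1%:R^-1 : R) @ \oo --> (0 : R)^'.
Proof.
move=> P P0; have H : \forall n \near \oo, n.+1%:R^-1 != 0 :> R -> P n.+1%:R^-1.
  exact: (@cvg_harmonic R _ P0).
by apply: filterS H => n; apply; rewrite invr_eq0 pnatr_eq0.
Qed.

(** Translation invariance makes the integral of every difference quotient zero; the mean value
    theorem dominates the quotients by a multiple of the indicator of one cube, which allows the
    passage to the limit. *)
Lemma integral_partial0 f i : test_function f -> Rintegral (leb3 R) setT (partial i f) = 0.
Proof.
move=> tf; have fs := test_smooth tf; have tdf := test_function_partial i tf.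
have [K K0 dfK] := test_function_bounded tdf.
have /test_functionP[_ [M fM]] := tf.
have mf : measurable_fun [set: M3 R] f.
  by apply: continuous_measurable3; exact: smooth_continuous.
pose h n : R := n.+1%:R^-1.
have h0 n : 0 < h n by rewrite invr_gt0 ltr0n.
have h1 n : h n <= 1 by rewrite invf_le1 ?ltr0n// ler1n.
have mtf n : measurable_fun [set: M3 R] (fun x => f (h n *: basis3 R i + x)).
  exact: (measurableT_comp mf (measurable_translation _)).
have fint (g : R3 R -> R) (r L : R) : measurable_fun [set: M3 R] g -> 0 <= r ->
    (forall x, `|g x| <= L) -> (forall x, ~ cube 0 r x -> g x = 0) ->
    (leb3 R).-integrable setT (EFin \o g).
  move=> mg r0 gL g0.
  have := L2_mul (L2_bounded mg r0 gL g0) (L2_indic 0 r0).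
  rewrite (_ : (fun x => _) = EFin \o g)//; apply/funext => x /=; rewrite indicE.
  have [h2|/negP h2] := boolP (x \in cube 0 r); first by rewrite mulr1.
  by rewrite g0 ?mul0r// => /mem_set.
have basis1 : `|basis3 R i| <= 1.
  by apply: crd_le => j; rewrite crd_basis; case: (j == i); rewrite ?normr1 ?normr0.
(* The shifts [h n] are at most 1, so this cube contains the supports of all translates. *)
pose r := `|M| + 1.
have r0 : 0 <= r by rewrite addr_ge0.
have fout x : ~ cube 0 r x -> f x = 0.
  rewrite /cube /= subr0 => /negP; rewrite -ltNge => rx; apply: fM.
  by apply: le_lt_trans rx; rewrite /r; have := ler_norm M; lra.
have ftout n x : ~ cube 0 r x -> f (h n *: basis3 R i + x) = 0.
  rewrite /cube /= subr0 => /negP; rewrite -ltNge => rx; apply: fM.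
  have := lerB_dist x (- (h n *: basis3 R i)); rewrite opprK normrN addrC => H.
  have : `|h n *: basis3 R i| <= 1.
    by rewrite normrZ gtr0_norm// mulr_ile1// ltW.
  by have := ler_norm M; move: rx H; rewrite /r [x + _]addrC; lra.
have [L L0 fL] := test_function_bounded tf.
have fi : (leb3 R).-integrable setT (EFin \o f) by exact: (fint f r L).
have fti n : (leb3 R).-integrable setT (fun x => (f (h n *: basis3 R i + x))%:E).
  by apply: (fint (fun x => f (h n *: basis3 R i + x)) r L) => //; exact: ftout.
have E n : (\int[leb3 R]_x ((h n)^-1 * (f (h n *: basis3 R i + x) - f x))%:E = 0)%E.
  under eq_integral do rewrite EFinM.
  rewrite integralZl//; last by under eq_fun do rewrite EFinB; apply: integrableB.
  under eq_integral do rewrite EFinB.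
  rewrite integralB// (integral_translation _ fi) subee ?mule0//.
  exact: integrable_fin_num.
have H : (\int[leb3 R]_x ((h n)^-1 * (f (h n *: basis3 R i + x) - f x))%:E)%E @[n --> \oo] -->
    (\int[leb3 R]_x (partial i f x)%:E)%E.
  apply: (@dominated_cvg _ (M3 R) R (leb3 R) setT measurableT
    (fun n x => ((h n)^-1 * (f (h n *: basis3 R i + x) - f x))%:E) _
    (fun x => (K * \1_(cube 0 r) x)%:E)) => //.
  - by move=> n; apply/measurable_EFinP; apply: measurable_funM => //; exact: measurable_funB.
  - move=> x _; apply: cvg_EFin; first exact: nearW.
    exact: cvg_comp harmonic_dnbhs (@ex_derive _ _ _ _ _ _ _ (smooth_is_derive i x fs)).
  - have := integrableZl measurableT K (L2_mul (L2_indic 0 r0) (L2_indic 0 r0)).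
    rewrite (_ : (fun x => _) = fun x => (K * \1_(cube 0 r) x)%:E)//.
    apply/funext => x; rewrite -EFinM indicE; congr (_ * _)%:E.
    by case: (x \in _); rewrite ?mulr1 ?mulr0.
  - move=> n x _; rewrite lee_fin indicE.
    have [/set_mem xr|/negP xr] := boolP (x \in cube 0 r).
      have [c _ ->] := smooth_MVT i x fs (h0 n).
      by rewrite mulKf ?gt_eqF// mulr1.
    have nxr : ~ cube 0 r x by move=> /mem_set.
    by rewrite [f x]fout// [X in `|_ * (X - _)|]ftout// subrr mulr0 normr0 mulr0.
rewrite /Rintegral; have <- := cvg_lim (@ereal_hausdorff R) H.
by rewrite (_ : lim _ = 0%E)//; apply: lim_near_cst => //; exact: nearW.
Qed.

Lemma test_is_grad f : test_function f -> is_grad f (fun i => partial i f).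
Proof.
move=> tf; split; first exact: test_L2.
move=> i; split; first by apply: test_L2; exact: test_function_partial.
move=> g tg; have fs := test_smooth tf; have gs := test_smooth tg.
have := integral_partial0 i (test_functionM fs tg).
have -> : partial i (fun x => f x * g x) = (fun x => f x * partial i g x + g x * partial i f x).
  by apply/funext => x; exact: partialM.
rewrite RintegralD//; last 2 first.
- by apply: L2_mul; [exact: test_L2|apply: test_L2; exact: test_function_partial].
- by apply: L2_mul; [exact: test_L2|apply: test_L2; exact: test_function_partial].
move=> /eqP; rewrite addr_eq0 => /eqP ->; congr (- _).
by apply: eq_Rintegral => x _; rewrite mulrC.
Qed.

Lemma mass_cube_ge y (r : R) u : measurable_fun [set: M3 R] u ->
  (\int[leb3 R]_(x in cube y r) (`|u x| ^+ 2)%:E <= mass u)%E.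
Proof.
move=> mu; apply: ge0_subset_integral => //; first exact: measurable_cube.
by apply/measurable_EFinP; apply: measurable_funX; exact: measurableT_comp.
Qed.

Lemma enorm_gt0 x : x != 0 -> 0 < enorm x.
Proof.
move=> x0; rewrite sqrtr_gt0 lt_neqAle !addr_ge0 ?sqr_ge0// andbT eq_sym.
apply: contra x0; rewrite !paddr_eq0 ?addr_ge0 ?sqr_ge0// !sqrf_eq0.
by case: x => -[x y] z /= /andP[/andP[/eqP-> /eqP->] /eqP->].
Qed.

Lemma enorm_cube y (r : R) x z : 0 <= r -> cube y r x -> cube y r z -> enorm (x - z) <= 4 * r.
Proof.
move=> r0 xr zr.
have E i : (crd i x - crd i z) ^+ 2 <= (2 * r) ^+ 2.
  rewrite -[leLHS]real_normK ?num_real// lerXn2r ?nnegrE ?mulr_ge0//.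
  rewrite -crdB; apply: le_trans (norm_crd _ _) _.
  rewrite -[x - z](subrKA y) mulr2n mulrDl mul1r; apply: le_trans (ler_normD _ _) _.
  by apply: lerD => //; rewrite distrC.
rewrite -[leRHS]ger0_norm ?mulr_ge0// -sqrtr_sqr /enorm ler_sqrt ?sqr_ge0//.
have := E 0; have := E 1; have := E (Ordinal (ltnSn 2)); rewrite /crd /= => h2 h1 h0.
apply: (@le_trans _ _ ((2 * r) ^+ 2 + (2 * r) ^+ 2 + (2 * r) ^+ 2)); first by rewrite !lerD.
by rewrite !exprMn; have := sqr_ge0 r; lra.
Qed.

(** Two points of the cube are at Euclidean distance at most [4 * r], so the kernel is bounded below
    there by the inverse. *)
Lemma Bint_cube y (r : R) u : measurable_fun [set: M3 R] u -> 0 < r ->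
  ((4 * r)^-1%:E * (\int[leb3 R]_(x in cube y r) (`|u x| ^+ 2)%:E *
    \int[leb3 R]_(x in cube y r) (`|u x| ^+ 2)%:E) <= Bint u)%E.
Proof.
move=> mu r0.
have mc := measurable_cube y r.
have msq : measurable_fun [set: M3 R] (fun x => (`|u x| ^+ 2)%:E).
  by apply/measurable_EFinP; apply: measurable_funX; exact: measurableT_comp.
set s := (\int[leb3 R]_(x in cube y r) (`|u x| ^+ 2)%:E)%E.
have s0 : (0 <= s)%E by apply: integral_ge0 => x _; rewrite lee_fin sqr_ge0.
have k0 : 0 <= (4 * r)^-1 by rewrite invr_ge0 mulr_ge0// ltW.
have inner x : cube y r x ->
    (((4 * r)^-1 * `|u x| ^+ 2)%:E * s <= \int[leb3 R]_z (coulomb u x z)%:E)%E.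
  move=> xr; set k := (4 * r)^-1 * _.
  have k1 : 0 <= k by rewrite mulr_ge0// sqr_ge0.
  have -> : (k%:E * s = \int[leb3 R]_z ((fun z => (k * `|u z| ^+ 2)%:E) \_ (cube y r)) z)%E.
    rewrite -integral_mkcond; under eq_integral do rewrite EFinM.
    by rewrite ge0_integralZl//; exact: measurable_funTS.
  apply: ae_ge0_le_integral => //.
  - by move=> z _; rewrite patchE; case: ifPn => // _; rewrite lee_fin mulr_ge0 ?sqr_ge0.
  - apply/(measurable_restrictT _ mc); apply: measurable_funTS; apply/measurable_EFinP.
    by apply: measurable_funM => //; exact/measurable_EFinP.
  - by move=> z _; rewrite lee_fin coulomb_ge0.
  - by apply/measurable_EFinP; exact: measurable_coulomb_l.
  (* At [z = x] the kernel takes the value 0 by convention and the pointwise bound may fail;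
     [cube x 0] is this single point, a null set. *)
  exists (cube x 0); split; first exact: measurable_cube.
    by rewrite [LHS]leb3_cube// mul0rn expr0n.
  move=> z /= /not_implyP[_]; rewrite /cube /= => H.
  rewrite normr_le0 subr_eq0; apply/eqP; apply: contra_notP H => zx.
  rewrite patchE; case: ifPn => [/set_mem zr|_]; last by rewrite lee_fin coulomb_ge0.
  rewrite lee_fin /coulomb /k -mulrA mulrC ler_wpM2l ?mulr_ge0 ?sqr_ge0//.
  rewrite lef_pV2 ?posrE ?mulr_gt0//; first exact: (enorm_cube (ltW r0) xr zr).
  by apply: enorm_gt0; rewrite subr_eq0; apply/eqP => xz; apply: zx.
rewrite muleA [X in (_ <= X)%E](_ : _ = \int[leb3 R]_x \int[leb3 R]_z (coulomb u x z)%:E)%E//.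
have -> : ((4 * r)^-1%:E * s * s = \int[leb3 R]_x ((fun x => ((4 * r)^-1 * `|u x| ^+ 2)%:E * s) \_ (cube y r)) x)%E.
  rewrite -integral_mkcond ge0_integralZr//.
  - congr (_ * _)%E; under eq_integral do rewrite EFinM.
    by rewrite ge0_integralZl//; exact: measurable_funTS.
  - by apply: measurable_funTS; apply/measurable_EFinP; apply: measurable_funM => //; exact/measurable_EFinP.
  - by move=> x _; rewrite lee_fin mulr_ge0 ?sqr_ge0.
apply: ge0_le_integral => //.
- move=> x _; rewrite patchE; case: ifPn => // _; rewrite mule_ge0// lee_fin mulr_ge0 ?sqr_ge0//.
- apply/(measurable_restrictT _ mc); apply: measurable_funTS; apply: emeasurable_funM => //.
  by apply/measurable_EFinP; apply: measurable_funM => //; exact/measurable_EFinP.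
- exact: measurable_coulomb_int.
move=> x _; rewrite patchE; case: ifPn => [/set_mem|_]; first exact: inner.
by apply: integral_ge0 => z _; rewrite lee_fin coulomb_ge0.
Qed.

Lemma test_function_neq0 : exists f : R3 R -> R, test_function f /\ (0 < mass f)%E.
Proof.
pose f := plateau3 1 ((-2, -2, -2) : R3 R) (2, 2, 2); exists f; split; first exact: plateau3_test.
have mf : measurable_fun [set: M3 R] f.
  by apply: continuous_measurable3; apply: smooth_continuous; apply: test_smooth; exact: plateau3_test.
apply: lt_le_trans (mass_cube_ge 0 1 mf).
have f1 x : cube 0 1 x -> f x = 1.
  rewrite /cube /= subr0 => x1; rewrite /f /plateau3 /plateau /=.
  have E i : (1 <= 1%:R * (crd i x - -2)) /\ (1 <= 1%:R * (2 - crd i x)).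
    have := norm_crd i x; rewrite ler_norml => /andP[h1 h2]; split; lra.
  rewrite !step_ge1 ?mulr1//.
all: try by have [] := E 0.
all: try by have [] := E 1.
all: try by have [] := E (Ordinal (ltnSn 2)).
rewrite (eq_integral (fun=> 1%:E)); last first.
  by move=> x /set_mem /f1 ->; rewrite normr1 expr1n.
rewrite integral_cst; last exact: measurable_cube.
by rewrite mul1e [X in (_ < X)%E]leb3_cube// lte_fin exprn_gt0//; lra.
Qed.

End parts.

(** * The fiber map *)

Lemma cube_homo (R : realType) :
  {homo (fun n : nat => cube (0 : R3 R) n%:R : set (M3 R)) : n m / (n <= m)%N >-> n `<=` m}.
Proof. by move=> n m nm x /le_trans; apply; rewrite ler_nat. Qed.

Lemma bigcup_cube (R : realType) : \bigcup_n (cube (0 : R3 R) n%:R : set (M3 R)) = setT.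
Proof.
apply/seteqP; split=> // x _; exists (Num.trunc `|x : R3 R|).+1 => //.
by rewrite /cube /= subr0 ltW// truncnS_gt.
Qed.

Lemma cube_exhaust (R : realType) (f : R3 R -> \bar R) :
  measurable_fun [set: M3 R] f -> (forall x, 0 <= f x)%E ->
  (\int[leb3 R]_(x in cube 0%R n%:R) f x)%E @[n --> \oo] --> (\int[leb3 R]_x f x)%E.
Proof.
move=> mf f0; rewrite -bigcup_cube; apply: ge0_nondecreasing_set_cvg_integral => //.
- by move=> n m nm; apply/subsetPset; exact: cube_homo.
- by move=> n; exact: measurable_cube.
- by move=> n; exact: measurable_funTS.
Qed.

Section fiber_function.
Context (R : realType) (sg gam a p : R).

Definition gfun (A B C t : R) : R :=
  1 / 2 * (t ^+ 2 * A) - gam / 4 * (t * B) - a / p * (t `^ sg * C).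

Definition dgfun (A B C t : R) : R :=
  t * A - gam / 4 * B - a / p * sg * (t `^ (sg - 1) * C).

Definition ddgfun (A C t : R) : R :=
  A - a / p * sg * (sg - 1) * (t `^ (sg - 2) * C).

Lemma is_derive_gfun (A B C t : R) : 0 < t -> is_derive t (1 : R) (gfun A B C) (dgfun A B C t).
Proof.
move=> t0.
have d1 := is_deriveZ (1 / 2 * A) (is_deriveX 2 (is_derive_id t (1 : R))).
have d2 := is_deriveZ (gam / 4 * B) (is_derive_id t (1 : R)).
have d3 := is_deriveZ (a / p * C) (is_derive1_powR sg t0).
have := is_deriveB (is_deriveB d1 d2) d3.
rewrite exprfctE => H.
have E : gfun A B C = (fun x : R => 1 / 2 * A * x ^+ 2 - gam / 4 * B * x - a / p * C * x `^ sg).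
  by apply/funext => x; rewrite /gfun; ring.
rewrite E; apply: (@is_derive_eq R R R _ t 1 _ _ H).
by rewrite /dgfun /GRing.scale /= expr1; move: (a / p) => q; field.
Qed.

Lemma is_derive_dgfun (A B C t : R) : 0 < t -> is_derive t (1 : R) (dgfun A B C) (ddgfun A C t).
Proof.
move=> t0.
have d1 := is_deriveZ A (is_derive_id t (1 : R)).
have d2 := is_derive_cst (gam / 4 * B) t (1 : R).
have d3 := is_deriveZ (a / p * sg * C) (is_derive1_powR (sg - 1) t0).
have H := is_deriveB (is_deriveB d1 d2) d3.
have E : dgfun A B C = (fun x : R => A * x - gam / 4 * B - a / p * sg * C * x `^ (sg - 1)).
  by apply/funext => x; rewrite /dgfun; ring.
rewrite E; apply: (@is_derive_eq R R R _ t 1 _ _ H).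
have -> : sg - 1 - 1 = sg - 2 by lra.
by rewrite /ddgfun /GRing.scale /=; ring.
Qed.

End fiber_function.

Section values.
Context (R : realType) (p gam a KH KGN : R).
Hypotheses (hp : 10 / 3 < p <= 6) (hgam : 0 < gam) (ha : 0 < a)
  (hKH : 0 < KH) (hKGN : 0 < KGN).
Hypothesis hB : forall (c : R) (u : R3 R -> R), 0 < c -> sphere c u ->
     (Bint u <= (KH * Num.sqrt (fine (Aint u)) * c `^ (3 / 2))%:E)%E.
Hypothesis hC : forall (c : R) (u : R3 R -> R), 0 < c -> sphere c u ->
     (Cint p u <= (KGN * fine (Aint u) `^ (sigma p / 2) * c `^ ((6 - p) / 4))%:E)%E.
Implicit Types (u v : R3 R -> R) (c t : R).

(** [fine] turns an infinite integral into 0. That these values are the true ones comes from [H1]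
    for the gradient, and for B and C from [hB] and [hC], whose extended-real form contains
    finiteness. *)
Definition vA u : R := fine (Aint u).
Definition vB u : R := fine (Bint u).
Definition vC u : R := fine (Cint p u).

Lemma H1_L2 u : H1 u -> u \in Lfun (leb3 R) 2%:E. Proof. by case. Qed.

Lemma H1_measurable u : H1 u -> measurable_fun [set: M3 R] u.
Proof. by move=> /H1_L2 /L2_measurable. Qed.

Lemma Aint_ge0 u : (0 <= Aint u)%E.
Proof. by apply: integral_ge0 => x _; rewrite lee_fin sumr_ge0// => i _; rewrite sqr_ge0. Qed.

Lemma Bint_ge0 u : (0 <= Bint u)%E.
Proof.
apply: integral_ge0 => x _; apply: integral_ge0 => y _.
by rewrite lee_fin !mulr_ge0 ?sqr_ge0// invr_ge0 sqrtr_ge0.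
Qed.

Lemma Cint_ge0 u : (0 <= Cint p u)%E.
Proof. by apply: integral_ge0 => x _; rewrite lee_fin powR_ge0. Qed.

Lemma Aint_vA u : H1 u -> Aint u = (vA u)%:E.
Proof.
move=> uH; have uG := H1_is_grad uH; rewrite /vA fineK// ge0_fin_numE ?Aint_ge0//.
rewrite (Aint_grad uG).
have L2i i := Lfun2_integrable_sqr (uG.2 i).1.
have : (leb3 R).-integrable setT (fun x => \sum_(i < 3) (weak_partial i u x ^+ 2)%:E)%E.
  by apply: integrable_sum => // i _; exact: L2i.
move=> /integrableP[_]; apply: le_lt_trans; rewrite le_eqVlt; apply/orP; left; apply/eqP.
apply: eq_integral => x _; rewrite sumEFin gee0_abs// lee_fin sumr_ge0// => i _.
by rewrite sqr_ge0.
Qed.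

Lemma Bint_vB u c : 0 < c -> sphere c u -> Bint u = (vB u)%:E.
Proof.
move=> c0 uS; rewrite /vB fineK// ge0_fin_numE ?Bint_ge0//.
exact: le_lt_trans (hB c0 uS) (ltry _).
Qed.

Lemma Cint_vC u c : 0 < c -> sphere c u -> Cint p u = (vC u)%:E.
Proof.
move=> c0 uS; rewrite /vC fineK// ge0_fin_numE ?Cint_ge0//.
exact: le_lt_trans (hC c0 uS) (ltry _).
Qed.

Lemma vB_le u c : 0 < c -> sphere c u -> vB u <= KH * Num.sqrt (vA u) * c `^ (3 / 2).
Proof. by move=> c0 uS; rewrite -lee_fin -(Bint_vB c0 uS) hB. Qed.

Lemma vC_le u c : 0 < c -> sphere c u ->
  vC u <= KGN * vA u `^ (sigma p / 2) * c `^ ((6 - p) / 4).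
Proof. by move=> c0 uS; rewrite -lee_fin -(Cint_vC c0 uS) hC. Qed.

Lemma vA_ge0 u : 0 <= vA u. Proof. exact: fine_ge0 (Aint_ge0 u). Qed.
Lemma vB_ge0 u : 0 <= vB u. Proof. exact: fine_ge0 (Bint_ge0 u). Qed.
Lemma vC_ge0 u : 0 <= vC u. Proof. exact: fine_ge0 (Cint_ge0 u). Qed.

(** Positive total mass gives positive mass in some cube, where [Bint_cube] applies. *)
Lemma vB_gt0 u c : 0 < c -> sphere c u -> 0 < vB u.
Proof.
move=> c0 uS; have [uH um] := uS; have mu := H1_measurable uH.
have msq : measurable_fun [set: M3 R] (fun x => (`|u x| ^+ 2)%:E).
  by apply/measurable_EFinP; apply: measurable_funX; exact: measurableT_comp.
have [n n0] : exists n : nat, (0 < \int[leb3 R]_(x in cube 0%R n%:R) (`|u x| ^+ 2)%:E)%E.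
  apply: contrapT => /forallNP H.
  have H0 n : (\int[leb3 R]_(x in cube 0%R n%:R) (`|u x| ^+ 2)%:E = 0)%E.
    apply/eqP; rewrite eq_le integral_ge0 ?andbT; last by move=> x _; rewrite lee_fin sqr_ge0.
    by rewrite leNgt; apply/negP; exact: H.
  have h0 (x : R3 R) : (0 <= (`|u x| ^+ 2)%:E)%E by rewrite lee_fin sqr_ge0.
  have : mass u = 0%E.
    rewrite /mass -(cvg_lim (@ereal_hausdorff R) (cube_exhaust msq h0)).
    by apply: lim_near_cst => //; exact: nearW.
  by rewrite um => -[c0']; rewrite c0' ltxx in c0.
(* [Bint_cube] needs a positive radius, and [n] could be 0. *)
have {n0} : (0 < \int[leb3 R]_(x in cube 0%R n.+1%:R) (`|u x| ^+ 2)%:E)%E.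
  apply: lt_le_trans n0 _; apply: ge0_subset_integral => //; [exact: measurable_cube|exact: measurable_cube|..].
  - exact: measurable_funTS.
  - exact: (cube_homo (leqnSn n)).
move=> n0.
rewrite -lte_fin -(Bint_vB c0 uS).
have r0 : 0 < n.+1%:R :> R by rewrite ltr0n.
apply: lt_le_trans (Bint_cube 0 mu r0).
by rewrite mule_gt0 ?lte_fin ?invr_gt0 ?mulr_gt0// mule_gt0.
Qed.

(** The bound [hB] transfers positivity from B to A, so that no statement about functions with
    vanishing gradient is needed. *)
Lemma vA_gt0 u c : 0 < c -> sphere c u -> 0 < vA u.
Proof.
move=> c0 uS; have := vB_le c0 uS; have := vB_gt0 c0 uS => B0 BA.
rewrite lt_neqAle vA_ge0 andbT eq_sym; apply/eqP => A0.
by move: (lt_le_trans B0 BA); rewrite A0 sqrtr0 mulr0 mul0r ltxx.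
Qed.

Lemma vC_gt0 u c : 0 < c -> sphere c u -> 0 < vC u.
Proof.
move=> c0 uS; have [uH um] := uS; have mu := H1_measurable uH.
rewrite lt_neqAle vC_ge0 andbT eq_sym; apply/eqP => C0.
have Ci : Cint p u = 0%E by rewrite (Cint_vC c0 uS) C0.
have mp : measurable_fun [set: M3 R] (fun x => (`|u x| `^ p)%:E).
  apply/measurable_EFinP; apply: (measurableT_comp (measurable_powR p)).
  exact: measurableT_comp.
have p0 : p != 0 by apply/eqP => p0; move: hp; rewrite p0; lra.
have /(ae_eq_integral_abs (leb3 R) measurableT mp) : (\int[leb3 R]_x `|(`|u x| `^ p)%:E| = 0)%E.
  by rewrite -[RHS]Ci; apply: eq_integral => x _; rewrite gee0_abs// lee_fin powR_ge0.
move=> ae0.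
suff : mass u = 0%E by rewrite um => -[c0']; rewrite c0' ltxx in c0.
rewrite -[RHS](@integral0 _ (M3 R) R (leb3 R) setT).
apply: ge0_ae_eq_integral => //.
  by apply/measurable_EFinP; apply: measurable_funX; exact: measurableT_comp.
apply: ae3_imp ae0 => x /(_ I) [] /eqP; rewrite powR_eq0 => /andP[/eqP ux _] _.
by rewrite ux expr0n.
Qed.

Lemma sphere_rescale c u (al be : R) : 0 < al -> 0 < be -> sphere c u ->
  sphere (al ^+ 2 * be^-1 ^+ 3 * c) (rescale al be u).
Proof.
move=> al0 be0 [uH um]; split.
  exact: (is_grad_H1 (is_grad_rescale al be0 (H1_is_grad uH))).
by rewrite mass_rescale ?um//; exact: H1_L2.
Qed.

Lemma vA_rescale u (al be : R) : 0 < al -> 0 < be -> H1 u ->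
  vA (rescale al be u) = al ^+ 2 * be^-1 * vA u.
Proof.
move=> al0 be0 uH; rewrite /vA Aint_rescale// Aint_vA//= /vA; congr (_ * _).
by field; rewrite gt_eqF.
Qed.

Lemma vB_rescale c u al be : 0 < c -> 0 < al -> 0 < be -> sphere c u ->
  vB (rescale al be u) = al ^+ 4 * be^-1 ^+ 5 * vB u.
Proof.
move=> c0 al0 be0 uS; rewrite {1}/vB Bint_rescale//; last by apply: H1_measurable; case: uS.
rewrite (Bint_vB c0 uS) /=; congr (_ * _).
by field; rewrite gt_eqF.
Qed.

Lemma vC_rescale c u al be : 0 < c -> 0 < al -> 0 < be -> sphere c u ->
  vC (rescale al be u) = al `^ p * be^-1 ^+ 3 * vC u.
Proof.
move=> c0 al0 be0 uS; rewrite {1}/vC Cint_rescale//; last 2 first.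
- by move: hp; lra.
- by apply: H1_L2; case: uS.
by rewrite (Cint_vC c0 uS).
Qed.

Lemma scale_rescale t u : scale t u = rescale (t `^ (3 / 2)) t u.
Proof. by []. Qed.

Lemma powR_32_2 t : 0 < t -> (t `^ (3 / 2)) ^+ 2 = t ^+ 3.
Proof.
move=> t0; rewrite -powR_mulrn ?powR_ge0// -powRrM -powR_mulrn ?ltW//.
by congr (_ `^ _); field.
Qed.

Lemma sphere_scale c u t : 0 < t -> sphere c u -> sphere c (scale t u).
Proof.
move=> t0 uS; have := sphere_rescale (powR_gt0 (3 / 2) t0) t0 uS.
by rewrite powR_32_2// -exprMn mulfV ?gt_eqF// expr1n mul1r.
Qed.

Lemma vA_scale c u t : 0 < t -> sphere c u -> vA (scale t u) = t ^+ 2 * vA u.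
Proof.
move=> t0 [uH _]; rewrite scale_rescale vA_rescale ?powR_gt0// powR_32_2//.
by congr (_ * _); field; rewrite gt_eqF.
Qed.

Lemma vB_scale c u t : 0 < c -> 0 < t -> sphere c u -> vB (scale t u) = t * vB u.
Proof.
move=> c0 t0 uS; rewrite scale_rescale (vB_rescale c0) ?powR_gt0//.
rewrite (exprM _ 2 2) powR_32_2//; congr (_ * _); field.
by rewrite gt_eqF.
Qed.

Lemma vC_scale c u t : 0 < c -> 0 < t -> sphere c u -> vC (scale t u) = t `^ sigma p * vC u.
Proof.
move=> c0 t0 uS; rewrite scale_rescale (vC_rescale c0) ?powR_gt0//; congr (_ * _).
rewrite -powRrM -[t^-1]powR_inv1 ?ltW// -powR_mulrn ?powR_ge0// -powRrM -powRD; last first.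
  by apply/implyP => _; rewrite gt_eqF.
by congr (_ `^ _); rewrite /sigma; field.
Qed.

Lemma energyE u : energy gam a p u = 1 / 2 * vA u - gam / 4 * vB u - a / p * vC u.
Proof. by []. Qed.

Lemma fiberE c u t : 0 < c -> 0 < t -> sphere c u ->
  fiber gam a p u t = gfun (sigma p) gam a p (vA u) (vB u) (vC u) t.
Proof.
move=> c0 t0 uS; rewrite /fiber energyE (vA_scale t0 uS) (vB_scale c0 t0 uS) (vC_scale c0 t0 uS).
by [].
Qed.

Lemma derive1_fiber c u t : 0 < c -> 0 < t -> sphere c u ->
  derive1 (fiber gam a p u) t = dgfun (sigma p) gam a p (vA u) (vB u) (vC u) t.
Proof.
move=> c0 t0 uS; rewrite derive1E.
(* The closed formula for the fiber map holds at positive parameters only; an equality near [t]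
   suffices to differentiate. *)
have E : \near t, gfun (sigma p) gam a p (vA u) (vB u) (vC u) t = fiber gam a p u t.
  by near=> s; rewrite (fiberE c0 _ uS)//; near: s; exact: lt_nbhsr.
by have [] := near_eq_is_derive E (is_derive_gfun (sigma p) gam a p (vA u) (vB u) (vC u) t0).
Unshelve. all: by end_near. Qed.

Lemma derive2_fiber c u : 0 < c -> sphere c u ->
  derive1n 2 (fiber gam a p u) 1 = ddgfun (sigma p) a p (vA u) (vC u) 1.
Proof.
move=> c0 uS; rewrite derive1nS derive1n1 derive1E.
have E : \forall s \near (1 : R), dgfun (sigma p) gam a p (vA u) (vB u) (vC u) s = derive1 (fiber gam a p u) s.
  near=> s; rewrite (derive1_fiber c0 _ uS)//; near: s; exact: lt_nbhsr.
by have [] := near_eq_is_derive E (is_derive_dgfun (sigma p) gam a p (vA u) (vB u) (vC u) ltr01).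
Unshelve. all: by end_near. Qed.

(** The equation is the Pohozaev identity; the inequality puts 1 strictly beyond the inflection
    point of the fiber map. *)
Lemma Lambda_minusP c u : 0 < c -> Lambda_minus gam a p c u <->
  [/\ sphere c u, vA u - gam / 4 * vB u - a / p * sigma p * vC u = 0 &
     vA u < a / p * sigma p * (sigma p - 1) * vC u].
Proof.
move=> c0; split=> -[uS].
  rewrite (derive1_fiber c0 ltr01 uS) (derive2_fiber c0 uS) /dgfun /ddgfun !powR1 !mul1r => h1 h2.
  by split => //; move: h2; rewrite subr_lt0.
move=> h1 h2; split => //.
  by rewrite (derive1_fiber c0 ltr01 uS) /dgfun !powR1 !mul1r.
by rewrite (derive2_fiber c0 uS) /ddgfun !powR1 !mul1r subr_lt0.
Qed.

End values.

(** * Critical points of the fiber map *)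

Lemma powRD_gt0 (R : realType) (x r s : R) : 0 < x -> x `^ (r + s) = x `^ r * x `^ s.
Proof. by move=> x0; rewrite powRD// (gt_eqF x0) implybT. Qed.

Section fiber_critical.
Context (R : realType) (sg gam a p : R).
Hypotheses (sg2 : 2 < sg) (gam0 : 0 < gam) (a0 : 0 < a) (p0 : 0 < p).
Implicit Types A B C t : R.

Lemma dgfun_continuous A B C t : 0 < t -> {for t, continuous (dgfun sg gam a p A B C)}.
Proof.
move=> t0; apply: differentiable_continuous; apply/derivable1_diffP.
by have [] := is_derive_dgfun sg gam a p A B C t0.
Qed.

(** [ts] is the zero of the second derivative, and the gap hypothesis says exactly that the first
    derivative is positive there. It is negative at [T], so it vanishes in between, in the region
    where the second derivative is already negative. *)
Lemma crit_exists A B C (ts T : R) : 0 < C -> 0 < ts -> ts < T ->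
  A = a / p * sg * (sg - 1) * (ts `^ (sg - 2) * C) ->
  gam / 4 * B < A * ts * ((sg - 2) / (sg - 1)) ->
  dgfun sg gam a p A B C T < 0 ->
  exists t, [/\ ts < t < T, dgfun sg gam a p A B C t = 0 &
    A < a / p * sg * (sg - 1) * (t `^ (sg - 2) * C)].
Proof.
move=> C0 ts0 tsT AE gap dT.
have dts : 0 < dgfun sg gam a p A B C ts.
  rewrite /dgfun.
  have -> : ts `^ (sg - 1) = ts * ts `^ (sg - 2).
    have -> : sg - 1 = 1 + (sg - 2) by lra.
    by rewrite (powRD_gt0 1 (sg - 2) ts0) powRr1 ?ltW.
  have E : a / p * sg * (ts * ts `^ (sg - 2) * C) = ts * A / (sg - 1).
    by rewrite AE; field; rewrite !gt_eqF//; move: sg2; lra.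
  rewrite E.
  have -> : ts * A - gam / 4 * B - ts * A / (sg - 1) = A * ts * ((sg - 2) / (sg - 1)) - gam / 4 * B.
    by field; rewrite gt_eqF//; move: sg2; lra.
  by rewrite subr_gt0.
have cont : {within `[ts, T], continuous (dgfun sg gam a p A B C)}.
  apply: continuous_in_subspaceT => x; rewrite inE /= in_itv/= => /andP[tx _].
  by apply: dgfun_continuous; exact: lt_le_trans tx.
have [|t] := IVT (ltW tsT) cont (v := 0).
  by rewrite ge_min le_max (ltW dT) (ltW dts) orbT.
rewrite in_itv/= => /andP[tst tT] dt; exists t.
have tst' : ts < t by rewrite lt_neqAle tst andbT; apply/eqP => E; move: dts; rewrite E dt ltxx.
split=> //.
  by rewrite tst' lt_neqAle tT andbT; apply/eqP => E; move: dT; rewrite -E dt ltxx.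
rewrite {1}AE ltr_pM2l; last by rewrite !mulr_gt0 ?invr_gt0//; move: sg2; lra.
rewrite ltr_pM2r//; apply: gt0_ltr_powR => //; rewrite ?nnegrE ?(ltW ts0) ?(ltW (lt_trans ts0 tst'))//.
by move: sg2; lra.
Qed.

Lemma ddgfun_decr A C (s t : R) : 0 < C -> 0 < s -> s < t ->
  ddgfun sg a p A C t < ddgfun sg a p A C s.
Proof.
move=> C0 s0 st; rewrite /ddgfun ltrD2l ltrN2.
have K0 : 0 < a / p * sg * (sg - 1) by rewrite !mulr_gt0 ?invr_gt0//; move: sg2; lra.
rewrite ltr_pM2l//.
rewrite ltr_pM2r//; apply: gt0_ltr_powR => //; rewrite ?nnegrE ?(ltW s0) ?(ltW (lt_trans s0 st))//.
by move: sg2; lra.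
Qed.

Lemma gfun_mvt A B C (s t : R) : 0 < s -> s < t -> exists2 x, s < x < t &
  gfun sg gam a p A B C t - gfun sg gam a p A B C s = dgfun sg gam a p A B C x * (t - s).
Proof.
move=> s0 st.
have [x||x] := @MVT _ (gfun sg gam a p A B C) (dgfun sg gam a p A B C) _ _ st.
- by rewrite in_itv/= => /andP[sx _]; apply: is_derive_gfun; exact: lt_trans sx.
- apply: continuous_in_subspaceT => x; rewrite inE /= in_itv/= => /andP[sx _].
  apply: differentiable_continuous; apply/derivable1_diffP.
  by have [] := is_derive_gfun sg gam a p A B C (lt_le_trans s0 sx).
by rewrite in_itv/= => sx E; exists x.
Qed.

Lemma dgfun_mvt A B C (s t : R) : 0 < s -> s < t -> exists2 x, s < x < t &
  dgfun sg gam a p A B C t - dgfun sg gam a p A B C s = ddgfun sg a p A C x * (t - s).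
Proof.
move=> s0 st.
have [x||x] := @MVT _ (dgfun sg gam a p A B C) (ddgfun sg a p A C) _ _ st.
- by rewrite in_itv/= => /andP[sx _]; apply: is_derive_dgfun; exact: lt_trans sx.
- apply: continuous_in_subspaceT => x; rewrite inE /= in_itv/= => /andP[sx _].
  by apply: dgfun_continuous; exact: lt_le_trans sx.
by rewrite in_itv/= => sx E; exists x.
Qed.

(* The derivative of the fiber map is concave, so it is nonnegative between [t] and [1]. *)
Lemma gfun_le1 A B C t : 0 < C -> 0 < t -> t <= 1 ->
  0 <= dgfun sg gam a p A B C t -> dgfun sg gam a p A B C 1 = 0 ->
  gfun sg gam a p A B C t <= gfun sg gam a p A B C 1.
Proof.
move=> C0 t0; rewrite le_eqVlt => /predU1P[->//|t1] dt d1.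
have [x /andP[tx x1] E] := gfun_mvt A B C t0 t1.
rewrite -subr_ge0 E; apply: mulr_ge0; last by rewrite subr_ge0 ltW.
rewrite leNgt; apply/negP => dx.
have [y /andP[ty yx] Ey] := dgfun_mvt A B C t0 tx.
have [z /andP[xz z1] Ez] := dgfun_mvt A B C (lt_trans t0 tx) x1.
have : ddgfun sg a p A C z < ddgfun sg a p A C y.
  by apply: ddgfun_decr => //; [exact: lt_trans ty|exact: lt_trans xz].
have : 0 < ddgfun sg a p A C z.
  have h : 0 < 1 - x by rewrite subr_gt0.
  by rewrite -(pmulr_lgt0 _ h) -Ez d1 sub0r oppr_gt0.
have : ddgfun sg a p A C y < 0.
  have h : 0 < x - t by rewrite subr_gt0.
  by rewrite -(pmulr_llt0 _ h) -Ey subr_lt0 (lt_le_trans dx).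
by lra.
Qed.

End fiber_critical.

(** This is where [c1] comes from. If the gap failed, the bounds on B and C at the inflection point
    [ts] would give 1 <= K KGN X^(sigma - 2) c^(2 (p - 3)), and [c1] is the value of c for which
    this product equals 1. *)
Lemma c1_gap (R : realType) (p gam a KH KGN A B C c ts : R) :
  10 / 3 < p -> 0 < gam -> 0 < a -> 0 < KH -> 0 < KGN ->
  0 < A -> 0 < C -> 0 < ts -> 0 < c -> c < c1 gam a p KH KGN ->
  B <= KH * Num.sqrt A * c `^ (3 / 2) ->
  C <= KGN * A `^ (sigma p / 2) * c `^ ((6 - p) / 4) ->
  A = a / p * sigma p * (sigma p - 1) * (ts `^ (sigma p - 2) * C) ->
  gam / 4 * B < A * ts * ((sigma p - 2) / (sigma p - 1)).
Proof.
move=> hp gam0 a0 KH0 KG0 A0 C0 ts0 c0 cc1 hB hC AE.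
have p0 : 0 < p by lra.
have sg2 : 2 < sigma p by rewrite /sigma; lra.
have sgE : sigma p - 2 = (3 * p - 10) / 2 by rewrite /sigma; lra.
have sA : 0 < Num.sqrt A by rewrite sqrtr_gt0.
have AA : A = Num.sqrt A ^+ 2 by rewrite sqr_sqrtr// ltW.
set K := a / p * sigma p * (sigma p - 1) in AE *.
have K0 : 0 < K by rewrite /K !mulr_gt0 ?invr_gt0//; lra.
(* By [hB], the claim follows once sqrt A times [ts] exceeds X c^(3/2). *)
set X := gam * KH / 4 * ((sigma p - 1) / (sigma p - 2)).
have X0 : 0 < X by rewrite /X !mulr_gt0 ?invr_gt0//; lra.
suff yX : X * c `^ (3 / 2) < Num.sqrt A * ts.
  apply: (@le_lt_trans _ _ (gam / 4 * (KH * Num.sqrt A * c `^ (3 / 2)))).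
    by rewrite ler_pM2l ?divr_gt0.
  have -> : gam / 4 * (KH * Num.sqrt A * c `^ (3 / 2)) =
      X * c `^ (3 / 2) * (Num.sqrt A * ((sigma p - 2) / (sigma p - 1))).
    by rewrite /X; field; rewrite !gt_eqF//; lra.
  have -> : A * ts * ((sigma p - 2) / (sigma p - 1)) =
      Num.sqrt A * ts * (Num.sqrt A * ((sigma p - 2) / (sigma p - 1))).
    by rewrite {1}AA; ring.
  by rewrite ltr_pM2r// !mulr_gt0 ?invr_gt0//; lra.
rewrite ltNge; apply/negP => yX.
(* In terms of [y] the powers of A and [ts] combine: A^(sigma / 2) ts^(sigma - 2) = A y^(sigma - 2),
   and the factor A cancels against the equation of the inflection point. *)
set y := Num.sqrt A * ts in yX.
have y0 : 0 < y by rewrite mulr_gt0.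
have e1 : A `^ (sigma p / 2) * ts `^ (sigma p - 2) = A * y `^ (sigma p - 2).
  rewrite /y powRM ?ltW// mulrA; congr (_ * _).
  rewrite {1 2}AA -!powR_mulrn ?ltW// -!powRrM -powRD_gt0//.
  by congr (_ `^ _); lra.
have h1 : 1 <= K * KGN * c `^ ((6 - p) / 4) * y `^ (sigma p - 2).
  rewrite -(ler_pM2l A0) mulr1 {1}AE.
  have -> : A * (K * KGN * c `^ ((6 - p) / 4) * y `^ (sigma p - 2)) =
     K * (ts `^ (sigma p - 2) * (KGN * A `^ (sigma p / 2) * c `^ ((6 - p) / 4))).
     transitivity (K * KGN * c `^ ((6 - p) / 4) * (A * y `^ (sigma p - 2))); first by ring.
     by rewrite -e1; ring.
  by rewrite ler_pM2l// ler_pM2l// powR_gt0.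
have h2 : y `^ (sigma p - 2) <= X `^ (sigma p - 2) * c `^ (3 / 2 * (sigma p - 2)).
  rewrite powRrM -powRM ?powR_ge0 ?(ltW X0)//; apply: ge0_ler_powR => //.
  - by rewrite subr_ge0 ltW.
  - by rewrite nnegrE ltW.
  - by rewrite nnegrE mulr_ge0 ?powR_ge0 ?ltW.
have h3 : 1 <= K * KGN * X `^ (sigma p - 2) * c `^ (2 * (p - 3)).
  apply: le_trans h1 _.
  have -> : 2 * (p - 3) = (6 - p) / 4 + 3 / 2 * (sigma p - 2) by rewrite /sigma; lra.
  rewrite (powRD_gt0 ((6 - p) / 4) _ c0).
  have -> : K * KGN * X `^ (sigma p - 2) * (c `^ ((6 - p) / 4) * c `^ (3 / 2 * (sigma p - 2))) =
    K * KGN * c `^ ((6 - p) / 4) * (X `^ (sigma p - 2) * c `^ (3 / 2 * (sigma p - 2))) by ring.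
  by apply: ler_wpM2l h2; apply: mulr_ge0 (powR_ge0 _ _); apply: mulr_ge0; exact: ltW.
have h4 : c `^ (2 * (p - 3)) < c1 gam a p KH KGN `^ (2 * (p - 3)).
  by apply: gt0_ltr_powR; rewrite ?nnegrE ?ltW//; [lra|exact: lt_trans cc1].
have h5 : c1 gam a p KH KGN `^ (2 * (p - 3)) = (K * KGN * X `^ (sigma p - 2))^-1.
  rewrite /c1 powRM ?powR_ge0// -!powRrM.
  have -> : 1 / (2 * (p - 3)) * (2 * (p - 3)) = 1 by field; rewrite gt_eqF//; lra.
  have -> : (3 * p - 10) / (4 * (p - 3)) * (2 * (p - 3)) = sigma p - 2.
    by rewrite sgE; field; rewrite gt_eqF//; lra.
  have -> : 4 / (gam * KH) * ((sigma p - 2) / (sigma p - 1)) = X^-1.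
    by rewrite /X; field; rewrite !gt_eqF//; lra.
  have -> : p / (a * sigma p * (sigma p - 1) * KGN) = (K * KGN)^-1.
    by rewrite /K; field; rewrite !gt_eqF//; lra.
  rewrite powRr1; last by rewrite invr_ge0 mulr_ge0// ltW.
  have -> : X^-1 `^ (sigma p - 2) = (X `^ (sigma p - 2))^-1.
    by rewrite -powR_inv1 ?(ltW X0)// -powRrM mulrC powRrM powR_inv1// powR_ge0.
  by rewrite [in RHS]mulrC [RHS]invfM.
move: h4; rewrite h5 ltNge => /negP; apply.
rewrite -[leLHS]mulr1 ler_pdivrMl//.
exact: mulr_gt0 (mulr_gt0 K0 KG0) (powR_gt0 _ X0).
Qed.

(** * Comparison of two masses *)

Lemma powR_gt1 (R : realType) (x y : R) : 1 < x -> 0 < y -> 1 < x `^ y.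
Proof.
move=> x1 y0; have E : (1 : R) `^ y = 1 by rewrite powR1.
by rewrite -E; apply: gt0_ltr_powR => //; rewrite ?nnegrE// ltW// (lt_trans ltr01).
Qed.

Lemma powR_ge1 (R : realType) (x y : R) : 1 <= x -> 0 <= y -> 1 <= x `^ y.
Proof. by move=> x1 y0; have := ler_powR x1 y0; rewrite powRr0. Qed.

Lemma powRV (R : realType) (x y : R) : 0 <= x -> x^-1 `^ y = x `^ (- y).
Proof. by move=> x0; rewrite -powR_inv1// -powRrM mulN1r. Qed.

Section fiber_compare.
Context (R : realType) (sg gam a p A B C b q : R).
Hypotheses (sg2 : 2 < sg) (gam0 : 0 < gam) (a0 : 0 < a) (p0 : 0 < p)
  (A0 : 0 < A) (B0 : 0 < B) (C0 : 0 < C) (b1 : 1 < b) (q1 : 1 <= q).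

Lemma dgfun_lt (t : R) : 0 < t ->
  dgfun sg gam a p A (b * B) (q * C) t < dgfun sg gam a p A B C t.
Proof.
move=> t0; rewrite /dgfun.
have h1 : gam / 4 * B < gam / 4 * (b * B).
  by rewrite ltr_pM2l ?divr_gt0// ltr_pMl.
have K10 : 0 < a / p * sg by rewrite mulr_gt0 ?divr_gt0//; move: sg2; lra.
have h2 : a / p * sg * (t `^ (sg - 1) * C) <= a / p * sg * (t `^ (sg - 1) * (q * C)).
  by rewrite ler_pM2l// ler_pM2l ?powR_gt0// ler_pMl.
by lra.
Qed.

(** At a critical point of the map with the increased B and C, the derivative of the original map is
    still positive, so [gfun_le1] compares the original values at [t] and at 1. The subtracted terms
    are the difference of the two maps at [t]. *)
Lemma gfun_compare (t : R) : 0 < t -> t <= 1 ->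
  dgfun sg gam a p A (b * B) (q * C) t = 0 -> dgfun sg gam a p A B C 1 = 0 ->
  gfun sg gam a p A (b * B) (q * C) t <= gfun sg gam a p A B C 1
     - gam / 4 * (1 - b^-1) * (t * (b * B)) - a / p * (1 - q^-1) * (t `^ sg * (q * C)).
Proof.
move=> t0 t1 dt d1.
have := @gfun_le1 R sg gam a p sg2 a0 p0 A B C t C0 t0 t1.
rewrite -{1}dt => /(_ (ltW (dgfun_lt t0)) d1).
move: (gfun sg gam a p A B C 1) => g1; rewrite /gfun.
have bn0 : b != 0 by rewrite gt_eqF// (lt_trans ltr01).
have qn0 : q != 0 by rewrite gt_eqF// (lt_le_trans ltr01).
have e1 : gam / 4 * (1 - b^-1) * (t * (b * B)) =
   gam / 4 * (t * (b * B)) - gam / 4 * (t * B) by field.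
have pn0 : p != 0 by rewrite gt_eqF.
have e2 : a / p * (1 - q^-1) * (t `^ sg * (q * C)) =
   a / p * (t `^ sg * (q * C)) - a / p * (t `^ sg * C) by field; rewrite pn0.
by rewrite e1 e2; lra.
Qed.

End fiber_compare.

Section comparison.
Context (R : realType) (p gam a KH KGN : R).
Hypotheses (hp : 10 / 3 < p <= 6) (hgam : 0 < gam) (ha : 0 < a)
  (hKH : 0 < KH) (hKGN : 0 < KGN).
Hypothesis hB : forall (c : R) (u : R3 R -> R), 0 < c -> sphere c u ->
     (Bint u <= (KH * Num.sqrt (fine (Aint u)) * c `^ (3 / 2))%:E)%E.
Hypothesis hC : forall (c : R) (u : R3 R -> R), 0 < c -> sphere c u ->
     (Cint p u <= (KGN * fine (Aint u) `^ (sigma p / 2) * c `^ ((6 - p) / 4))%:E)%E.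
Implicit Types (u v w : R3 R -> R) (c t : R).

Local Notation LamP := (Lambda_minusP gam a hp hB hC).
Local Notation K := (a / p * sigma p * (sigma p - 1)).

Lemma sigma_gt2 : 2 < sigma p. Proof. by move: hp; rewrite /sigma; lra. Qed.

Lemma exponent_gt0 : 0 < p. Proof. by move: hp; lra. Qed.

Lemma K1_gt0 : 0 < a / p * sigma p.
Proof. by rewrite mulr_gt0 ?(lt_trans _ sigma_gt2)// divr_gt0// exponent_gt0. Qed.

Lemma K_gt0 : 0 < K.
Proof. by rewrite mulr_gt0 ?K1_gt0// subr_gt0 (lt_trans _ sigma_gt2)// ltr1n. Qed.

Lemma Lambda_minus_scale c u t : 0 < c -> 0 < t -> sphere c u ->
  dgfun (sigma p) gam a p (vA u) (vB u) (vC p u) t = 0 ->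
  vA u < K * (t `^ (sigma p - 2) * vC p u) ->
  Lambda_minus gam a p c (scale t u).
Proof.
move=> c0 t0 uS dt At; apply/LamP => //; split; first exact: sphere_scale.
  rewrite (vA_scale t0 uS) (vB_scale hB c0 t0 uS) (vC_scale hp hC c0 t0 uS).
  have -> : t `^ sigma p = t * t `^ (sigma p - 1).
    have {1}-> : sigma p = 1 + (sigma p - 1) by lra.
    by rewrite (powRD_gt0 1 (sigma p - 1) t0) powRr1 ?ltW.
  by transitivity (t * dgfun (sigma p) gam a p (vA u) (vB u) (vC p u) t);
    [rewrite /dgfun; ring|rewrite dt mulr0].
rewrite (vA_scale t0 uS) (vC_scale hp hC c0 t0 uS).
have -> : t `^ sigma p = t ^+ 2 * t `^ (sigma p - 2).
  have {1}-> : sigma p = 2 + (sigma p - 2) by lra.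
  by rewrite (powRD_gt0 2 (sigma p - 2) t0) powR_mulrn ?ltW.
have -> : K * (t ^+ 2 * t `^ (sigma p - 2) * vC p u) =
  t ^+ 2 * (K * (t `^ (sigma p - 2) * vC p u)) by move: (a / p) => q; ring.
by rewrite ltr_pM2l// exprn_gt0.
Qed.

Lemma exists_critical c u (T : R) : 0 < c -> c < c1 gam a p KH KGN -> sphere c u ->
  0 < T -> dgfun (sigma p) gam a p (vA u) (vB u) (vC p u) T < 0 ->
  vA u < K * (T `^ (sigma p - 2) * vC p u) ->
  exists t, [/\ 0 < t, t < T, dgfun (sigma p) gam a p (vA u) (vB u) (vC p u) t = 0 &
    Lambda_minus gam a p c (scale t u)].
Proof.
move=> c0 cc uS T0 dT AT.
have K0 := K_gt0; have s2 := sigma_gt2; have p0 := exponent_gt0.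
have A0 := vA_gt0 hB c0 uS; have C0 := vC_gt0 hp hC c0 uS.
have s20 : 0 < sigma p - 2 by rewrite subr_gt0.
set q := vA u / (K * vC p u).
have q0 : 0 < q by rewrite divr_gt0// mulr_gt0.
(* The zero of the second derivative of the fiber map. *)
pose ts := q `^ (sigma p - 2)^-1.
have ts0 : 0 < ts by exact: powR_gt0.
have tsE : ts `^ (sigma p - 2) = q.
  by rewrite /ts -powRrM mulVf ?gt_eqF// powRr1// ltW.
have AE : vA u = K * (ts `^ (sigma p - 2) * vC p u).
  by rewrite tsE /q; move: K0 C0; set k := K; set d := vC p u => k0 d0; field; rewrite !gt_eqF.
have tsT : ts < T.
  rewrite ltNge; apply/negP => Tts; move: AT; rewrite {1}AE.
  rewrite ltr_pM2l// ltr_pM2r// ltNge => /negP; apply.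
  by apply: ge0_ler_powR; rewrite ?nnegrE ?(ltW ts0) ?(ltW T0) ?(ltW s20).
have hp1 : 10 / 3 < p by case/andP: hp.
have gap := c1_gap hp1 hgam ha hKH hKGN A0 C0 ts0 c0 cc (vB_le hB c0 uS) (vC_le hC c0 uS) AE.
have [t [/andP[tst tT] dt At]] := crit_exists s2 ha p0 C0 ts0 tsT AE gap dT.
exists t; have t0 := lt_trans ts0 tst; split => //.
exact: Lambda_minus_scale.
Qed.

Lemma H1_mass u : H1 u -> (mass u < +oo)%E.
Proof. by move=> /H1_L2 /L2_mass. Qed.

Lemma sphere_neq0 c : 0 < c -> exists u, sphere c u.
Proof.
move=> c0; have [f [tf f0]] := test_function_neq0 R.
have fH := is_grad_H1 (test_is_grad tf).
have mE : mass f = (fine (mass f))%:E by rewrite fineK// ge0_fin_numE ?ltW// H1_mass.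
have m0 : 0 < fine (mass f) by rewrite -lte_fin -mE.
exists (rescale (Num.sqrt (c / fine (mass f))) 1 f).
have al0 : 0 < Num.sqrt (c / fine (mass f)) by rewrite sqrtr_gt0 divr_gt0.
have := sphere_rescale al0 ltr01 (conj fH mE).
rewrite sqr_sqrtr ?divr_ge0 ?ltW// invr1 expr1n mulr1 divfK//.
by rewrite gt_eqF.
Qed.

Lemma Lambda_minus_fiber c u : 0 < c -> c < c1 gam a p KH KGN -> sphere c u ->
  exists t, [/\ 0 < t, dgfun (sigma p) gam a p (vA u) (vB u) (vC p u) t = 0 &
    Lambda_minus gam a p c (scale t u)].
Proof.
move=> c0 cc uS.
have K0 := K_gt0; have s2 := sigma_gt2; have p0 := exponent_gt0.
have A0 := vA_gt0 hB c0 uS; have C0 := vC_gt0 hp hC c0 uS; have B0 := vB_gt0 hB c0 uS.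
have s20 : 0 < sigma p - 2 by rewrite subr_gt0.
set K1 := a / p * sigma p.
have K10 : 0 < K1 by exact: K1_gt0.
(* Chosen so that the C term of the derivative at [T] is [2 * T * vA u]: the derivative is then
   negative, and the second derivative too since 2 (sigma - 1) > 1. *)
set q := 2 * vA u / (K1 * vC p u).
have q0 : 0 < q by rewrite divr_gt0// mulr_gt0.
pose T := q `^ (sigma p - 2)^-1.
have T0 : 0 < T by exact: powR_gt0.
have TE : T `^ (sigma p - 2) = q.
  by rewrite /T -powRrM mulVf ?gt_eqF// powRr1// ltW.
have KC : K1 * (q * vC p u) = 2 * vA u.
  by rewrite /q; move: C0; set d := vC p u => d0; field; rewrite !gt_eqF.
have [||t [t0 tT dt tL]] := exists_critical c0 cc uS T0; last by exists t.
  have T1E : T `^ (sigma p - 1) = T * q.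
    have -> : sigma p - 1 = 1 + (sigma p - 2) by lra.
    by rewrite (powRD_gt0 1 (sigma p - 2) T0) powRr1 ?ltW// TE.
  rewrite /dgfun -/K1 T1E.
  have -> : K1 * (T * q * vC p u) = T * (2 * vA u) by rewrite -KC; ring.
  have : 0 < T * vA u by rewrite mulr_gt0.
  have : 0 < gam / 4 * vB u by rewrite mulr_gt0// divr_gt0.
  by lra.
rewrite TE -/K1.
have -> : K1 * (sigma p - 1) * (q * vC p u) = (sigma p - 1) * (2 * vA u) by rewrite -KC; ring.
have : 0 < vA u * (sigma p - 2) by rewrite mulr_gt0.
by lra.
Qed.

Lemma Lambda_minus_neq0 c : 0 < c -> c < c1 gam a p KH KGN -> Lambda_minus gam a p c !=set0.
Proof.
move=> c0 cc; have [u uS] := sphere_neq0 c0.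
by have [t [_ _ tL]] := Lambda_minus_fiber c0 cc uS; exists (scale t u).
Qed.

Lemma energy_scale c u t : 0 < c -> 0 < t -> sphere c u ->
  energy gam a p (scale t u) = gfun (sigma p) gam a p (vA u) (vB u) (vC p u) t.
Proof.
move=> c0 t0 uS.
by rewrite energyE (vA_scale t0 uS) (vB_scale hB c0 t0 uS) (vC_scale hp hC c0 t0 uS).
Qed.

Lemma Lambda_minus_compare c r u : 0 < c -> 1 < r -> r ^+ 4 * c < c1 gam a p KH KGN ->
  Lambda_minus gam a p c u ->
  exists2 w, Lambda_minus gam a p (r ^+ 4 * c) w &
    energy gam a p w <= energy gam a p u - gam / 4 * (1 - r ^- 6) * vB w
                        - a / p * (1 - r `^ (p - 6)) * vC p w.
Proof.
move=> c0 r1 cc /LamP[]// uS u1 u2.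
have r0 : 0 < r by lra.
have s2 := sigma_gt2; have p0 := exponent_gt0; have K0 := K_gt0.
have A0 := vA_gt0 hB c0 uS; have C0 := vC_gt0 hp hC c0 uS; have B0 := vB_gt0 hB c0 uS.
set al := r^-1; set be := r ^- 2.
have al0 : 0 < al by rewrite invr_gt0.
have be0 : 0 < be by rewrite invr_gt0 exprn_gt0.
set v := rescale al be u.
have rn0 : r != 0 by rewrite gt_eqF.
have vS : sphere (r ^+ 4 * c) v.
  have := sphere_rescale al0 be0 uS; congr (sphere (_ * _) _).
  by rewrite /al /be; field.
have c'0 : 0 < r ^+ 4 * c by rewrite mulr_gt0// exprn_gt0.
have crit := exists_critical c'0 cc vS ltr01; clear cc.
move: (r ^+ 4 * c) c'0 vS crit => c' c'0 vS crit.
have AE : vA v = vA u.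
  rewrite vA_rescale//; last by case: uS.
  by rewrite /al /be; field.
have BE : vB v = r ^+ 6 * vB u.
  rewrite (vB_rescale hB c0 al0 be0 uS); congr (_ * _); rewrite /al /be invrK -exprM exprVn.
  have h : r ^- 4 * r ^+ (4 + 6) = r ^+ 6 by rewrite exprD; apply: mulKf; rewrite expf_neq0.
  exact h.
have CE : vC p v = r `^ (6 - p) * vC p u.
  rewrite (vC_rescale hp hC c0 al0 be0 uS); congr (_ * _).
  have -> : be^-1 ^+ 3 = r `^ 6.
    rewrite /be invrK -exprM -[6]/(6%:R) powR_mulrn; last exact: ltW.
    by [].
  by rewrite /al (powRV _ (ltW r0)) -(powRD_gt0 _ _ r0) addrC.
have r6 : 1 < r ^+ 6 by rewrite exprn_egt1.
have -> : r `^ (p - 6) = (r `^ (6 - p))^-1 by rewrite -powRN opprB.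
rewrite -[r ^- 6]/((r ^+ 6)^-1).
have rp : 1 <= r `^ (6 - p).
  by apply: powR_ge1; [exact: ltW|rewrite subr_ge0; case/andP: hp].
move: (r ^+ 6) (r `^ (6 - p)) r6 rp BE CE => b q r6 rp BE CE.
have b0 : 0 < b by rewrite (lt_trans ltr01).
have q0 : 0 < q by rewrite (lt_le_trans ltr01).
clearbody v.
have K10 := K1_gt0.
have d1 : dgfun (sigma p) gam a p (vA u) (vB u) (vC p u) 1 = 0.
  by rewrite /dgfun !powR1 !mul1r.
(* The endpoint is [T = 1]: the derivative vanished there for [u] and the second derivative was
   negative. As A is unchanged, B grows and C does not decrease, both become negative for [v]. *)
move: crit; rewrite AE BE CE => -[||t [t0 t1 dt tL]].
- by rewrite -d1; exact: dgfun_lt.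
- by rewrite powR1 mul1r; apply: (lt_le_trans u2); rewrite (ler_pM2l K0) (ler_pMl _ C0).
exists (scale t v); first exact: tL.
rewrite energyE (vA_scale t0 vS) (vB_scale hB c'0 t0 vS) (vC_scale hp hC c'0 t0 vS) AE BE CE.
have -> : energy gam a p u = gfun (sigma p) gam a p (vA u) (vB u) (vC p u) 1.
  by rewrite energyE /gfun powR1 expr1n !mul1r.
exact: (gfun_compare s2 hgam ha p0 B0 C0 r6 rp t0 (ltW t1) dt d1).
Qed.

(** The concavity condition with [hC] reads A < K KGN A^(sigma / 2) c^((6 - p) / 4), and sigma / 2 >
    1 keeps A away from 0; the same condition passes the bound on to C. *)
Lemma Lambda_minus_lower c : 0 < c -> exists A0, 0 < A0 /\
  forall u, Lambda_minus gam a p c u -> A0 < vA u /\ A0 / K < vC p u.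
Proof.
move=> c0.
have s2 := sigma_gt2; have p0 := exponent_gt0; have K0 := K_gt0.
set M := K * KGN * c `^ ((6 - p) / 4).
have M0 : 0 < M by exact: mulr_gt0 (mulr_gt0 K0 hKGN) (powR_gt0 _ c0).
set e := sigma p / 2 - 1; have e0 : 0 < e by rewrite /e; lra.
exists (M^-1 `^ e^-1); split; first by rewrite powR_gt0// invr_gt0.
move=> u /LamP[]// uS _ u2.
have A0 := vA_gt0 hB c0 uS; have C0 := vC_gt0 hp hC c0 uS.
have AL : M^-1 `^ e^-1 < vA u.
  have h : vA u < vA u * (M * vA u `^ e).
    apply: lt_le_trans u2 _.
    have -> : vA u * (M * vA u `^ e) = K * (KGN * vA u `^ (sigma p / 2) * c `^ ((6 - p) / 4)).
      have -> : sigma p / 2 = 1 + e by rewrite /e; lra.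
      by rewrite (powRD_gt0 1 e A0) powRr1 ?ltW// /M; move: (a / p) => q; ring.
    by rewrite ler_pM2l// vC_le.
  rewrite ltr_pMr// in h.
  rewrite ltNge; apply/negP => AM.
  suff : vA u `^ e <= M^-1 by rewrite -[leRHS]mulr1 ler_pdivlMl// leNgt h.
  have -> : M^-1 = (M^-1 `^ e^-1) `^ e.
    by rewrite -powRrM mulVf ?gt_eqF// powRr1// invr_ge0 ltW.
  by apply: ge0_ler_powR; rewrite ?nnegrE ?powR_ge0 ?(ltW e0) ?(ltW A0).
split => //.
by rewrite ltr_pdivrMr// mulrC (lt_trans AL).
Qed.

Lemma Lambda_minus_energyE c u : 0 < c -> Lambda_minus gam a p c u ->
  energy gam a p u = (1 / 2 - (sigma p)^-1) * vA u - gam / 4 * (1 - (sigma p)^-1) * vB u.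
Proof.
move=> c0 /LamP[]// uS u1 _; have s2 := sigma_gt2; have p0 := exponent_gt0.
have : a / p * vC p u = (vA u - gam / 4 * vB u) / sigma p.
  have -> : vA u - gam / 4 * vB u = a / p * vC p u * sigma p by move: u1; lra.
  by rewrite mulfK// gt_eqF//; lra.
rewrite energyE => ->.
by field; rewrite gt_eqF//; lra.
Qed.

Lemma energy_bounded_below c : 0 < c ->
  exists M, forall u, Lambda_minus gam a p c u -> M <= energy gam a p u.
Proof.
move=> c0; have s2 := sigma_gt2.
set k1 := 1 / 2 - (sigma p)^-1.
have k10 : 0 < k1 by rewrite /k1 subr_gt0 div1r ltf_pV2 ?posrE//; lra.
set k2 := gam / 4 * KH * c `^ (3 / 2).
have k20 : 0 < k2 by rewrite !mulr_gt0 ?powR_gt0// invr_gt0.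
(* On the constraint the energy is at least k1 y^2 - k2 y with y = sqrt A; this is the minimum of
   the quadratic. *)
exists (- (k2 ^+ 2 / (4 * k1))) => u uL.
rewrite (Lambda_minus_energyE c0 uL) -/k1.
have uS : sphere c u by case: uL.
have B0 := vB_ge0 u; have A0 := vA_gt0 hB c0 uS.
have hb : gam / 4 * (1 - (sigma p)^-1) * vB u <= k2 * Num.sqrt (vA u).
  apply: (@le_trans _ _ (gam / 4 * 1 * vB u)).
    rewrite ler_wpM2r// ler_pM2l ?divr_gt0// lerBlDr lerDl invr_ge0; lra.
  rewrite mulr1 (_ : k2 * _ = gam / 4 * (KH * Num.sqrt (vA u) * c `^ (3 / 2))).
    by rewrite ler_pM2l ?divr_gt0//; exact: vB_le.
  by rewrite /k2; ring.
have AA : vA u = Num.sqrt (vA u) ^+ 2 by rewrite sqr_sqrtr// ltW.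
set y := Num.sqrt (vA u) in AA hb; rewrite AA.
have : 0 <= k1 * (y - k2 / (2 * k1)) ^+ 2 by rewrite mulr_ge0 ?sqr_ge0// ltW.
have -> : k1 * (y - k2 / (2 * k1)) ^+ 2 = k1 * y ^+ 2 - k2 * y + k2 ^+ 2 / (4 * k1).
  by field; rewrite gt_eqF.
by lra.
Qed.

Lemma gamma_minus_fin c : 0 < c -> c < c1 gam a p KH KGN ->
  exists l : R, [/\ gamma_minus gam a p c = l%:E,
    forall u, Lambda_minus gam a p c u -> l <= energy gam a p u &
    forall e, 0 < e -> exists2 u, Lambda_minus gam a p c u & energy gam a p u < l + e].
Proof.
move=> c0 cc; have [u0 u0L] := Lambda_minus_neq0 c0 cc.
have [M hM] := energy_bounded_below c0.
have lo : (M%:E <= gamma_minus gam a p c)%E.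
  by apply: le_ereal_inf_tmp => _ [u uL <-]; rewrite lee_fin; exact: hM.
have up u : Lambda_minus gam a p c u -> (gamma_minus gam a p c <= (energy gam a p u)%:E)%E.
  by move=> uL; apply: ereal_inf_lbound; exists u.
have fn : gamma_minus gam a p c \is a fin_num.
  rewrite fin_numE; apply/andP; split.
    by rewrite -ltNye (lt_le_trans _ lo)// ltNyr.
  by rewrite -ltey (le_lt_trans (up _ u0L))// ltry.
exists (fine (gamma_minus gam a p c)); rewrite fineK//; split => //.
  by move=> u uL; rewrite -lee_fin fineK//; exact: up.
move=> e e0; have [_ [u uL <-]] := lb_ereal_inf_adherent e0 fn.
rewrite -/(gamma_minus gam a p c) => ue.
exists u => //; rewrite -lte_fin; apply: lt_le_trans ue _.
by rewrite EFinD fineK.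
Qed.

Lemma gamma_minus_subcritical c c' : p < 6 -> 0 < c -> c < c' -> c' < c1 gam a p KH KGN ->
  (gamma_minus gam a p c' < gamma_minus gam a p c)%E.
Proof.
move=> p6 c0 cc' c'c; have c'0 := lt_trans c0 cc'; have p0 := exponent_gt0; have K0 := K_gt0.
have [l [-> _ lu]] := gamma_minus_fin c0 (lt_trans cc' c'c).
have [l' [-> l'l _]] := gamma_minus_fin c'0 c'c.
have [A0 [A00 lowA]] := Lambda_minus_lower c'0.
set r := (c' / c) `^ 4^-1.
have r1 : 1 < r.
  by rewrite powR_gt1 ?invr_gt0// ltr_pdivlMr// mul1r.
have r4 : r ^+ 4 * c = c'.
  rewrite /r -powR_mulrn ?powR_ge0// -powRrM mulVf ?pnatr_eq0// powRr1 ?divr_ge0 ?ltW//.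
  by rewrite divfK// gt_eqF.
(* The drop guaranteed by the C term, uniformly on Lambda^-(c'); being independent of [u], it can
   serve as the tolerance in the choice of [u]. *)
set d := a / p * (1 - r `^ (p - 6)) * (A0 / K).
have q0 : 0 < a / p * (1 - r `^ (p - 6)).
  rewrite mulr_gt0 ?divr_gt0// subr_gt0.
  have -> : r `^ (p - 6) = (r `^ (6 - p))^-1 by rewrite -powRN opprB.
  have h : 1 < r `^ (6 - p) by rewrite powR_gt1// subr_gt0.
  by rewrite invf_lt1// (lt_trans ltr01).
have d0 : 0 < d by rewrite mulr_gt0// divr_gt0.
have [u uL ul] := lu _ d0.
have [|w] := @Lambda_minus_compare c r u c0 r1 _ uL; first by rewrite r4.
rewrite r4 => wL wu.
have [_ wC] := lowA _ wL.
have wB : 0 <= gam / 4 * (1 - r ^- 6) * vB w.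
  apply: mulr_ge0 (vB_ge0 w); apply: mulr_ge0; first by rewrite ltW// divr_gt0.
  have r6 : 1 <= r ^+ 6 by apply: exprn_ege1; exact: ltW.
  by rewrite subr_ge0 invf_le1// (lt_le_trans ltr01).
have wC' : d < a / p * (1 - r `^ (p - 6)) * vC p w by rewrite ltr_pM2l.
rewrite lte_fin; apply: le_lt_trans (l'l _ wL) _; apply: le_lt_trans wu _.
move: wB wC' ul; set x := gam / 4 * _ * _; set y := a / p * _ * vC p w.
by clearbody x y d; move: (energy _ _ _ _) => z; lra.
Qed.

End comparison.

(** * Cutoff functions *)

(** Combinations of sine and cosine are preserved by differentiation, which makes them an invariant
    family for [smooth1_coind]. *)
Lemma smooth1_trigo (R : realType) (a b : R) : smooth1 (fun x => a * sin x + b * cos x).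
Proof.
apply: (@smooth1_coind _ [set h | exists a b, h = fun x => a * sin x + b * cos x]); last first.
  by exists a, b.
move=> _ [{}a [{}b ->]].
have H x : is_derive x (1 : R) (fun x => a * sin x + b * cos x) (- b * sin x + a * cos x).
  have := is_deriveD (is_deriveZ a (is_derive_sin x)) (is_deriveZ b (is_derive_cos x)).
  by rewrite /GRing.scale /= => h; apply: is_derive_eq h _; ring.
split=> [x|]; first by have [] := H x.
by exists (- b), a; apply/funext => x; rewrite derive1E; have [_ ->] := H x.
Qed.

Lemma smooth1_sin (R : realType) : smooth1 (@sin R).
Proof.
have := @smooth1_trigo R 1 0; rewrite (_ : (fun x => _) = sin)//.
by apply/funext => x; rewrite mul1r mul0r addr0.
Qed.

Lemma smooth1_cos (R : realType) : smooth1 (@cos R).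
Proof.
have := @smooth1_trigo R 0 1; rewrite (_ : (fun x => _) = cos)//.
by apply/funext => x; rewrite mul1r mul0r add0r.
Qed.

Lemma derive1_sin (R : realType) (x : R) : derive1 sin x = cos x.
Proof. by rewrite derive1E; have [_ ->] := is_derive_sin x. Qed.

Lemma derive1_cos (R : realType) (x : R) : derive1 cos x = - sin x.
Proof. by rewrite derive1E; have [_ ->] := is_derive_cos x. Qed.

Lemma derive1_step_lt0 (R : realType) (t : R) : t < 0 -> derive1 (@step R) t = 0.
Proof.
move=> t0; rewrite derive1E.
have E : \near t, (fun _ : R => 0 : R) t = step t.
  by near=> s; rewrite step_le0// ltW//; near: s; exact: lt_nbhsl.
by have [] := near_eq_is_derive E (is_derive_cst (0 : R) t (1 : R)).
Unshelve. all: by end_near. Qed.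

Lemma derive1_step_gt1 (R : realType) (t : R) : 1 < t -> derive1 (@step R) t = 0.
Proof.
move=> t0; rewrite derive1E.
have E : \near t, (fun _ : R => 1 : R) t = step t.
  by near=> s; rewrite step_ge1// ltW//; near: s; exact: lt_nbhsr.
by have [] := near_eq_is_derive E (is_derive_cst (1 : R) t (1 : R)).
Unshelve. all: by end_near. Qed.

Lemma derive1_step_bounded (R : realType) : exists2 K : R, 0 < K & forall t : R, `|derive1 (@step R) t| <= K.
Proof.
have cs : continuous (derive1 (@step R)).
  by apply: smooth1_continuous; apply: smooth1_derive; exact: step_smooth1.
have [M [_ HM]] := compact_bounded (continuous_compact (continuous_subspaceT cs) (@segment_compact R 0 1)).
exists (`|M| + 1); first by rewrite ltr_wpDl.
move=> t; have [t0|t0] := ltP t 0; first by rewrite derive1_step_lt0// normr0 addr_ge0.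
have [t1|t1] := ltP 1 t; first by rewrite derive1_step_gt1// normr0 addr_ge0.
apply: HM; first by rewrite (le_lt_trans (ler_norm M))// ltrDl.
by exists t => //=; rewrite in_itv/= t0.
Qed.

Section cutoff.
Context (R : realType).
Implicit Types (i : 'I_3) (x y : R3 R) (u th : R3 R -> R) (r L : R).

Definition cut01 L th := [/\ smooth th, forall x, 0 <= th x <= 1 & forall i x, `|partial i th x| <= L].

Lemma cut01M L L' th th' : cut01 L th -> cut01 L' th' -> cut01 (L + L') (fun x => th x * th' x).
Proof.
move=> [s1 b1 d1] [s2 b2 d2]; split; first exact: smoothM.
  move=> x; have /andP[h1 h2] := b1 x; have /andP[h3 h4] := b2 x.
  by rewrite mulr_ge0//= -[leRHS]mulr1 ler_pM.
move=> i x; rewrite partialM//; apply: (le_trans (ler_normD _ _)); rewrite !normrM addrC.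
have /andP[h1 h2] := b1 x; have /andP[h3 h4] := b2 x.
rewrite (ger0_norm h1) (ger0_norm h3); apply: lerD.
  by rewrite -[leRHS]mul1r ler_pM.
by rewrite -[leRHS]mul1r ler_pM.
Qed.

(** The gradient has to vanish together with the value, since the cost of a cut is integrated over a
    set outside which the gradient is zero. *)
Definition flat_at th x := th x = 0 /\ forall i, partial i th x = 0.

Lemma flat_atMl th th' x : smooth th -> smooth th' -> flat_at th x -> flat_at (fun x => th x * th' x) x.
Proof.
move=> s1 s2 [t0 d0]; split; first by rewrite t0 mul0r.
by move=> i; rewrite partialM// t0 d0 mul0r mulr0 addr0.
Qed.

Lemma flat_atMr th th' x : smooth th -> smooth th' -> flat_at th' x -> flat_at (fun x => th x * th' x) x.
Proof.
move=> s1 s2 [t0 d0]; split; first by rewrite t0 mulr0.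
by move=> i; rewrite partialM// t0 d0 mul0r mulr0 addr0.
Qed.

Definition ramp i (a d : R) : R3 R -> R := fun x => step (a * crd i x + d).

Lemma ramp_smooth i (a d : R) : smooth (ramp i a d).
Proof. by apply: (smooth_comp (@step_smooth1 R)); exact: smooth_affine. Qed.

Lemma partial_ramp i j (a d : R) x :
  partial j (ramp i a d) x = derive1 (@step R) (a * crd i x + d) * (a * (i == j)%:R).
Proof.
rewrite /ramp partial_comp; [|exact: step_smooth1|exact: smooth_affine].
congr (_ * _).
rewrite partialD; [|by apply: smoothM; [exact: smooth_cst|exact: smooth_crd]|exact: smooth_cst].
rewrite partialM; [|exact: smooth_cst|exact: smooth_crd].
by rewrite !partial_cst partial_crd mulr0 !addr0.
Qed.

Lemma ramp_flat i (a d : R) x : a * crd i x + d < 0 -> flat_at (ramp i a d) x.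
Proof.
move=> h; split; first by rewrite /ramp step_le0// ltW.
by move=> j; rewrite partial_ramp derive1_step_lt0// mul0r.
Qed.

Lemma ramp_cut01 (K : R) : (forall t : R, `|derive1 (@step R) t| <= K) ->
  forall i (a d : R), cut01 (K * `|a|) (ramp i a d).
Proof.
move=> hK i a d; split; first exact: ramp_smooth.
  by move=> x; rewrite step_ge0 step_le1.
move=> j x; rewrite partial_ramp !normrM mulrA -[leRHS]mulr1.
apply: ler_pM; rewrite ?mulr_ge0 ?ler_wpM2r//.
by case: eqP => _; rewrite ?normr1// normr0.
Qed.

Lemma box_ramp_cut (K : R) : (forall t : R, `|derive1 (@step R) t| <= K) ->
  forall y r, 0 < r -> exists th, [/\ cut01 (6 * K * r^-1) th,
    forall x, cube y r x -> th x = 1 & forall x, ~ cube y (2 * r) x -> flat_at th x].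
Proof.
move=> hK y r r0.
pose i2 := Ordinal (ltnSn 2).
(* One ramp on each side: [P i] is 1 at distance up to [r] from [crd i y] and flat beyond [2 * r].
   Six ramps of slope [r^-1] in all account for the constant 6. *)
pose P i : R3 R -> R := fun x => ramp i r^-1 (2 - r^-1 * crd i y) x * ramp i (- r^-1) (2 + r^-1 * crd i y) x.
have Pc i : cut01 (2 * K * r^-1) (P i).
  have := cut01M (ramp_cut01 hK i r^-1 (2 - r^-1 * crd i y)) (ramp_cut01 hK i (- r^-1) (2 + r^-1 * crd i y)).
  rewrite normrN ger0_norm; last by rewrite invr_ge0 ltW.
  by rewrite (_ : K * r^-1 + K * r^-1 = 2 * K * r^-1)//; ring.
have Ps i : smooth (P i) by case: (Pc i).
exists (fun x => P 0 x * (P 1 x * P i2 x)); split.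
- have := cut01M (Pc 0) (cut01M (Pc 1) (Pc i2)).
  by congr (cut01 _ _); ring.
- move=> x xy.
  have P1 i : P i x = 1.
    have := le_trans (norm_crd i (x - y)) xy; rewrite crdB ler_norml => /andP[h1 h2].
    have h3 : -1 <= r^-1 * (crd i x - crd i y) by rewrite mulrC ler_pdivlMr// mulN1r.
    have h4 : r^-1 * (crd i x - crd i y) <= 1 by rewrite mulrC ler_pdivrMr// mul1r.
    rewrite /P /ramp !step_ge1 ?mulr1//; lra.
  by rewrite !P1 !mulr1.
- move=> x xy.
  have [i xi] : exists i, 2 * r < `|crd i x - crd i y|.
    apply: contrapT => /forallNP H; apply: xy; apply: crd_le => i.
    by rewrite crdB leNgt; apply/negP; exact: H.
  have PF : flat_at (P i) x.
    have [s1 _ _] := ramp_cut01 hK i r^-1 (2 - r^-1 * crd i y).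
    have [s2 _ _] := ramp_cut01 hK i (- r^-1) (2 + r^-1 * crd i y).
    move: xi; rewrite ltr_normr => /orP[h|h].
      apply: flat_atMr => //; apply: ramp_flat.
      have : 2 < r^-1 * (crd i x - crd i y) by rewrite mulrC ltr_pdivlMr.
      by lra.
    apply: flat_atMl => //; apply: ramp_flat.
    have : 2 < r^-1 * - (crd i x - crd i y) by rewrite mulrC ltr_pdivlMr.
    by lra.
  have S12 : smooth (fun x => P 1 x * P i2 x) by exact: smoothM.
  move: i PF {xi} => [[|[|[|//]]] p] PF.
  + have E : Ordinal p = 0 by exact: val_inj.
    by rewrite E in PF; exact: (flat_atMl (Ps 0) S12 PF).
  + have E : Ordinal p = 1 by exact: val_inj.
    by rewrite E in PF; exact: (flat_atMr (Ps 0) S12 (flat_atMl (Ps 1) (Ps i2) PF)).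
  + have E : Ordinal p = i2 by exact: val_inj.
    by rewrite E in PF; exact: (flat_atMr (Ps 0) S12 (flat_atMr (Ps 1) (Ps i2) PF)).
Qed.

End cutoff.

(** * Cutting a function into two pieces *)

Section integrals.
Context (R : realType).
Implicit Types (f : R3 R -> R) (S : set (M3 R)).

Lemma int3_ge0 f S : (forall x, 0 <= f x) -> 0 <= Rintegral (leb3 R) S f.
Proof. by move=> f0; apply: Rintegral_ge0 => x _. Qed.

Lemma integrable3S f S : (leb3 R).-integrable setT (EFin \o f) -> measurable S ->
  (leb3 R).-integrable S (EFin \o f).
Proof. by move=> fi mS; exact: integrableS fi. Qed.

Lemma int3_compl f S : (leb3 R).-integrable setT (EFin \o f) -> measurable S ->
  Rintegral (leb3 R) S f + Rintegral (leb3 R) (~` S) f = Rintegral (leb3 R) setT f.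
Proof.
move=> fi mS; rewrite -(setvU S) setUC Rintegral_setU//.
- exact: measurableC.
- by rewrite setUv.
- by apply/disj_setPCl.
Qed.

Lemma int3_subset f S S' : (leb3 R).-integrable setT (EFin \o f) -> measurable S -> measurable S' ->
  (forall x, 0 <= f x) -> S `<=` S' -> Rintegral (leb3 R) S f <= Rintegral (leb3 R) S' f.
Proof.
move=> fi mS mS' f0 SS; apply: fine_le.
- by apply: integrable_fin_num => //; exact: integrable3S.
- by apply: integrable_fin_num => //; exact: integrable3S.
apply: ge0_subset_integral => //.
- by apply: (measurable_funS measurableT) => //; case/integrableP: fi.
by move=> x _; rewrite lee_fin.
Qed.

Lemma int3_supp f S : (forall x, ~ S x -> f x = 0) ->
  Rintegral (leb3 R) setT f = Rintegral (leb3 R) S f.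
Proof.
move=> fS; rewrite [RHS]Rintegral_mkcond; apply: eq_Rintegral => x _.
by rewrite patchE; case: ifPn => // /negP; rewrite in_setE => /fS.
Qed.

End integrals.

Section trig_cut.
Context (R : realType).
Implicit Types (i : 'I_3) (x y : R3 R) (u th : R3 R -> R) (r L : R).

Lemma vA_grad u G : is_grad u G -> vA u = Rintegral (leb3 R) setT (fun x => \sum_(i < 3) G i x ^+ 2).
Proof. by move=> uG; rewrite /vA (Aint_grad uG). Qed.

Lemma grad_integrable u G : is_grad u G ->
  (leb3 R).-integrable setT (EFin \o (fun x => \sum_(i < 3) G i x ^+ 2)).
Proof.
move=> uG.
have L2i i := Lfun2_integrable_sqr (uG.2 i).1.
have : (leb3 R).-integrable setT (fun x => \sum_(i < 3) (G i x ^+ 2)%:E)%E.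
  by apply: integrable_sum => // i _; exact: L2i.
by congr (integrable _ _ _); apply/funext => x; rewrite sumEFin.
Qed.

Lemma sqr_integrable u : H1 u -> (leb3 R).-integrable setT (EFin \o (fun x => u x ^+ 2)).
Proof. by move=> uH; exact: Lfun2_integrable_sqr (H1_L2 uH). Qed.

Lemma sqrB_cut (c s d g u : R) : c ^+ 2 + s ^+ 2 = 1 ->
  (c * g + s * d * u) ^+ 2 + (s * g + - c * d * u) ^+ 2 = g ^+ 2 + d ^+ 2 * u ^+ 2.
Proof.
move=> h.
transitivity ((c ^+ 2 + s ^+ 2) * (g ^+ 2 + d ^+ 2 * u ^+ 2)); first by ring.
by rewrite h mul1r.
Qed.

(** Multiplying by the sine and the cosine of one smooth angle makes the cross terms between the two
    gradients cancel ([sqrB_cut]). What remains is u^2 times the squared gradient of the angle; the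
    factor 3 counts its components. *)
Lemma trig_cut L th (S : set (M3 R)) : cut01 L th -> measurable S ->
  (forall x, ~ S x -> forall i, partial i th x = 0) ->
  forall u, H1 u -> let T x := pi / 2 * th x in
  [/\ H1 (fun x => sin (T x) * u x), H1 (fun x => cos (T x) * u x) &
    vA (fun x => sin (T x) * u x) + vA (fun x => cos (T x) * u x) <=
    vA u + 3 * (pi / 2 * L) ^+ 2 * Rintegral (leb3 R) S (fun x => u x ^+ 2)].
Proof.
move=> [ths th01 thL] mS thS u uH T.
have pi0 : 0 < pi / 2 :> R by rewrite divr_gt0// pi_gt0.
have L0 : 0 <= L by apply: le_trans (thL 0 0).
have Ts : smooth T by exact: (smoothM (smooth_cst _) ths).
have dT i x : partial i T x = pi / 2 * partial i th x.
  by rewrite (partialM _ _ (smooth_cst _) ths) partial_cst mulr0 addr0.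
have dTL i x : `|partial i T x| <= pi / 2 * L.
  by rewrite dT normrM (gtr0_norm pi0) ler_pM2l.
have cs : smooth (fun x => sin (T x)) by apply: (smooth_comp (@smooth1_sin R)).
have ss : smooth (fun x => cos (T x)) by apply: (smooth_comp (@smooth1_cos R)).
have dc i x : partial i (fun x => sin (T x)) x = cos (T x) * partial i T x.
  by rewrite partial_comp// ?derive1_sin//; exact: smooth1_sin.
have ds i x : partial i (fun x => cos (T x)) x = - sin (T x) * partial i T x.
  by rewrite partial_comp// ?derive1_cos//; exact: smooth1_cos.
have cle x : `|sin (T x)| <= 1 by rewrite ler_norml sin_geN1 sin_le1.
have sle x : `|cos (T x)| <= 1 by rewrite ler_norml cos_geN1 cos_le1.
have K1 : 1 <= 1 + pi / 2 * L by rewrite lerDl mulr_ge0// ltW.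
have uG := H1_is_grad uH; set G := fun i => weak_partial i u.
have L1 : pi / 2 * L <= 1 + pi / 2 * L by rewrite lerDr.
have cG : is_grad (fun x => sin (T x) * u x)
    (fun i x => sin (T x) * G i x + cos (T x) * partial i T x * u x).
  have -> : (fun i x => sin (T x) * G i x + cos (T x) * partial i T x * u x) =
      (fun i x => sin (T x) * G i x + partial i (fun x => sin (T x)) x * u x).
    by apply/funext => i; apply/funext => x; rewrite dc.
  apply: (is_grad_mul uG cs (K := 1 + pi / 2 * L)) => [x|i x].
    exact: le_trans (cle x) K1.
  rewrite dc normrM -[leRHS]mul1r ler_pM//.
  exact: le_trans (dTL i x) L1.
have sG : is_grad (fun x => cos (T x) * u x)
    (fun i x => cos (T x) * G i x + - sin (T x) * partial i T x * u x).
  have -> : (fun i x => cos (T x) * G i x + - sin (T x) * partial i T x * u x) =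
      (fun i x => cos (T x) * G i x + partial i (fun x => cos (T x)) x * u x).
    by apply/funext => i; apply/funext => x; rewrite ds.
  apply: (is_grad_mul uG ss (K := 1 + pi / 2 * L)) => [x|i x].
    exact: le_trans (sle x) K1.
  rewrite ds normrM normrN -[leRHS]mul1r ler_pM//.
  exact: le_trans (dTL i x) L1.
split; [exact: is_grad_H1 cG|exact: is_grad_H1 sG|].
rewrite (vA_grad cG) (vA_grad sG) (vA_grad uG) -(RintegralD measurableT (grad_integrable cG) (grad_integrable sG)).
have iS := integrable3S (sqr_integrable uH) mS.
have iS2 : (leb3 R).-integrable setT (EFin \o ((fun x => u x ^+ 2) \_ S)).
  by rewrite -restrict_EFin; apply/(integrable_mkcond _ mS).
rewrite (Rintegral_mkcond _ S) -(RintegralZl _ measurableT iS2).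
have iS3 : (leb3 R).-integrable setT (EFin \o (fun x => 3 * (pi / 2 * L) ^+ 2 * ((fun x => u x ^+ 2) \_ S) x)).
  have := integrableZl (measurableT) (3 * (pi / 2 * L) ^+ 2) iS2.
  by congr (integrable _ _ _).
rewrite -(RintegralD measurableT (grad_integrable uG) iS3).
apply: le_Rintegral => //.
- by have := integrableD measurableT (grad_integrable cG) (grad_integrable sG); congr (integrable _ _ _).
- by have := integrableD measurableT (grad_integrable uG) iS3; congr (integrable _ _ _).
move=> x _; rewrite -big_split/=.
have sc1 : sin (T x) ^+ 2 + cos (T x) ^+ 2 = 1 by rewrite addrC cos2Dsin2.
under eq_bigr do rewrite (sqrB_cut _ _ _ sc1).
rewrite big_split/= lerD2l.
rewrite patchE; case: ifPn => [_|/negP]; last first.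
  rewrite in_setE => nS; rewrite mulr0 big1// => i _.
  by rewrite dT thS// mulr0 expr0n mul0r.
rewrite -mulr_suml ler_wpM2r ?sqr_ge0//.
apply: (@le_trans _ _ (\sum_(i < 3) (pi / 2 * L) ^+ 2)).
  apply: ler_sum => i _; rewrite -[leLHS]real_normK ?num_real// lerXn2r ?nnegrE//.
  by rewrite mulr_ge0// ltW.
by rewrite sumr_const card_ord mulr_natl.
Qed.

Lemma box_cut : exists2 K : R, 0 < K & forall y r, 0 < r -> exists c s : R3 R -> R,
  [/\ forall x, c x ^+ 2 + s x ^+ 2 = 1, forall x, cube y r x -> s x = 0,
      forall x, ~ cube y (2 * r) x -> c x = 0 &
      forall u, H1 u -> [/\ H1 (fun x => c x * u x), H1 (fun x => s x * u x) &
        vA (fun x => c x * u x) + vA (fun x => s x * u x) <=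
        vA u + K * (r ^- 2 * Rintegral (leb3 R) (cube y (2 * r)) (fun x => u x ^+ 2))]].
Proof.
have [K0 K00 hK] := derive1_step_bounded R.
have pi0 : 0 < pi / 2 :> R by rewrite divr_gt0// pi_gt0.
exists (3 * (pi / 2 * (6 * K0)) ^+ 2).
  by rewrite mulr_gt0// exprn_gt0// mulr_gt0// mulr_gt0.
move=> y r r0; have [th [thc th1 th0]] := box_ramp_cut hK y r0.
(* The angle is pi / 2 on the inner cube, so the kept piece is the sine; for slabs the angle is 0 on
   the kept side and the roles are exchanged. *)
exists (fun x => sin (pi / 2 * th x)), (fun x => cos (pi / 2 * th x)); split.
- by move=> x; rewrite addrC cos2Dsin2.
- by move=> x /th1 ->; rewrite mulr1 cos_pihalf.
- by move=> x /th0[-> _]; rewrite mulr0 sin0.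
move=> u uH.
have [|a b c] := trig_cut thc (measurable_cube y (2 * r)) _ uH; first by move=> x /th0[].
split; [exact: a|exact: b|apply: (le_trans c)].
have -> : 3 * (pi / 2 * (6 * K0 * r^-1)) ^+ 2 = 3 * (pi / 2 * (6 * K0)) ^+ 2 * r ^- 2.
  by move: (pi / 2) => q; rewrite -exprVn; ring.
by rewrite -mulrA.
Qed.

(** The mass of the transition layer is simply bounded by the total mass, which is harmless for a
    function already cut off to a cube. *)
Lemma slab_cut : exists2 K : R, 0 < K & forall i (t l : R), 0 < l -> exists c s : R3 R -> R,
  [/\ forall x, c x ^+ 2 + s x ^+ 2 = 1, forall x, crd i x <= t -> s x = 0,
      forall x, t + l <= crd i x -> c x = 0 &
      forall u, H1 u -> [/\ H1 (fun x => c x * u x), H1 (fun x => s x * u x) &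
        vA (fun x => c x * u x) + vA (fun x => s x * u x) <=
        vA u + K * (l ^- 2 * Rintegral (leb3 R) setT (fun x => u x ^+ 2))]].
Proof.
have [K0 K00 hK] := derive1_step_bounded R.
have pi0 : 0 < pi / 2 :> R by rewrite divr_gt0// pi_gt0.
exists (3 * (pi / 2 * K0) ^+ 2).
  by rewrite mulr_gt0// exprn_gt0// mulr_gt0// mulr_gt0.
move=> i t l l0; set th : R3 R -> R := ramp i l^-1 (- (l^-1 * t)).
have thE x : th x = step (l^-1 * (crd i x - t)) by rewrite /th /ramp mulrBr.
have thc : cut01 (K0 * `|l^-1|) th by exact: ramp_cut01.
clearbody th.
exists (fun x => cos (pi / 2 * th x)), (fun x => sin (pi / 2 * th x)); split.
- by move=> x; rewrite cos2Dsin2.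
- move=> x h; rewrite thE step_le0 ?mulr0 ?sin0//.
  by rewrite mulr_ge0_le0// ?subr_le0// invr_ge0 ltW.
- move=> x h; rewrite thE step_ge1 ?mulr1 ?cos_pihalf//.
  by rewrite mulrC ler_pdivlMr// mul1r lerBrDl.
move=> u uH.
have [|a b c] := trig_cut thc (@measurableT _ (M3 R)) _ uH; first by move=> x /(_ I).
split; [exact: b|exact: a|rewrite [leLHS]addrC; apply: (le_trans c)].
have -> : 3 * (pi / 2 * (K0 * `|l^-1|)) ^+ 2 = 3 * (pi / 2 * K0) ^+ 2 * l ^- 2.
  rewrite ger0_norm; last by rewrite invr_ge0 ltW.
  by move: (pi / 2) => q; rewrite -exprVn; ring.
by rewrite -mulrA.
Qed.

End trig_cut.

(** * The critical exponent *)

Section sextic.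
Context (R : realType).
Implicit Types (x y : R3 R) (u v w c s : R3 R -> R) (S : set (M3 R)).

Definition V6 S u : R := Rintegral (leb3 R) S (fun x => u x ^+ 6).

Lemma Cint6E u : Cint 6 u = (\int[leb3 R]_x (u x ^+ 6)%:E)%E.
Proof.
apply: eq_integral => x _; congr EFin.
by rewrite -[6]/(6%:R) powR_mulrn// -normrX ger0_norm// (exprM _ 2 3) exprn_ge0// sqr_ge0.
Qed.

Lemma vC6E u : vC 6 u = V6 setT u. Proof. by rewrite /vC Cint6E. Qed.

Lemma sextic_ge0 u x : 0 <= u x ^+ 6.
Proof. by rewrite (exprM _ 2 3) exprn_ge0// sqr_ge0. Qed.

Lemma V6_ge0 S u : 0 <= V6 S u.
Proof. by apply: int3_ge0 => x; exact: sextic_ge0. Qed.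

(** Young's inequality with exponents 3 and 3/2: with X = l w^2 and Y = v^2 the difference is (X -
    Y)^2 (X + 2 Y). The parameter [l] is chosen after integration, in place of Hoelder's
    inequality. *)
Lemma sextic_young (l v w : R) : 0 <= l -> 3 * l * (w ^+ 2 * v ^+ 4) <= l ^+ 3 * w ^+ 6 + 2 * v ^+ 6.
Proof.
move=> l0; set X := l * w ^+ 2; set Y := v ^+ 2.
have X0 : 0 <= X by rewrite mulr_ge0// sqr_ge0.
have Y0 : 0 <= Y by rewrite sqr_ge0.
rewrite -subr_ge0 (_ : _ - _ = (X - Y) ^+ 2 * (X + 2 * Y)); last by rewrite /X /Y; ring.
by rewrite mulr_ge0 ?sqr_ge0// addr_ge0// mulr_ge0.
Qed.

(** Bernoulli's inequality (1 - q)^3 >= 1 - 3 q for q = s^2. *)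
Lemma sextic_cut (c s v : R) : c ^+ 2 + s ^+ 2 = 1 ->
  v ^+ 6 <= (c * v) ^+ 6 + 3 * ((s * v) ^+ 2 * v ^+ 4).
Proof.
move=> cs; have cE : c ^+ 2 = 1 - s ^+ 2 by rewrite -cs addrK.
have s1 : s ^+ 2 <= 1 by rewrite -cs lerDr sqr_ge0.
rewrite -subr_ge0.
have -> : (c * v) ^+ 6 + 3 * ((s * v) ^+ 2 * v ^+ 4) - v ^+ 6 =
   v ^+ 6 * ((c ^+ 2) ^+ 3 + 3 * s ^+ 2 - 1) by ring.
rewrite cE; set q := s ^+ 2 in s1 *; have q0 : 0 <= q by rewrite sqr_ge0.
have -> : (1 - q) ^+ 3 + 3 * q - 1 = q ^+ 2 * (3 - q) by ring.
have q3 : 0 <= 3 - q by lra.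
exact: mulr_ge0 (sextic_ge0 (fun=> v) 0) (mulr_ge0 (sqr_ge0 q) q3).
Qed.

Context (Q : R).
Hypotheses (Q0 : 0 < Q).
Hypothesis SOB : forall u, H1 u -> (Cint 6 u <= (Q * vA u ^+ 3)%:E)%E.

Lemma measurable_sextic u : H1 u -> measurable_fun [set: M3 R] (EFin \o (fun x => u x ^+ 6)).
Proof. by move=> uH; apply/measurable_EFinP; apply: measurable_funX; exact: H1_measurable. Qed.

Lemma sextic_integrable u : H1 u -> (leb3 R).-integrable setT (EFin \o (fun x => u x ^+ 6)).
Proof.
move=> uH; apply/integrableP; split; first exact: measurable_sextic.
apply: le_lt_trans (le_lt_trans (SOB uH) (ltry _)).
rewrite Cint6E le_eqVlt; apply/orP; left; apply/eqP; apply: eq_integral => x _.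
by rewrite gee0_abs// lee_fin sextic_ge0.
Qed.

Lemma V6_le u : H1 u -> V6 setT u <= Q * vA u ^+ 3.
Proof.
move=> uH; have := SOB uH; rewrite Cint6E -lee_fin /V6 /Rintegral fineK//.
by apply: integrable_fin_num => //; exact: sextic_integrable.
Qed.

Lemma mixed_integrable v w : H1 v -> H1 w ->
  (leb3 R).-integrable setT (EFin \o (fun x => w x ^+ 2 * v x ^+ 4)).
Proof.
move=> vH wH.
have ig : (leb3 R).-integrable setT (EFin \o (fun x => w x ^+ 6 + 2 * v x ^+ 6)).
  have := integrableD measurableT (sextic_integrable wH) (integrableZl measurableT 2 (sextic_integrable vH)).
  by congr (integrable _ _ _).
apply: le_integrable ig => //.
- apply/measurable_EFinP; apply: measurable_funM; apply: measurable_funX; exact: H1_measurable.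
- move=> x _; rewrite lee_fin; have := sextic_young (v x) (w x) ler01.
  rewrite expr1n mul1r mulr1 => h.
  have h1 : 0 <= w x ^+ 2 * v x ^+ 4 by rewrite mulr_ge0 ?sqr_ge0// (exprM _ 2 2) sqr_ge0.
  have h2 := sextic_ge0 v x; have h3 := sextic_ge0 w x.
  rewrite !ger0_norm//; last by rewrite addr_ge0// mulr_ge0.
  by move: h1 h2 h3 h; move: (v x ^+ 6) (w x ^+ 6) (w x ^+ 2 * _) => X Y Z; lra.
Qed.

(** Young's inequality with weight mu / A(w), followed by the Sobolev inequality for [w]. The factor
    [vA w] is essential: it makes the effect of a discarded piece linear in its own energy. *)
Lemma mixed_le v w S (mu : R) : H1 v -> H1 w -> measurable S ->
  (forall x, ~ S x -> w x = 0) -> 0 < mu ->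
  Rintegral (leb3 R) setT (fun x => w x ^+ 2 * v x ^+ 4) <=
  vA w * (mu ^+ 2 * Q / 3 + 2 / (3 * mu) * V6 S v).
Proof.
move=> vH wH mS wS mu0; set M := (X in _ * X); set X := (X in X <= _).
have M0 : 0 <= M.
  rewrite /M addr_ge0//; first by rewrite divr_ge0// mulr_ge0 ?sqr_ge0// ltW.
  by rewrite mulr_ge0 ?V6_ge0// divr_ge0// mulr_ge0// ltW.
have A0 := vA_ge0 w.
(* The weight would be undefined for [vA w = 0], so [vA w] is replaced by any positive number above
   it and the limit is taken at the end. *)
have step1 al : 0 < al -> vA w <= al -> X <= al * M.
  move=> al0 Aal; set l := mu / al; have l0 : 0 < l by rewrite divr_gt0.
  have iV : (leb3 R).-integrable setT (EFin \o ((fun x => v x ^+ 6) \_ S)).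
    by rewrite -restrict_EFin; apply/(integrable_mkcond _ mS); apply: integrable3S => //; exact: sextic_integrable.
  have iR : (leb3 R).-integrable setT (EFin \o (fun x => l ^+ 3 * w x ^+ 6 + 2 * ((fun x => v x ^+ 6) \_ S) x)).
    have := integrableD measurableT (integrableZl measurableT (l ^+ 3) (sextic_integrable wH)) (integrableZl measurableT 2 iV).
    by congr (integrable _ _ _).
  have h : 3 * l * X <= l ^+ 3 * V6 setT w + 2 * V6 S v.
    rewrite -(RintegralZl _ measurableT (mixed_integrable vH wH)).
    rewrite /V6 (Rintegral_mkcond _ S) -(RintegralZl _ measurableT (sextic_integrable wH)).
    rewrite -(RintegralZl _ measurableT iV) -RintegralD//; last 2 first.
    - by have := integrableZl measurableT (l ^+ 3) (sextic_integrable wH); congr (integrable _ _ _).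
    - by have := integrableZl measurableT 2 iV; congr (integrable _ _ _).
    apply: le_Rintegral => //.
      by have := integrableZl measurableT (3 * l) (mixed_integrable vH wH); congr (integrable _ _ _).
    move=> x _; rewrite patchE; case: ifPn => [_|/negP]; first by apply: sextic_young; exact: ltW.
    by rewrite in_setE => /wS ->; rewrite !expr0n/= !(mul0r, mulr0) addr0.
  have h2 : V6 setT w <= Q * al ^+ 3.
    by apply: (le_trans (V6_le wH)); rewrite ler_pM2l// lerXn2r ?nnegrE// ltW.
  have h3 : 3 * l * X <= l ^+ 3 * (Q * al ^+ 3) + 2 * V6 S v.
    by apply: (le_trans h); rewrite lerD2r ler_pM2l// exprn_gt0.
  have l3 : 0 < 3 * l by rewrite mulr_gt0.
  rewrite -(ler_pM2l l3); apply: (le_trans h3).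
  rewrite le_eqVlt; apply/orP; left; apply/eqP; rewrite /M /l.
  by move: (V6 S v) => E; field; rewrite !gt_eqF.
apply/ler_addgt0Pr => e e0.
have M1 : 0 < M + 1 by rewrite ltr_wpDl.
have t0 : 0 < e / (M + 1) by rewrite divr_gt0.
apply: (le_trans (step1 (vA w + e / (M + 1)) _ _)); [by rewrite ltr_wpDl|by rewrite lerDl ltW|].
rewrite mulrDl lerD2l -mulrA ler_piMr ?(ltW e0)// mulrC ler_pdivrMr// mul1r lerDl ler01.
by [].
Qed.

(** A^3 - 1 is A - 1 times A^2 + A + 1, a factor between 1 and 7 for A in [0, 2]. The upper bound 7
    is used when A >= 1 and the lower bound 1 otherwise. *)
Lemma cube_gap (A W al : R) : 0 <= A -> A <= 1 + W - al -> 0 <= W <= 1 -> 0 <= al ->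
  A ^+ 3 - 1 <= 7 * W - al.
Proof.
move=> A0 AW /andP[W0 W1] al0.
have A2 : A <= 2 by lra.
have -> : A ^+ 3 - 1 = (A - 1) * (A ^+ 2 + A + 1) by ring.
have [A1|A1] := leP 1 A.
  have B7 : A ^+ 2 + A + 1 <= 7 by have : (A + 2) * (2 - A) >= 0 by [rewrite mulr_ge0//; lra]; lra.
  apply: (@le_trans _ _ ((A - 1) * 7)); first by rewrite ler_wpM2l// subr_ge0.
  by lra.
have B1 : 1 <= A ^+ 2 + A + 1 by have := sqr_ge0 A; lra.
apply: (@le_trans _ _ ((A - 1) * 1)); last by lra.
by rewrite ler_nM2l ?subr_lt0.
Qed.

(* A near-maximizer of [V6 / vA ^ 3] loses little when it is cut: the energy
   [al] of the discarded part lowers [Q * vA ^ 3] by at least [Q * al], while by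
   Young's inequality its effect on [V6] is at most [Q * al / 2]. *)
Lemma cut_deficit u c s S (ep W : R) : H1 u -> vA u = 1 -> Q - ep <= V6 setT u ->
  (forall x, c x ^+ 2 + s x ^+ 2 = 1) -> measurable S -> (forall x, ~ S x -> s x = 0) ->
  V6 S u <= Q / 16 -> H1 (fun x => c x * u x) -> H1 (fun x => s x * u x) ->
  0 <= W <= 1 -> vA (fun x => c x * u x) + vA (fun x => s x * u x) <= vA u + W ->
  Q * vA (fun x => c x * u x) ^+ 3 - V6 setT (fun x => c x * u x) <=
    ep + 7 * Q * W - Q / 2 * vA (fun x => s x * u x) /\
  Q - ep - Q / 2 * vA (fun x => s x * u x) <= V6 setT (fun x => c x * u x).
Proof.
move=> uH u1 uQ cs mS sS VS cH sH W01 AW; rewrite u1 in AW.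
set al := vA (fun x => s x * u x) in AW *; set A := vA (fun x => c x * u x) in AW *.
have al0 : 0 <= al by exact: vA_ge0. have A0 : 0 <= A by exact: vA_ge0.
have AW' : A <= 1 + W - al by lra.
have gap := cube_gap A0 AW' W01 al0.
have w0 x : ~ S x -> s x * u x = 0 by move=> /sS ->; rewrite mul0r.
(* With mu = 1/2 and the tail at most Q / 16, the two terms of [mixed_le] are at most Q / 12 each.
   Their sum, multiplied by the 3 of [sextic_cut], is Q / 2, half of the gain in Q A^3. *)
have half : 0 < 2^-1 :> R by rewrite invr_gt0.
have mix := mixed_le uH sH mS w0 half.
have mix' : 3 * Rintegral (leb3 R) setT (fun x => (s x * u x) ^+ 2 * u x ^+ 4) <= Q / 2 * al.
  rewrite -/al in mix; set I := Rintegral _ _ _ in mix *; set E := V6 S u in mix VS.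
  clear AW AW' gap; clearbody al A I E.
  have : al * (2^-1 ^+ 2 * Q / 3 + 2 / (3 * 2^-1) * E) <= al * (Q / 6).
    apply: ler_wpM2l => //.
    have -> : 2 / (3 * 2^-1) = 4 / 3 :> R by field.
    have -> : 2^-1 ^+ 2 * Q / 3 = Q / 12 by field.
    by lra.
  by lra.
have iC := sextic_integrable cH.
have iM : (leb3 R).-integrable setT (EFin \o (fun x => 3 * ((s x * u x) ^+ 2 * u x ^+ 4))).
  by have := integrableZl measurableT 3 (mixed_integrable uH sH); congr (integrable _ _ _).
have tot : V6 setT u <= V6 setT (fun x => c x * u x) +
    3 * Rintegral (leb3 R) setT (fun x => (s x * u x) ^+ 2 * u x ^+ 4).
  rewrite /V6 -(RintegralZl _ measurableT (mixed_integrable uH sH)) -(RintegralD measurableT iC iM).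
  apply: le_Rintegral => //; first exact: sextic_integrable.
    by have := integrableD measurableT iC iM; congr (integrable _ _ _).
  by move=> x _; exact: sextic_cut.
have QA : Q * A ^+ 3 - Q <= Q * (7 * W - al).
  by rewrite -[X in _ - X]mulr1 -mulrBr ler_pM2l.
move: tot mix' uQ QA; set T := V6 _ _; set T' := V6 _ _; set I := Rintegral _ _ _.
by clear mix iC iM AW AW' gap; clearbody T T' I al A => tot mix' uQ QA; split; lra.
Qed.

End sextic.

(** * Localization between coordinate planes *)

Section cubes.
Context (R : realType).
Implicit Types (x y : R3 R) (r t : R) (i : 'I_3).

Lemma measurable_crd i : measurable_fun [set: M3 R] (crd i : M3 R -> R).
Proof. by apply: continuous_measurable3; exact: crd_continuous. Qed.

Lemma measurable_crd_gt i t : measurable ([set x | t < crd i x] : set (M3 R)).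
Proof.
have := @measurable_crd i measurableT _ (measurable_itv (`]t, +oo[ : interval R)).
by rewrite setTI; congr measurable; apply/seteqP; split => x /=; rewrite in_itv/= andbT.
Qed.

Lemma measurable_crd_lt i t : measurable ([set x | crd i x < t] : set (M3 R)).
Proof.
have := @measurable_crd i measurableT _ (measurable_itv (`]-oo, t[ : interval R)).
by rewrite setTI; congr measurable; apply/seteqP; split => x /=; rewrite in_itv.
Qed.

Lemma cube_subset y y' r r' : `|y' - y| + r' <= r -> cube y' r' `<=` cube y r.
Proof.
move=> h x; rewrite /cube /= => xy'; apply: le_trans h.
rewrite -(subrKA y') addrC.
by apply: (le_trans (ler_normD _ _)); rewrite lerD2l.
Qed.

Definition pt (f : 'I_3 -> R) : R3 R := (f 0, f 1, f (Ordinal (ltnSn 2))).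

Lemma crd_pt f i : crd i (pt f) = f i.
Proof. by case: i => [[|[|[|//]]] p]; rewrite /crd/=; congr f; exact: val_inj. Qed.

End cubes.

(* The values of [eta] and [del] only have to satisfy
   [(1 + 2 * eta) * (1 + 2 * (1 - del) * (1 - 9 * eta)) < 3 * (1 - 9 * eta)] and
   [15 / 16 <= (1 - 6 * del) * (1 - 9 * eta)]. *)
Section descent.
Context (R : realType) (Q eta del : R).
Implicit Types (x y : R3 R) (u v w c s : R3 R -> R) (S : set (M3 R)) (i : 'I_3) (r t l : R).
Hypotheses (Q0 : 0 < Q) (etaE : eta = 1 / 2000) (delE : del = 1 / 120).
Hypothesis SOB : forall u, H1 u -> (Cint 6 u <= (Q * vA u ^+ 3)%:E)%E.

Lemma V6_compl u S : H1 u -> measurable S -> V6 S u + V6 (~` S) u = V6 setT u.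
Proof. by move=> uH mS; apply: int3_compl => //; exact: sextic_integrable SOB _ uH. Qed.

Lemma V6_subset u S S' : H1 u -> measurable S -> measurable S' -> S `<=` S' -> V6 S u <= V6 S' u.
Proof.
move=> uH mS mS' SS; apply: int3_subset => //; first exact: sextic_integrable SOB _ uH.
by move=> x; exact: sextic_ge0.
Qed.

Lemma V6_inter u S S' : H1 u -> measurable S -> measurable S' ->
  V6 S u + V6 S' u - V6 setT u <= V6 (S `&` S') u.
Proof.
move=> uH mS mS'; have iu := sextic_integrable SOB uH.
have h : V6 S u = V6 (S `&` S') u + V6 (S `\` S') u.
  rewrite /V6 -Rintegral_setU.
  - by rewrite setUIDK.
  - exact: measurableI.
  - exact: measurableD.
  - by rewrite setUIDK; exact: integrable3S.
  - by apply/disj_setPS => x [[_ ?] [_ ?]].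
have h2 : V6 (S `\` S') u <= V6 (~` S') u.
  by apply: V6_subset uH (measurableD mS mS') (measurableC mS') _ => x [].
by have := V6_compl uH mS'; lra.
Qed.

Lemma V6_mono u v S : H1 u -> H1 v -> measurable S ->
  (forall x, v x ^+ 2 <= u x ^+ 2) -> V6 S v <= V6 S u.
Proof.
move=> uH vH mS vu; apply: le_Rintegral => //.
- by apply: integrable3S => //; exact: sextic_integrable SOB _ vH.
- by apply: integrable3S => //; exact: sextic_integrable SOB _ uH.
by move=> x _; rewrite !(exprM _ 2 3) lerXn2r ?nnegrE ?sqr_ge0.
Qed.

(** Up to terms in [eta] the sum [a1 + a2] is at most 1 and [C] is at least [Q], so the right-hand
    side is at most about C (1 - 2/3 del). Since [eta] is much smaller than [del], this is below
    [C]. *)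
Lemma half_gap (C D1 D2 a1 a2 : R) : 0 <= a1 -> 0 <= a2 -> a1 + a2 <= 1 + 2 * eta ->
  Q * (1 - 9 * eta) <= C -> D1 <= (1 - del) * C -> D2 <= (1 - del) * C ->
  C <= a1 * (Q / 3 + 2 / 3 * D1) + a2 * (Q / 3 + 2 / 3 * D2) -> False.
Proof.
move=> a10 a20 a12 QC D1C D2C; have q9 : 0 < 1 - 9 * eta by rewrite etaE; lra.
have C0 : 0 < C by apply: lt_le_trans QC; exact: mulr_gt0.
set M := Q / 3 + 2 / 3 * ((1 - del) * C).
have M0 : 0 <= M by rewrite /M delE; move: Q0 C0; lra.
have h1 : a1 * (Q / 3 + 2 / 3 * D1) <= a1 * M by apply: ler_wpM2l => //; rewrite /M; move: D1C; lra.
have h2 : a2 * (Q / 3 + 2 / 3 * D2) <= a2 * M by apply: ler_wpM2l => //; rewrite /M; move: D2C; lra.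
have h3 : (a1 + a2) * M <= (1 + 2 * eta) * M by apply: ler_wpM2r.
move=> h; have : C <= (1 + 2 * eta) * M by lra.
by move: QC; rewrite /M etaE delE; move: Q0 C0; lra.
Qed.

(* Otherwise both pieces of the cut are subcritical, and summing [mixed_le] over
   them bounds [V6 setT v] strictly below itself. *)
Lemma slab_half : exists2 K : R, 0 < K & forall v i t l, H1 v -> 0 < l ->
  vA v <= 1 + eta -> Q * (1 - 9 * eta) <= V6 setT v ->
  K * (l ^- 2 * Rintegral (leb3 R) setT (fun x => v x ^+ 2)) <= eta ->
  (1 - del) * V6 setT v <= V6 [set x | crd i x < t + l] v \/
  (1 - del) * V6 setT v <= V6 [set x | t < crd i x] v.
Proof.
have [K K0 HK] := slab_cut R; exists K => // v i t l vH l0 vA1 vQ vK.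
have [c [s [cs s0 c0 /(_ v vH)[cH sH A12]]]] := HK i t l l0.
have [h1|h1] := leP ((1 - del) * V6 setT v) (V6 [set x | crd i x < t + l] v); first by left.
have [h2|h2] := leP ((1 - del) * V6 setT v) (V6 [set x | t < crd i x] v); first by right.
exfalso.
have c0' x : ~ [set x | crd i x < t + l] x -> c x * v x = 0.
  by move=> /= /negP; rewrite -leNgt => /c0 ->; rewrite mul0r.
have s0' x : ~ [set x | t < crd i x] x -> s x * v x = 0.
  by move=> /= /negP; rewrite -leNgt => /s0 ->; rewrite mul0r.
have m1 := mixed_le Q0 SOB vH cH (measurable_crd_lt i (t + l)) c0' ltr01.
have m2 := mixed_le Q0 SOB vH sH (measurable_crd_gt i t) s0' ltr01.
have E : V6 setT v = Rintegral (leb3 R) setT (fun x => (c x * v x) ^+ 2 * v x ^+ 4) +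
     Rintegral (leb3 R) setT (fun x => (s x * v x) ^+ 2 * v x ^+ 4).
  rewrite -(RintegralD measurableT (mixed_integrable SOB vH cH) (mixed_integrable SOB vH sH)).
  apply: eq_Rintegral => x _; rewrite !exprMn -mulrDl -mulrDl cs mul1r.
  by rewrite -exprD.
have a1 := vA_ge0 (fun x => c x * v x); have a2 := vA_ge0 (fun x => s x * v x).
move: m1 m2; rewrite !expr1n !mul1r !mulr1 => m1 m2.
have a12 := le_trans A12 (lerD vA1 vK).
apply: (half_gap a1 a2 _ vQ (ltW h1) (ltW h2)).
  by apply: (le_trans a12); rewrite -addrA mulr_natl mulr2n.
by rewrite {1}E; apply: lerD.
Qed.

Lemma slab_localize : exists2 K : R, 0 < K & forall v i y r, H1 v -> 0 < r ->
  vA v <= 1 + eta -> Q * (1 - 9 * eta) <= V6 setT v ->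
  (forall x, ~ cube y (2 * r) x -> v x = 0) ->
  K * (r ^- 2 * Rintegral (leb3 R) setT (fun x => v x ^+ 2)) <= eta ->
  exists2 t, `|t - crd i y| <= 2 * r &
    (1 - 2 * del) * V6 setT v <= V6 ([set x | t - r / 4 < crd i x] `&` [set x | crd i x < t + r / 4]) v.
Proof.
have [K K0 HK] := slab_half; exists (16 * K); first by rewrite mulr_gt0.
move=> v i y r vH r0 vA1 vQ vS vK.
set l := r / 4; have l0 : 0 < l by rewrite divr_gt0.
have rl : r = 4 * l by rewrite /l; field.
have {}vK : K * (l ^- 2 * Rintegral (leb3 R) setT (fun x => v x ^+ 2)) <= eta.
  apply: le_trans vK; rewrite le_eqVlt; apply/orP; left; apply/eqP.
  by move: (Rintegral _ _ _) => I; rewrite rl; field; rewrite gt_eqF.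
have HS t := HK v i t l vH l0 vA1 vQ vK.
set C := V6 setT v in vQ HS *.
have q9 : 0 < 1 - 9 * eta by rewrite etaE; lra.
have C0 : 0 < C by apply: lt_le_trans vQ; exact: mulr_gt0.
have d1 : 0 < 1 - del by rewrite delE; lra.
(* Levels at distance [l] sweeping the support, which lies within [8 * l] of the centre: everything
   is beyond level 0 and nothing beyond level 17. At the least [k] with too little beyond it,
   [slab_half] places nearly everything before level k + 1, while nearly everything is beyond level
   k - 1. The offset 9, not 8, puts the face of the closed support strictly beyond level 0. *)
pose tt (k : nat) := crd i y + (k%:R - 9) * l.
pose P k := V6 [set x | tt k < crd i x] v < (1 - del) * C.
have P17 : P 17%N.
  rewrite /P (_ : V6 _ v = 0); first exact: mulr_gt0.
  rewrite /V6; under eq_Rintegral => x.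
    rewrite inE /= /tt => h; rewrite vS; last first.
      move=> xy; have := le_trans (norm_crd i (x - y)) xy; rewrite crdB ler_norml => /andP[_].
      by move: h; rewrite rl; lra.
    rewrite expr0n/=; over.
  by rewrite /Rintegral integral0.
have exP : exists k, P k by exists 17%N.
have [k Pk mk] := ex_minnP exP.
have k17 : (k <= 17)%N by exact: mk.
have k1 : (0 < k)%N.
  rewrite lt0n; apply/negP => /eqP k0; move: Pk; rewrite k0 /P.
  have -> : V6 [set x | tt 0%N < crd i x] v = C.
    rewrite /C /V6; apply: esym; apply: int3_supp => x /= /negP; rewrite -leNgt /tt => h.
    rewrite vS ?expr0n//= => xy.
    have := le_trans (norm_crd i (x - y)) xy; rewrite crdB ler_norml => /andP[+ _].
    by move: h; rewrite rl; lra.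
  by rewrite ltNge => /negP; apply; rewrite ler_piMl ?ltW// delE; lra.
exists (tt k).
  have h1 : 1 <= k%:R :> R by rewrite ler1n.
  have h2 : k%:R <= 17 :> R by rewrite ler_nat.
  rewrite /tt addrAC subrr add0r ler_norml rl; apply/andP; split.
    have : 0 <= (k%:R - 1) * l by rewrite mulr_ge0 ?subr_ge0// ltW.
    by lra.
  have : 0 <= (17 - k%:R) * l by rewrite mulr_ge0 ?subr_ge0// ltW.
  by lra.
have hL : (1 - del) * C <= V6 [set x | crd i x < tt k + l] v.
  by have [//|] := HS (tt k); rewrite leNgt; move: Pk; rewrite /P => ->.
have hR : (1 - del) * C <= V6 [set x | tt k - l < crd i x] v.
  have -> : tt k - l = tt k.-1 by rewrite /tt -{1}(prednK k1) -natr1; ring.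
  rewrite leNgt; apply/negP => /mk; rewrite leqNgt => /negP; apply.
  by rewrite ltn_predL.
have := V6_inter vH (measurable_crd_gt i (tt k - l)) (measurable_crd_lt i (tt k + l)).
by rewrite -/C; apply: le_trans; lra.
Qed.

End descent.

(** * Descent to smaller cubes *)

Lemma norm_le_itv (R : realType) (a b q : R) : b - q < a -> a < b + q -> `|a - b| <= q.
Proof. by move=> h1 h2; rewrite ler_norml; apply/andP; split; lra. Qed.

Lemma inter_arith (R : realType) (q a0 a1 a2 a01 d : R) : a0 + a1 - d <= a01 ->
  q <= a0 -> q <= a1 -> q <= a2 -> 3 * q - 2 * d <= a01 + a2 - d.
Proof. by move=> h h0 h1 h2; lra. Qed.

Section concentration.
Context (R : realType) (Q eta del : R).
Implicit Types (x y : R3 R) (u v w c s : R3 R -> R) (S : set (M3 R)) (i : 'I_3) (r t l : R).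
Hypotheses (Q0 : 0 < Q) (etaE : eta = 1 / 2000) (delE : del = 1 / 120).
Hypothesis SOB : forall u, H1 u -> (Cint 6 u <= (Q * vA u ^+ 3)%:E)%E.

Definition M2 S u : R := Rintegral (leb3 R) S (fun x => u x ^+ 2).

Lemma M2_ge0 S u : 0 <= M2 S u.
Proof. by apply: int3_ge0 => x; exact: sqr_ge0. Qed.

Lemma M2_subset u S S' : H1 u -> measurable S -> measurable S' -> S `<=` S' -> M2 S u <= M2 S' u.
Proof.
move=> uH mS mS' SS; apply: int3_subset => //; first exact: sqr_integrable.
by move=> x; exact: sqr_ge0.
Qed.

Lemma M2_mono u v S : H1 u -> H1 v -> measurable S -> (forall x, v x ^+ 2 <= u x ^+ 2) -> M2 S v <= M2 S u.
Proof.
move=> uH vH mS vu; apply: le_Rintegral => //.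
- by apply: integrable3S => //; exact: sqr_integrable.
- by apply: integrable3S => //; exact: sqr_integrable.
Qed.

Lemma cut_sqr_le (c s z : R) : c ^+ 2 + s ^+ 2 = 1 -> (c * z) ^+ 2 <= z ^+ 2.
Proof.
by move=> cs; rewrite exprMn ler_piMl ?sqr_ge0// -cs lerDl sqr_ge0.
Qed.

(** The deficit cannot be negative, so the discarded energy satisfies Q al / 2 <= 8 Q eta. Inserting
    this in the last hypothesis produces the constant 9. *)
Lemma descent_arith (C' A al : R) : 0 <= Q * A ^+ 3 - C' ->
  Q * A ^+ 3 - C' <= Q * eta + 7 * Q * eta - Q / 2 * al ->
  Q - Q * eta - Q / 2 * al <= C' -> Q * (1 - 9 * eta) <= C'.
Proof.
move: (Q * A ^+ 3) => B; rewrite (_ : 7 * Q * eta = 7 * (Q * eta)); last by ring.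
by rewrite (_ : Q * (1 - 9 * eta) = Q - 9 * (Q * eta)); [lra|ring].
Qed.

Lemma box_arith (C' T V : R) : Q * (1 - 9 * eta) <= C' -> 3 * ((1 - 2 * del) * C') - 2 * C' <= V ->
  T <= Q -> T - V <= Q / 16.
Proof.
rewrite etaE delE => h1 h2 h3; move: Q0 h1 h2 h3; lra.
Qed.

(** The box cut leaves a function that is still a near-maximizer and is supported in a cube
    comparable to [r], so [slab_localize] applies in each coordinate. The three slabs of half-width
    [r / 4] meet in the new cube, and [u] keeps at least as much of the sixth power there as its
    truncation. *)
Lemma descent : exists2 K : R, 0 < K & forall u y r, H1 u -> vA u = 1 ->
  Q - Q * eta <= V6 setT u -> 0 < r -> V6 (~` cube y r) u <= Q / 16 ->
  K * (r ^- 2 * M2 (cube y (2 * r)) u) <= eta ->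
  exists2 y', `|y' - y| <= 2 * r & V6 (~` cube y' (r / 4)) u <= Q / 16.
Proof.
have eta1 : 0 <= eta <= 1 by apply/andP; split; rewrite etaE; lra.
have eta0 : 0 < eta by rewrite etaE; lra.
have [Kb Kb0 HKb] := box_cut R.
have [Ks Ks0 HKs] := slab_localize Q0 etaE delE SOB.
exists (Kb + Ks); first exact: addr_gt0.
move=> u y r uH u1 uQ r0 tl; rewrite mulrDl => Keta.
have [c [s [cs s0 c0 /(_ u uH)[cH sH A12]]]] := HKb y r r0.
have I0 : 0 <= r ^- 2 * M2 (cube y (2 * r)) u.
  by rewrite mulr_ge0 ?M2_ge0// invr_ge0 exprn_ge0// ltW.
have W1 : Kb * (r ^- 2 * M2 (cube y (2 * r)) u) <= eta.
  by apply: le_trans Keta; rewrite lerDl mulr_ge0// ltW.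
have W2 : Ks * (r ^- 2 * M2 (cube y (2 * r)) u) <= eta.
  by apply: le_trans Keta; rewrite lerDr mulr_ge0// ltW.
have mc := measurable_cube y r.
have s0' x : ~ (~` cube y r) x -> s x = 0 by move=> /contrapT /s0.
have A12' : vA (fun x => c x * u x) + vA (fun x => s x * u x) <= vA u + eta.
  by apply: (le_trans A12); rewrite lerD2l.
have [d1 d2] := cut_deficit Q0 SOB uH u1 uQ cs (measurableC mc) s0' tl cH sH eta1 A12'.
set v := fun x => c x * u x in cH A12' d1 d2 *.
have vQ : Q * (1 - 9 * eta) <= V6 setT v.
  apply: (descent_arith _ d1 d2).
  by rewrite subr_ge0; exact: V6_le.
have vA1 : vA v <= 1 + eta.
  by rewrite -u1; apply: le_trans A12'; rewrite lerDl vA_ge0.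
have v0 x : ~ cube y (2 * r) x -> v x = 0 by move=> /c0; rewrite /v => ->; rewrite mul0r.
have vu x : v x ^+ 2 <= u x ^+ 2 by exact: cut_sqr_le (cs x).
have vM : Ks * (r ^- 2 * Rintegral (leb3 R) setT (fun x => v x ^+ 2)) <= eta.
  apply: le_trans W2; rewrite ler_pM2l// ler_wpM2l//.
    by rewrite invr_ge0 exprn_ge0// ltW.
  rewrite (int3_supp (S := cube y (2 * r))); last by move=> x /v0 ->; rewrite expr0n.
  exact: (M2_mono uH cH (measurable_cube y (2 * r)) vu).
have /choice[f Hf] : forall i, exists t, `|t - crd i y| <= 2 * r /\
    (1 - 2 * del) * V6 setT v <= V6 ([set x | t - r / 4 < crd i x] `&` [set x | crd i x < t + r / 4]) v.
  by move=> i; have [t h1 h2] := HKs v i y r cH r0 vA1 vQ v0 vM; exists t.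
exists (pt f).
  by apply: crd_le => i; rewrite crdB crd_pt; case: (Hf i).
pose S i : set (M3 R) := [set x | f i - r / 4 < crd i x] `&` [set x | crd i x < f i + r / 4].
have mS i : measurable (S i) by apply: measurableI; [exact: measurable_crd_gt|exact: measurable_crd_lt].
pose i2 := Ordinal (ltnSn 2).
have I1 := V6_inter SOB cH (mS 0) (mS 1).
have I2 := V6_inter SOB cH (measurableI _ _ (mS 0) (mS 1)) (mS i2).
have Sc : S 0 `&` S 1 `&` S i2 `<=` cube (pt f) (r / 4).
  move=> x [[h0 h1] h2]; apply: crd_le => i; rewrite crdB crd_pt.
  have : S i x.
    case: i => [[|[|[|//]]] p].
    - by rewrite (_ : Ordinal p = 0)//; exact: val_inj.
    - by rewrite (_ : Ordinal p = 1)//; exact: val_inj.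
    - by rewrite (_ : Ordinal p = i2)//; exact: val_inj.
  by case; exact: norm_le_itv.
have mS3 : measurable (S 0 `&` S 1 `&` S i2) by exact: (measurableI _ _ (measurableI _ _ (mS 0) (mS 1)) (mS i2)).
have mc' := measurable_cube (pt f) (r / 4).
have I3 := V6_subset SOB cH mS3 mc' Sc.
have I4 := V6_mono SOB uH cH mc' vu.
have I5 := V6_compl SOB uH mc'.
have I6 := V6_le SOB uH; rewrite u1 expr1n mulr1 in I6.
have J0 := (Hf 0).2; have J1 := (Hf 1).2; have J2 := (Hf i2).2.
have -> : V6 (~` cube (pt f) (r / 4)) u = V6 setT u - V6 (cube (pt f) (r / 4)) u.
  by rewrite -I5 addrAC subrr add0r.
apply: (box_arith vQ _ I6).
apply: le_trans I4; apply: le_trans I3; apply: le_trans I2.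
exact: inter_arith I1 J0 J1 J2.
Qed.

Lemma V6_cube_cvg u : H1 u -> V6 (cube 0 n%:R) u @[n --> \oo] --> V6 setT u.
Proof.
move=> uH; have iu := sextic_integrable SOB uH.
have h := @cube_exhaust R (EFin \o (fun x => u x ^+ 6)) (measurable_sextic uH)
  (fun x => (_ : 0 <= (u x ^+ 6)%:E)%E).
have {}h := h (fun x => sextic_ge0 u x).
apply: fine_cvg; rewrite /V6 /Rintegral fineK; first exact: h.
exact: integrable_fin_num.
Qed.

(** Mass over a squared length scales like A under dilations and amplitudes. The factor 5 leaves
    room for a centre moved by [2 * r] and a cutoff of radius 5 r / 2 around it. *)
Definition omega y r u : R := r ^- 2 * M2 (cube y (5 * r)) u.

(** At large radii [omega] tends to 0 because the total mass is finite. *)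
Lemma start_scale u (w0 : R) : H1 u -> vA u = 1 -> 0 < w0 ->
  exists2 r, 0 < r & V6 (~` cube 0 r) u <= Q / 16 /\ omega 0 r u <= w0.
Proof.
move=> uH u1 w00; have h := V6_cube_cvg uH.
have Q16 : 0 < Q / 16 by rewrite divr_gt0.
have M0 := M2_ge0 setT u.
near \oo => n.
have n0 : 0 < n%:R :> R by rewrite ltr0n; near: n; exact: nbhs_infty_gt.
exists n%:R => //; split.
  have : `|V6 setT u - V6 (cube 0 n%:R) u| < Q / 16.
    by near: n; move/cvgrPdist_lt : h; apply.
  have := V6_compl SOB uH (measurable_cube 0 n%:R).
  by move=> <-; rewrite addrAC subrr add0r => /ltW; apply: le_trans; exact: ler_norm.
have hM : M2 (cube 0 (5 * n%:R)) u <= M2 setT u.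
  by apply: M2_subset => //; exact: measurable_cube.
rewrite /omega mulrC ler_pdivrMr ?exprn_gt0//; apply: (le_trans hM).
have n1 : 1 <= n%:R :> R by rewrite ler1n; near: n; exact: nbhs_infty_gt.
apply: (@le_trans _ _ (w0 * n%:R)); last first.
  by rewrite ler_pM2l// expr2 ler_peMr// ltW.
by rewrite mulrC -ler_pdivrMr//; near: n; exact: nbhs_infty_ger.
Unshelve. all: by end_near. Qed.

Lemma V6_small_cube u (e : R) : H1 u -> 0 < e ->
  exists2 d, 0 < d & forall y r, 0 <= r -> r < d -> V6 (cube y r) u < e.
Proof.
move=> uH e0; have [d [d0 hd]] := integral_normr_continuous (sextic_integrable SOB uH) e0.
(* The volume 8 r^3 of the cube is at most 8 r for r <= 1. *)
pose m := Num.min 1 (d / 8).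
have m0 : 0 < m by rewrite lt_min ltr01 divr_gt0.
exists m => // y r r0; rewrite lt_min => /andP[r1 rd].
have := hd (cube y r) (measurable_cube y r).
rewrite leb3_cube// lte_fin => h.
have -> : V6 (cube y r) u = Rintegral (leb3 R) (cube y r) (fun x => `|u x ^+ 6|).
  by apply: eq_Rintegral => x _; rewrite ger0_norm// sextic_ge0.
apply: h; rewrite mulr2n -[r + r]mulr2n -mulr_natl exprMn.
rewrite mulrC -ltr_pdivlMr ?exprn_gt0//.
have -> : 2 ^+ 3 = 8 :> R by ring.
apply: le_lt_trans rd; rewrite exprS -[leRHS]mulr1 ler_wpM2l// exprn_ile1//.
exact: ltW.
Qed.

(* If the descent never stopped, cubes of vanishing size would keep half of the
   integral of [u ^ 6]. *)
Lemma stop_scale (w0 : R) u : 0 < w0 -> H1 u -> vA u = 1 -> Q - Q * eta <= V6 setT u ->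
  (forall y r, 0 < r -> V6 (~` cube y r) u <= Q / 16 -> omega y r u <= w0 ->
     exists2 y', `|y' - y| <= 2 * r & V6 (~` cube y' (r / 4)) u <= Q / 16) ->
  exists y r y', [/\ 0 < r, `|y' - y| <= 2 * r, omega y r u <= w0,
    V6 (~` cube y' (r / 4)) u <= Q / 16 & w0 < omega y' (r / 4) u].
Proof.
move=> w00 uH u1 uQ step; apply: contrapT => nex.
have [r0 r00 [V0 W0]] := start_scale uH u1 w00.
have all_scales k : exists y, V6 (~` cube y (r0 / 4 ^+ k)) u <= Q / 16 /\ omega y (r0 / 4 ^+ k) u <= w0.
  elim: k => [|k [y [Vy Wy]]]; first by exists 0; rewrite expr0 divr1.
  have rk : 0 < r0 / 4 ^+ k by rewrite divr_gt0// exprn_gt0.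
  have [y' yy' Vy'] := step y _ rk Vy Wy.
  have E : r0 / 4 ^+ k.+1 = r0 / 4 ^+ k / 4 by rewrite exprSr invfM mulrA.
  exists y'; rewrite E; split => //; rewrite leNgt; apply/negP => W'.
  by apply: nex; exists y, (r0 / 4 ^+ k), y'.
have Q2 : 0 < Q / 2 by rewrite divr_gt0.
have [d d0 hd] := V6_small_cube uH Q2.
have [k kd] : exists k : nat, r0 / 4 ^+ k < d.
  exists (Num.trunc (r0 / d)).+1; rewrite ltr_pdivrMr ?exprn_gt0// mulrC -ltr_pdivrMr//.
  apply: (@lt_trans _ _ (Num.trunc (r0 / d)).+1%:R); first exact: truncnS_gt.
  have := @ltn_expl 4 (Num.trunc (r0 / d)).+1 isT.
  by rewrite -(ltr_nat R) natrX.
have [y [Vy _]] := all_scales k.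
have rk : 0 <= r0 / 4 ^+ k by rewrite ltW// divr_gt0// exprn_gt0.
have := hd y _ rk kd; have := V6_compl SOB uH (measurable_cube y (r0 / 4 ^+ k)).
move: Vy uQ; move: (V6 _ _) (V6 _ _) (V6 _ _) => a b c h1 h2 h3 h4.
by move: h1 h2 h3 h4; rewrite etaE; move: Q0; lra.
Qed.

End concentration.

(** * Truncated near-maximizers *)

(** m^2 / (10 r) is the bound of [Bint_cube] for a function of mass m supported in a cube of radius
    5 r / 2. The right-hand side equals 16 m^4 / r^2, and the hypothesis bounds w0 by 16 m / r^2. *)
Lemma bubble_arith (R : realType) (w0 r m : R) : 0 < r -> 0 < w0 -> w0 < (r / 4) ^- 2 * m ->
  w0 * m ^+ 3 <= 1600 * ((10 * r)^-1 * m ^+ 2) ^+ 2.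
Proof.
move=> r0 w00 h.
have q0 : 0 < (r / 4) ^- 2 by rewrite invr_gt0 exprn_gt0// divr_gt0.
have m0 : 0 < m by rewrite -(pmulr_rgt0 _ q0) (lt_trans w00).
have -> : 1600 * ((10 * r)^-1 * m ^+ 2) ^+ 2 = (r / 4) ^- 2 * m * m ^+ 3.
  by field; rewrite gt_eqF.
by rewrite ler_pM2r ?exprn_gt0// ltW.
Qed.

(** Nonnegativity of the deficit limits the energy [al] of the discarded part, so most of C survives
    and A^3 >= 1/64 with much to spare. The bound allows division by powers of A later. *)
Lemma bubble_mass_ge (R : realType) (Q ep W al A C' eta : R) : 0 < Q -> eta = 1 / 2000 -> 0 <= A ->
  ep <= Q * eta -> 0 <= W <= eta ->
  0 <= Q * A ^+ 3 - C' -> Q * A ^+ 3 - C' <= ep + 7 * Q * W - Q / 2 * al ->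
  Q - ep - Q / 2 * al <= C' -> 1 / 4 <= A.
Proof.
move=> Q0 etaE A0 epQ /andP[W0 W1] D0 D1 C1.
have QW : Q * W <= Q * eta by rewrite ler_pM2l.
have h : Q * (1 / 64) <= Q * A ^+ 3.
  move: D0 D1 C1 QW epQ; rewrite etaE -mulrA; move: (Q * A ^+ 3) (Q * W) (Q / 2 * al) => x y z.
  by move: Q0; lra.
rewrite ler_pM2l// in h; rewrite leNgt; apply/negP => A4.
move: h; rewrite leNgt => /negP; apply.
have -> : 1 / 64 = (1 / 4) ^+ 3 :> R by field.
by rewrite ltrXn2r// ?nnegrE//.
Qed.

Section bubble.
Context (R : realType) (Q eta del : R).
Implicit Types (x y : R3 R) (u v w c s : R3 R -> R) (S : set (M3 R)) (i : 'I_3) (r t l : R).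
Hypotheses (Q0 : 0 < Q) (etaE : eta = 1 / 2000) (delE : del = 1 / 120).
Hypothesis SOB : forall u, H1 u -> (Cint 6 u <= (Q * vA u ^+ 3)%:E)%E.
Hypothesis NEAR : forall e, 0 < e -> exists u, [/\ H1 u, vA u = 1 & Q - e <= V6 setT u].

Lemma mass_M2 v : H1 v -> mass v = (M2 setT v)%:E.
Proof.
move=> vH; rewrite /mass /M2 /Rintegral fineK.
  by apply: eq_integral => x _; rewrite real_normK ?num_real.
by apply: integrable_fin_num => //; exact: sqr_integrable.
Qed.

Lemma mass_supp v S : H1 v -> measurable S -> (forall x, ~ S x -> v x = 0) ->
  (\int[leb3 R]_(x in S) (`|v x| ^+ 2)%:E)%E = (M2 setT v)%:E.
Proof.
move=> vH mS vS; rewrite /M2 (@int3_supp _ _ S); last by move=> x /vS ->; rewrite expr0n.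
rewrite /Rintegral fineK.
  by apply: eq_integral => x _; rewrite real_normK ?num_real.
by apply: integrable_fin_num => //; apply: integrable3S => //; exact: sqr_integrable.
Qed.

(** Two consecutive scales are used. At scale [r] the mass is at most w0 r^2, so the cut costs a
    multiple of w0; at scale [r / 4] it exceeds w0 (r / 4)^2, which bounds B from below. *)
Lemma bubble : exists2 K : R, 0 < K & forall w0 ep : R, 0 < w0 -> K * w0 <= eta -> 0 < ep -> ep <= Q * eta ->
  exists v (m b : R), [/\ H1 v, mass v = m%:E, 0 < m, 0 <= b & (b%:E <= Bint v)%E] /\
    [/\ 1 / 4 <= vA v, Q * vA v ^+ 3 - V6 setT v <= ep + 7 * Q * (K * w0) &
        w0 * m ^+ 3 <= 1600 * b ^+ 2].
Proof.
have eta1 : eta <= 1 by rewrite etaE; lra.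
have [K1 K10 HK1] := descent Q0 etaE delE SOB.
have [Kb Kb0 HKb] := box_cut R.
exists (K1 + Kb); first exact: addr_gt0.
move=> w0 ep w00 Kw ep0 epQ.
have Kw1 : K1 * w0 <= eta by apply: le_trans Kw; rewrite ler_pM2r// lerDl ltW.
have Kwb : Kb * w0 <= (K1 + Kb) * w0 by rewrite ler_pM2r// lerDr ltW.
have [u [uH u1 uQ]] := NEAR ep0.
have uQ' : Q - Q * eta <= V6 setT u by apply: le_trans uQ; rewrite lerD2l lerN2.
have stp y r : 0 < r -> V6 (~` cube y r) u <= Q / 16 -> omega y r u <= w0 ->
     exists2 y', `|y' - y| <= 2 * r & V6 (~` cube y' (r / 4)) u <= Q / 16.
  move=> r0 V16 W; apply: HK1 => //; apply: le_trans Kw1; rewrite ler_pM2l//.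
  apply: le_trans W; rewrite /omega; apply: ler_wpM2l.
    by rewrite invr_ge0 exprn_ge0// ltW.
  apply: M2_subset => //; [exact: measurable_cube|exact: measurable_cube|].
  by apply: cube_subset; rewrite subrr normr0 add0r ler_pM2r// ler_nat.
have [y [r [y' [r0 yy' W V16 W']]]] := stop_scale Q0 etaE SOB w00 uH u1 uQ' stp.
(* The inner cube is the one in [omega y' (r / 4) u], so all of that mass survives the cut. The
   outer cube, of radius 5 r / 2 about [y'], remains inside the one in [omega y r u]. *)
set rho := 5 * (r / 4); have rho0 : 0 < rho by rewrite mulr_gt0// divr_gt0.
have rrho : r <= rho by rewrite /rho; lra.
have rr4 : r / 4 <= rho by rewrite /rho; lra.
have rr2 : 2 * r + 2 * rho <= 5 * r by rewrite /rho; lra.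
have [c [s [cs s0 c0 /(_ u uH)[cH sH A12]]]] := HKb y' rho rho0.
set v := fun x => c x * u x in cH A12 *.
set W1 := Kb * _ in A12.
have W1le : W1 <= Kb * w0.
  rewrite ler_pM2l//; apply: le_trans W; rewrite /omega; apply: ler_pM.
  - by rewrite invr_ge0 exprn_ge0// ltW.
  - exact: M2_ge0.
  - by rewrite lef_pV2 ?posrE ?exprn_gt0// lerXn2r ?nnegrE ?(ltW r0) ?(ltW rho0).
  apply: (M2_subset uH); [exact: measurable_cube|exact: measurable_cube|].
  by apply: cube_subset; exact: (le_trans (lerD yy' (lexx _)) rr2).
have W1eta : 0 <= W1 <= eta.
  apply/andP; split; last exact: (le_trans W1le (le_trans Kwb Kw)).
  rewrite /W1 mulr_ge0 ?(ltW Kb0)// mulr_ge0 ?M2_ge0//.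
  by rewrite invr_ge0 exprn_ge0// ltW.
have W11 : 0 <= W1 <= 1 by case/andP: W1eta => -> /le_trans; apply.
have mc := measurable_cube y' rho.
have s0' x : ~ (~` cube y' rho) x -> s x = 0 by move=> /contrapT /s0.
have tl : V6 (~` cube y' rho) u <= Q / 16.
  apply: le_trans V16; apply: (V6_subset SOB uH); [exact: measurableC|exact: measurableC (measurable_cube _ _)|].
  by apply: subsetC; apply: cube_subset; rewrite subrr normr0 add0r.
have [d1 d2] := cut_deficit Q0 SOB uH u1 uQ cs (measurableC mc) s0' tl cH sH W11 A12.
have v0 x : ~ cube y' (2 * rho) x -> v x = 0 by move=> /c0; rewrite /v => ->; rewrite mul0r.
have mge : w0 < (r / 4) ^- 2 * M2 setT v.
  apply: (lt_le_trans W'); rewrite /omega; apply: ler_wpM2l.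
    by rewrite invr_ge0 exprn_ge0// divr_ge0// ltW.
  apply: (@le_trans _ _ (M2 (cube y' rho) v)); last by apply: M2_subset.
  rewrite le_eqVlt; apply/orP; left; apply/eqP; apply: eq_Rintegral => x.
  by rewrite inE /v exprMn => /s0 sx; have := cs x; rewrite sx expr0n addr0 => ->; rewrite mul1r.
have q0 : 0 < (r / 4) ^- 2 by rewrite invr_gt0 exprn_gt0// divr_gt0.
have m0 : 0 < M2 setT v by rewrite -(pmulr_rgt0 _ q0) (lt_trans w00).
exists v, (M2 setT v), ((10 * r)^-1 * M2 setT v ^+ 2); split; split.
- by [].
- exact: mass_M2.
- by [].
- by rewrite mulr_ge0 ?sqr_ge0// invr_ge0 mulr_ge0// ltW.
- have r20 : 0 < 2 * rho by rewrite mulr_gt0.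
  have := Bint_cube y' (H1_measurable cH) r20.
  rewrite (mass_supp cH (measurable_cube _ _) v0) -EFinM.
  by rewrite (_ : 4 * (2 * rho) = 10 * r)//; rewrite /rho; field.
- apply: (bubble_mass_ge Q0 etaE (vA_ge0 v) epQ W1eta _ d1 d2).
  by rewrite subr_ge0; exact: V6_le.
- apply: (le_trans d1).
  have : 0 <= Q / 2 * vA (fun x => s x * u x) by rewrite mulr_ge0 ?vA_ge0// divr_ge0// ltW.
  have : 7 * Q * W1 <= 7 * Q * ((K1 + Kb) * w0).
    by rewrite ler_pM2l ?mulr_gt0//; exact: le_trans W1le Kwb.
  by move=> h1 h2; rewrite lerBlDr -addrA lerD2l (le_trans h1)// lerDl.
- exact: bubble_arith.
Qed.

End bubble.

(* [(3 * z)^-1] is the maximum of [t ^ 2 / 2 - a * Q * t ^ 6 / 6] over [t > 0]. *)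
Section level.
Context (R : realType) (a Q z : R).
Hypotheses (a0 : 0 < a) (Q0 : 0 < Q) (z0 : 0 < z) (zE : z ^+ 2 = a * Q).

Lemma level_upper (t : R) : 1 / 2 * t ^+ 2 - a / 6 * (t ^+ 6 * Q) <= (3 * z)^-1.
Proof.
(* In this variable the gap to the maximum is (x - 1)^2 (x + 2) / (6 z). *)
set x := z * t ^+ 2; have x0 : 0 <= x by rewrite mulr_ge0 ?sqr_ge0// ltW.
have : 0 <= (6 * z)^-1 * ((x - 1) ^+ 2 * (x + 2)).
  apply: mulr_ge0; first by rewrite invr_ge0 mulr_ge0// ltW.
  by apply: mulr_ge0 (sqr_ge0 _) _; rewrite addr_ge0.
have -> : (6 * z)^-1 * ((x - 1) ^+ 2 * (x + 2)) = z ^+ 2 / 6 * t ^+ 6 - 1 / 2 * t ^+ 2 + (3 * z)^-1.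
  by rewrite /x; field; rewrite gt_eqF.
rewrite zE => h; rewrite -subr_ge0; apply: le_trans h _.
by rewrite le_eqVlt; apply/orP; left; apply/eqP; field; rewrite gt_eqF.
Qed.

(** The fiber map is compared with the one where B is dropped and C raised to Q. The difference is t
    times gam B / 4 - a t^5 (Q - C) / 6; the hypotheses on a t^4 C and on C keep t bounded, so a
    small [kap] lets the B term win. *)
Lemma level_fiber (gam kap t B C : R) : 0 < gam -> 0 < t -> 0 < C -> 0 < B ->
  Q / 2 <= C -> a * t ^+ 4 * C <= 1 -> Q - C < kap * B -> 0 < kap ->
  kap * ((1 + 2 / (a * Q)) / (3 * Q)) <= gam / 4 ->
  1 / 2 * t ^+ 2 - gam / 4 * (t * B) - a / 6 * (t ^+ 6 * C) < (3 * z)^-1.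
Proof.
move=> gam0 t0 C0 B0 QC atC D kap0 hk.
apply: lt_le_trans (level_upper t).
rewrite -subr_gt0.
have -> : 1 / 2 * t ^+ 2 - a / 6 * (t ^+ 6 * Q) - (1 / 2 * t ^+ 2 - gam / 4 * (t * B) - a / 6 * (t ^+ 6 * C)) =
  t * (gam / 4 * B - a * t ^+ 4 * t / 6 * (Q - C)) by field.
apply: mulr_gt0 => //; rewrite subr_gt0.
have at0 : 0 < a * t ^+ 4 by rewrite mulr_gt0// exprn_gt0.
have at4 : a * t ^+ 4 <= 2 / Q.
  rewrite ler_pdivlMr//; have : a * t ^+ 4 * (Q / 2) <= 1 by apply: le_trans atC; rewrite ler_pM2l.
  by rewrite mulrA; lra.
have t4 : t ^+ 4 <= 2 / (a * Q).
  rewrite -(ler_pM2l a0); apply: (le_trans at4).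
  by rewrite le_eqVlt; apply/orP; left; apply/eqP; field; rewrite !gt_eqF.
have t1 : t <= 1 + 2 / (a * Q).
  apply: (@le_trans _ _ (1 + t ^+ 4)); last by rewrite lerD2l.
  have [h|h] := leP t 1; first by rewrite (le_trans h)// lerDl exprn_ge0// ltW.
  apply: (@le_trans _ _ (t ^+ 4)); last by rewrite lerDr.
  by rewrite exprS ler_peMr ?(ltW t0)// exprn_ege1// ltW.
have P1 : a * t ^+ 4 * t / 6 <= (1 + 2 / (a * Q)) / (3 * Q).
  have -> : (1 + 2 / (a * Q)) / (3 * Q) = 2 / Q * (1 + 2 / (a * Q)) / 6.
    by move: (1 + 2 / (a * Q)) => q; field; rewrite gt_eqF.
  by rewrite ler_pM2r ?invr_gt0// ler_pM// ltW.
have P0 : 0 < a * t ^+ 4 * t / 6 by rewrite divr_gt0// mulr_gt0.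
apply: (@lt_le_trans _ _ (a * t ^+ 4 * t / 6 * (kap * B))); first by rewrite ltr_pM2l.
rewrite mulrA ler_pM2r//; apply: le_trans hk; rewrite mulrC ler_pM2l//.
Qed.

(** Here [be] is gam B / 4 and the right-hand side is the energy on the constraint at p = 6. The
    hypothesis gives (z A)^2 >= 1 - be / A0; as the right side is at most 1, also z A >= 1 - be /
    A0. *)
Lemma level_lower (A0 A be : R) : 0 < A0 -> A0 <= A -> 0 <= be -> A - be <= a * (Q * A ^+ 3) ->
  (3 * z)^-1 - be * ((3 * z * A0)^-1 + 5 / 6) <= A / 3 - 5 / 6 * be.
Proof.
move=> A00 A0A be0 h; have A_gt0 : 0 < A by exact: lt_le_trans A0A.
set s := be / A0; have s0 : 0 <= s by rewrite divr_ge0// ltW.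
have x0 : 0 < z * A by rewrite mulr_gt0.
have h2 : 1 - s <= (z * A) ^+ 2.
  rewrite exprMn zE.
  apply: (@le_trans _ _ (1 - be / A)).
    by rewrite lerD2l lerN2 ler_wpM2l// lef_pV2 ?posrE.
  by rewrite -(ler_pM2r A_gt0) mulrBl mul1r divfK ?gt_eqF//; apply: le_trans h _; rewrite le_eqVlt; apply/orP; left; apply/eqP; ring.
have h3 : 1 - s <= z * A.
  have [h1|h1] := leP (1 - s) 0; first by apply: (le_trans h1); exact: ltW.
  rewrite leNgt; apply/negP => h4.
  have : (z * A) ^+ 2 < (1 - s) * 1.
    rewrite expr2; apply: (@le_lt_trans _ _ (z * A * (1 - s))); first by rewrite ler_pM2l// ltW.
    rewrite mulrC ltr_pM2l//; apply: (lt_le_trans h4); lra.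
  by rewrite mulr1 ltNge h2.
have h5 : (1 - s) * (3 * z)^-1 <= A / 3.
  rewrite ler_pdivrMr ?mulr_gt0//; apply: (le_trans h3).
  by rewrite le_eqVlt; apply/orP; left; apply/eqP; field.
have E : (1 - s) * (3 * z)^-1 = (3 * z)^-1 - be * (3 * z * A0)^-1.
  by rewrite /s; field; rewrite !gt_eqF.
by rewrite mulrDr; move: h5; rewrite E; lra.
Qed.

End level.

(** * The level at the critical exponent *)

Lemma sigma6 (R : realType) : sigma (6 : R) = 6.
Proof. by rewrite /sigma; field. Qed.

Lemma exponent6 (R : realType) : 10 / 3 < (6 : R) <= 6.
Proof. by apply/andP; split; lra. Qed.

Section critical.
Context (R : realType) (gam a KH KGN : R).
Hypotheses (hgam : 0 < gam) (ha : 0 < a) (hKH : 0 < KH) (hKGN : 0 < KGN).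
Hypothesis hB : forall (c : R) (u : R3 R -> R), 0 < c -> sphere c u ->
     (Bint u <= (KH * Num.sqrt (fine (Aint u)) * c `^ (3 / 2))%:E)%E.
Hypothesis hC : forall (c : R) (u : R3 R -> R), 0 < c -> sphere c u ->
     (Cint 6 u <= (KGN * fine (Aint u) `^ (sigma 6 / 2) * c `^ ((6 - 6) / 4))%:E)%E.
Implicit Types (u v w : R3 R -> R) (c t : R).

(** Invariant under [rescale]. The supremum is the best Sobolev constant, of which [KGN] is only
    some upper bound; sharpness is what provides near-maximizers. *)
Definition quotients : set R :=
  [set q | exists c u, [/\ 0 < c, sphere c u & q = vC 6 u / vA u ^+ 3]].

Lemma vC6_le u c : 0 < c -> sphere c u -> vC 6 u <= KGN * vA u ^+ 3.
Proof.
move=> c0 uS; have := vC_le hC c0 uS; rewrite subrr mul0r powRr0 mulr1 sigma6.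
have -> : 6 / 2 = 3%:R :> R by field.
by rewrite powR_mulrn ?vA_ge0.
Qed.

Lemma quotients_sup : has_sup quotients.
Proof.
split; last first.
  exists KGN => _ [c [u [c0 uS ->]]].
  by rewrite ler_pdivrMr ?vC6_le ?(vC6_le c0 uS)// exprn_gt0// (vA_gt0 hB c0 uS).
have [u uS] := sphere_neq0 (ltr01 : 0 < (1 : R)).
by exists (vC 6 u / vA u ^+ 3), 1, u; split.
Qed.

Definition Qsup : R := sup quotients.

Lemma Qsup_ge c u : 0 < c -> sphere c u -> vC 6 u <= Qsup * vA u ^+ 3.
Proof.
move=> c0 uS; rewrite -ler_pdivrMr ?exprn_gt0 ?(vA_gt0 hB c0 uS)//.
by apply: ub_le_sup; [case: quotients_sup|exists c, u].
Qed.

Lemma Qsup_gt0 : 0 < Qsup.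
Proof.
have [u uS] := sphere_neq0 (ltr01 : 0 < (1 : R)).
have := Qsup_ge ltr01 uS; have := vC_gt0 (exponent6 R) hC ltr01 uS => C0 /(lt_le_trans C0).
by rewrite pmulr_lgt0// exprn_gt0// (vA_gt0 hB ltr01 uS).
Qed.

Lemma Qsup_sobolev u : H1 u -> (Cint 6 u <= (Qsup * vA u ^+ 3)%:E)%E.
Proof.
move=> uH; have mE : mass u = (fine (mass u))%:E.
  by rewrite fineK// ge0_fin_numE ?H1_mass//; apply: integral_ge0 => x _; rewrite lee_fin sqr_ge0.
have m0 : 0 <= fine (mass u).
  by apply: fine_ge0; apply: integral_ge0 => x _; rewrite lee_fin sqr_ge0.
(* Functions of mass zero lie on no sphere of positive mass and are treated apart: they vanish
   almost everywhere. *)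
move: m0; rewrite le_eqVlt => /predU1P[m0|m0]; last first.
  have uS : sphere (fine (mass u)) u by [].
  by rewrite (Cint_vC hC m0 uS) lee_fin; exact: Qsup_ge uS.
have mu := H1_measurable uH.
rewrite -m0 in mE.
have ms : measurable_fun [set: M3 R] (fun x => (`|u x| ^+ 2)%:E).
  by apply/measurable_EFinP; apply: measurable_funX; exact: measurableT_comp.
have /(ae_eq_integral_abs (leb3 R) measurableT ms) : (\int[leb3 R]_x `|(`|u x| ^+ 2)%:E| = 0)%E.
  by rewrite -[RHS]mE; apply: eq_integral => x _; rewrite gee0_abs// lee_fin sqr_ge0.
move=> ae0.
have -> : Cint 6 u = 0%E.
  rewrite Cint6E -[RHS](@integral0 _ (M3 R) R (leb3 R) setT).
  apply: ge0_ae_eq_integral => //.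
  - by apply/measurable_EFinP; exact: measurable_funX.
  - by move=> x _; rewrite lee_fin sextic_ge0.
  apply: ae3_imp ae0 => x /(_ I) [] /eqP; rewrite expf_eq0/= normr_eq0 => /eqP ux _.
  by rewrite ux expr0n.
by rewrite lee_fin mulr_ge0 ?exprn_ge0 ?vA_ge0// ltW// Qsup_gt0.
Qed.

Lemma powR6 (x : R) : 0 <= x -> x `^ 6 = x ^+ 6.
Proof. by move=> x0; rewrite -[6]/(6%:R) powR_mulrn. Qed.

Lemma Qsup_near e : 0 < e -> exists u, [/\ H1 u, vA u = 1 & Qsup - e <= V6 setT u].
Proof.
move=> e0; have [_ [c [u [c0 uS ->]]] hq] := sup_adherent e0 quotients_sup.
have A0 := vA_gt0 hB c0 uS; have [uH _] := uS.
set al := Num.sqrt (vA u)^-1; have al0 : 0 < al by rewrite sqrtr_gt0 invr_gt0.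
have al2 : al ^+ 2 = (vA u)^-1 by rewrite sqr_sqrtr// invr_ge0 ltW.
exists (rescale al 1 u); split.
- by case: (sphere_rescale al0 ltr01 uS).
- by rewrite vA_rescale// invr1 mulr1 al2 mulVf// gt_eqF.
- rewrite -vC6E (vC_rescale (exponent6 R) hC c0 al0 ltr01 uS) invr1 expr1n mulr1.
  rewrite (powR6 (ltW al0)) (exprM _ 2 3) al2 exprVn mulrC; exact: ltW.
Qed.

End critical.

(** [Bw] is the value of B after normalization to mass c and A = 1, that is c^(3/2) B / (A^(1/2)
    m^(3/2)). Its square is at least of order w0, while the squared deficit is of order w0^2; the
    last hypothesis takes w0 small enough for the former to win. *)
Lemma bubble_compare (R : realType) (N Q K w0 c kap A C m b B Bw : R) :
  0 < N -> 0 < Q -> 0 < K -> 0 < w0 -> 0 < c -> 0 < kap -> 1 / 4 <= A -> 0 < m -> 0 <= b -> b <= B ->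
  0 <= Q * A ^+ 3 - C -> Q * A ^+ 3 - C <= 8 * (Q * (K * w0)) -> w0 * m ^+ 3 <= N * b ^+ 2 ->
  0 <= Bw -> Bw ^+ 2 * (A * m ^+ 3) = c ^+ 3 * B ^+ 2 ->
  64 * (4 ^+ 5 * N) * (Q * K) ^+ 2 * w0 < kap ^+ 2 * c ^+ 3 ->
  Q - C / A ^+ 3 < kap * Bw.
Proof.
move=> N0 Q0 K0 w00 c0 kap0 A4 m0 b0 bB D0 D8 wb Bw0 BwE hk.
have A0 : 0 < A by apply: lt_le_trans A4; rewrite divr_gt0.
have m3 : 0 < m ^+ 3 by rewrite exprn_gt0.
rewrite ltNge; apply/negP => h.
set D := Q * A ^+ 3 - C in D0 D8.
have DE : Q - C / A ^+ 3 = D / A ^+ 3 by rewrite /D; field; rewrite gt_eqF.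
have kB0 : 0 <= kap * Bw by rewrite mulr_ge0// ltW.
have h1 : (kap * Bw) ^+ 2 <= (D / A ^+ 3) ^+ 2 by rewrite -DE lerXn2r ?nnegrE// (le_trans kB0).
have bB2 : b ^+ 2 <= B ^+ 2 by rewrite lerXn2r ?nnegrE// (le_trans b0).
have h2 : kap ^+ 2 * c ^+ 3 * w0 <= N * (A * (D / A ^+ 3) ^+ 2).
  rewrite -(ler_pM2r m3).
  apply: (@le_trans _ _ (kap ^+ 2 * c ^+ 3 * (N * B ^+ 2))).
    rewrite -[leLHS]mulrA; apply: ler_wpM2l.
      by rewrite mulr_ge0 ?sqr_ge0// exprn_ge0// ltW.
    by apply: (le_trans wb); rewrite ler_pM2l.
  have -> : kap ^+ 2 * c ^+ 3 * (N * B ^+ 2) = N * ((kap * Bw) ^+ 2 * (A * m ^+ 3)).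
    transitivity (N * kap ^+ 2 * (c ^+ 3 * B ^+ 2)); first by ring.
    by rewrite -BwE; ring.
  have -> : N * (A * (D / A ^+ 3) ^+ 2) * m ^+ 3 = N * ((D / A ^+ 3) ^+ 2 * (A * m ^+ 3)) by ring.
  by rewrite ler_pM2l// ler_wpM2r// ltW// mulr_gt0.
have A5 : A^-1 ^+ 5 <= 4 ^+ 5.
  by rewrite lerXn2r ?nnegrE ?invr_ge0 ?(ltW A0)// -[4]invrK lef_pV2 ?posrE ?invr_gt0// -div1r.
have h3 : A * (D / A ^+ 3) ^+ 2 <= 4 ^+ 5 * (8 * (Q * (K * w0))) ^+ 2.
  have -> : A * (D / A ^+ 3) ^+ 2 = A^-1 ^+ 5 * D ^+ 2 by field; rewrite gt_eqF.
  apply: ler_pM => //; rewrite ?sqr_ge0 ?exprn_ge0 ?invr_ge0 ?(ltW A0)//.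
  by rewrite lerXn2r ?nnegrE// (le_trans D0).
have h4 : kap ^+ 2 * c ^+ 3 * w0 <= 64 * (4 ^+ 5 * N) * (Q * K) ^+ 2 * w0 * w0.
  apply: (le_trans h2); apply: (@le_trans _ _ (N * (4 ^+ 5 * (8 * (Q * (K * w0))) ^+ 2))).
    by rewrite ler_pM2l.
  by rewrite le_eqVlt; apply/orP; left; apply/eqP; move: (4 ^+ 5) => q; ring.
by rewrite ler_pM2r// in h4; move: hk; rewrite ltNge h4.
Qed.

Lemma pick_scale (R : realType) (K eta P y : R) : 0 < K -> 0 < eta -> 0 < P -> 0 < y ->
  exists w0, [/\ 0 < w0, K * w0 <= eta & P * w0 < y].
Proof.
move=> K0 e0 P0 y0; exists (Num.min (eta / K) (y / (2 * P))); split.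
- by rewrite lt_min !divr_gt0// mulr_gt0.
- by rewrite mulrC -ler_pdivlMr// ge_min lexx.
- apply: (@le_lt_trans _ _ (y / 2)); last by lra.
  rewrite mulrC -ler_pdivlMr// ge_min; apply/orP; right.
  by rewrite le_eqVlt; apply/orP; left; apply/eqP; field; rewrite gt_eqF.
Qed.

(** [e] is the energy of the compared function and [x] its B term. The two bounds around [l] force k
    x < d, and the last one then gives m <= e + d L / k, impossible when [d] is small against m -
    l. *)
Lemma level_contradiction (R : realType) (m l k L : R) : l < m -> 0 < k -> 0 <= L ->
  exists2 d, 0 < d & forall e x : R, 0 <= x -> l <= e -> e < l + d - k * x -> m - x * L <= e -> False.
Proof.
move=> lm k0 L0; set M := 1 + L / k.
have M0 : 0 < M by rewrite ltr_wpDr// divr_ge0// ltW.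
exists ((m - l) / M); first by rewrite divr_gt0// subr_gt0.
move=> e x x0 le ed me.
set d := (m - l) / M in ed *.
have kx : k * x <= d by lra.
have xL : x * L <= d * (L / k).
  have -> : x * L = k * x * (L / k) by field; rewrite gt_eqF.
  by rewrite ler_wpM2r// divr_ge0// ltW.
have : m - l < d * M - k * x by rewrite /M mulrDr mulr1; lra.
rewrite /d divfK ?gt_eqF//.
by have : 0 <= k * x by [rewrite mulr_ge0// ltW]; lra.
Qed.

Section critical_mass.
Context (R : realType) (gam a KH KGN : R).
Hypotheses (hgam : 0 < gam) (ha : 0 < a) (hKH : 0 < KH) (hKGN : 0 < KGN).
Hypothesis hB : forall (c : R) (u : R3 R -> R), 0 < c -> sphere c u ->
     (Bint u <= (KH * Num.sqrt (fine (Aint u)) * c `^ (3 / 2))%:E)%E.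
Hypothesis hC : forall (c : R) (u : R3 R -> R), 0 < c -> sphere c u ->
     (Cint 6 u <= (KGN * fine (Aint u) `^ (sigma 6 / 2) * c `^ ((6 - 6) / 4))%:E)%E.
Implicit Types (u v w : R3 R -> R) (c t : R).

Local Notation Q := (Qsup R).

Let Q0 : 0 < Q := Qsup_gt0 hB hC.

Lemma normalized_bubble c kap : 0 < c -> 0 < kap ->
  exists w, [/\ sphere c w, vA w = 1 & Q - vC 6 w < kap * vB w].
Proof.
move=> c0 kap0.
have eta0 : 0 < 1 / 2000 :> R by rewrite div1r invr_gt0 ltr0n.
have [K K0 HK] := bubble Q0 erefl erefl (Qsup_sobolev hB hC) (Qsup_near hB hC).
have N0 : 0 < 1600 :> R by rewrite ltr0n.
have QK : 0 < 64 * (4 ^+ 5 * 1600) * (Q * K) ^+ 2.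
  apply: mulr_gt0; first by lra.
  by apply: exprn_gt0; exact: mulr_gt0.
have y0 : 0 < kap ^+ 2 * c ^+ 3 by rewrite mulr_gt0 ?exprn_gt0.
have [w0 [w00 Kw Pw]] := pick_scale K0 eta0 QK y0.
have ep0 : 0 < Q * (K * w0) by rewrite !mulr_gt0.
have epQ : Q * (K * w0) <= Q * (1 / 2000) by rewrite ler_pM2l.
have [v [m [b [[vH vm m0 b0 bB] [A4 D wb]]]]] := HK w0 _ w00 Kw ep0 epQ.
have vS : sphere m v by [].
rewrite (Bint_vB hB m0 vS) lee_fin in bB.
have A0 := vA_gt0 hB m0 vS; have B0 := vB_gt0 hB m0 vS.
(* Together with [al] below, the solution of al^2 be^-3 m = c and al^2 be^-1 A = 1. *)
set be := Num.sqrt (m / (c * vA v)).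
have be0 : 0 < be by rewrite sqrtr_gt0 divr_gt0// mulr_gt0.
have be2 : be ^+ 2 = m / (c * vA v) by rewrite sqr_sqrtr// divr_ge0 ?mulr_ge0 ?ltW.
set al := Num.sqrt (be / vA v).
have al0 : 0 < al by rewrite sqrtr_gt0 divr_gt0.
have al2 : al ^+ 2 = be / vA v by rewrite sqr_sqrtr// divr_ge0 ?ltW.
have D0 : 0 <= Q * vA v ^+ 3 - V6 setT v.
  by rewrite subr_ge0; exact: V6_le (Qsup_sobolev hB hC) _ vH.
clearbody be al.
have wS : sphere c (rescale al be v).
  have := sphere_rescale al0 be0 vS; congr (sphere _ _).
  rewrite al2 (_ : be / vA v * be^-1 ^+ 3 * m = (be ^+ 2)^-1 * m / vA v); last first.
    by field; rewrite !gt_eqF.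
  by rewrite be2; field; rewrite !gt_eqF.
have Bw := vB_rescale hB m0 al0 be0 vS.
have Cw := vC_rescale (exponent6 R) hC m0 al0 be0 vS.
exists (rescale al be v); split => //.
  by rewrite vA_rescale// al2; field; rewrite !gt_eqF.
have -> : vC 6 (rescale al be v) = V6 setT v / vA v ^+ 3.
  rewrite Cw vC6E (powR6 (ltW al0)) (exprM _ 2 3) al2.
  by field; rewrite !gt_eqF.
apply: (bubble_compare N0 Q0 K0 w00 c0 kap0 A4 m0 b0 bB D0 _ wb) Pw.
- apply: (le_trans D); by rewrite le_eqVlt; apply/orP; left; apply/eqP; ring.
- exact: vB_ge0.
- rewrite Bw (exprM _ 2 2) al2.
  have -> : ((be / vA v) ^+ 2 * be^-1 ^+ 5 * vB v) ^+ 2 * (vA v * m ^+ 3) =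
    (be ^+ 2) ^- 3 * vB v ^+ 2 * m ^+ 3 / vA v ^+ 3.
    by move: (vB v) => B; field; rewrite !gt_eqF.
  by rewrite be2; move: (vB v) => B; field; rewrite !gt_eqF.
Qed.

Lemma critical_level c : 0 < c -> c < c1 gam a 6 KH KGN ->
  exists2 u, Lambda_minus gam a 6 c u & energy gam a 6 u < (3 * Num.sqrt (a * Q))^-1.
Proof.
move=> c0 cc.
have aQ : 0 < a * Q by exact: mulr_gt0.
have z0 : 0 < Num.sqrt (a * Q) by rewrite sqrtr_gt0.
have zE : Num.sqrt (a * Q) ^+ 2 = a * Q by rewrite sqr_sqrtr// ltW.
set X := (1 + 2 / (a * Q)) / (3 * Q).
have X0 : 0 < X by rewrite /X divr_gt0 ?mulr_gt0// addr_gt0// divr_gt0.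
have g4 : 0 < gam / 4 by rewrite divr_gt0.
have Y0 : 0 < KH * c `^ (3 / 2) by rewrite mulr_gt0// powR_gt0.
have Q2 : 0 < Q / 2 by rewrite divr_gt0.
(* The first bound on [kap] is the one required by [level_fiber]; the second makes kap B less than Q
   / 2, hence C >= Q / 2. *)
have [kap [kap0 hk1 hk2]] := pick_scale X0 g4 Y0 Q2.
have [w [wS A1 D]] := normalized_bubble c0 kap0.
have B0 := vB_gt0 hB c0 wS; have C0 := vC_gt0 (exponent6 R) hC c0 wS.
have BX : vB w <= KH * c `^ (3 / 2).
  by apply: (le_trans (vB_le hB c0 wS)); rewrite A1 sqrtr1 mulr1.
have QC : Q / 2 <= vC 6 w.
  have : kap * vB w <= kap * (KH * c `^ (3 / 2)) by rewrite ler_pM2l.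
  move: D hk2; rewrite [kap * (KH * _)]mulrC.
  by move: (kap * vB w) (KH * _ * kap) (vC 6 w) => x y C h1 h2 h3; lra.
have [t [t0 dt tL]] := Lambda_minus_fiber (exponent6 R) hgam ha hKH hKGN hB hC c0 cc wS.
exists (scale t w) => //.
rewrite (energy_scale gam a (exponent6 R) hB hC c0 t0 wS) A1.
rewrite /gfun sigma6 (powR6 (ltW t0)) mulr1.
apply: (level_fiber ha Q0 z0 zE hgam t0 C0 B0 QC _ D kap0); last by rewrite mulrC.
(* Criticality reads t - gam B / 4 = a t^5 C, and B > 0 yields a t^4 C <= 1. *)
move: dt; rewrite A1 /dgfun sigma6 mulr1.
have -> : t `^ (6 - 1) = t * t ^+ 4.
  by rewrite (_ : 6 - 1 = 5%:R :> R); [rewrite powR_mulrn ?(ltW t0)// exprS|ring].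
have -> : a / 6 * 6 * (t * t ^+ 4 * vC 6 w) = t * (a * t ^+ 4 * vC 6 w).
  by move: (vC 6 w) => C; field.
have gB : 0 < gam / 4 * vB w by exact: mulr_gt0.
move: gB; move: (gam / 4 * vB w) (a * _ * _) => x y x0 h.
rewrite -(ler_pM2l t0) mulr1.
by lra.
Qed.

Lemma gamma_minus_critical c c' : 0 < c -> c < c' -> c' < c1 gam a 6 KH KGN ->
  (gamma_minus gam a 6 c' < gamma_minus gam a 6 c)%E.
Proof.
move=> c0 cc' c'c; have c'0 := lt_trans c0 cc'; have cc := lt_trans cc' c'c.
have p6 := exponent6 R.
have [l [-> ll lu]] := gamma_minus_fin p6 hgam ha hKH hKGN hB hC c0 cc.
have [l' [-> l'l _]] := gamma_minus_fin p6 hgam ha hKH hKGN hB hC c'0 c'c.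
have [A0 [A00 lowA]] := Lambda_minus_lower gam p6 ha hKGN hB hC c'0.
have [u0 u0L u0m] := critical_level c0 cc.
have lm := le_lt_trans (ll _ u0L) u0m.
have aQ : 0 < a * Q by exact: mulr_gt0.
set z := Num.sqrt (a * Q) in u0m lm.
have z0 : 0 < z by rewrite sqrtr_gt0.
have zE : z ^+ 2 = a * Q by rewrite sqr_sqrtr// ltW.
set r := (c' / c) `^ 4^-1.
have r1 : 1 < r.
  by rewrite powR_gt1 ?invr_gt0// ltr_pdivlMr// mul1r.
have r4 : r ^+ 4 * c = c'.
  rewrite /r -powR_mulrn ?powR_ge0// -powRrM mulVf ?pnatr_eq0// powRr1 ?divr_ge0 ?ltW//.
  by rewrite divfK// gt_eqF.
have k0 : 0 < 1 - r ^- 6.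
  have r6 : 1 < r ^+ 6 by rewrite exprn_egt1.
  by rewrite subr_gt0 invf_lt1// (lt_trans ltr01).
have L0 : 0 <= (3 * z * A0)^-1 + 5 / 6.
  by rewrite addr_ge0 ?invr_ge0 ?divr_ge0// !mulr_ge0 ?(ltW z0) ?(ltW A00).
(* Under the assumption that the infimum does not drop, [w] has energy at least [l] and less than l
   + d minus a multiple of its B term; [level_lower] supplies the remaining bound. *)
have [d d0 hd] := level_contradiction lm k0 L0.
rewrite lte_fin ltNge; apply/negP => ll'.
have [u uL ul] := lu _ d0.
have c'c2 : r ^+ 4 * c < c1 gam a 6 KH KGN by rewrite r4.
have [w] := Lambda_minus_compare p6 hgam ha hKH hKGN hB hC c0 r1 c'c2 uL.
(* The coefficient of C is 1 - r^0 = 0: only the gain in B survives. *)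
rewrite r4 subrr powRr0 subrr mulr0 mul0r subr0 => wL wu.
apply: (hd (energy gam a 6 w) (gam / 4 * vB w)).
- by rewrite mulr_ge0 ?vB_ge0// ltW// divr_gt0.
- exact: le_trans ll' (l'l _ wL).
- apply: (le_lt_trans wu).
  rewrite (_ : gam / 4 * (1 - r ^- 6) * vB w = (1 - r ^- 6) * (gam / 4 * vB w)).
    by rewrite ltrD2r.
  by rewrite mulrAC mulrC.
have [wA _] := lowA _ wL.
have [wS w1 _] := (Lambda_minusP gam a p6 hB hC w c'0).1 wL.
rewrite (Lambda_minus_energyE p6 hB hC c'0 wL) sigma6.
have -> : (1 / 2 - 6^-1) * vA w - gam / 4 * (1 - 6^-1) * vB w =
   vA w / 3 - 5 / 6 * (gam / 4 * vB w).
  by move: (vA w) (vB w) => A B; field.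
have h := level_lower z0 zE A00 (ltW wA).
apply: h.
  by rewrite mulr_ge0 ?vB_ge0// ltW// divr_gt0.
have := Qsup_ge hB hC c'0 wS; rewrite -(ler_pM2l ha); apply: le_trans.
move: w1; rewrite sigma6 (_ : a / 6 * 6 = a); last by field.
by move=> /eqP; rewrite subr_eq0 => /eqP ->.
Qed.

End critical_mass.

Theorem lemma3p27 (R : realType) (p gam a KH KGN : R)
  (hp : 10 / 3 < p <= 6) (hgam : 0 < gam) (ha : 0 < a)
  (hKH : 0 < KH) (hKGN : 0 < KGN)
  (hB : forall (c : R) (u : R3 R -> R), 0 < c -> sphere c u ->
     (Bint u <= (KH * Num.sqrt (fine (Aint u)) * c `^ (3 / 2))%:E)%E)
  (hC : forall (c : R) (u : R3 R -> R), 0 < c -> sphere c u ->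
     (Cint p u <= (KGN * fine (Aint u) `^ (sigma p / 2) * c `^ ((6 - p) / 4))%:E)%E) :
  forall c c' : R, 0 < c -> c < c' -> c' < c1 gam a p KH KGN ->
    (gamma_minus gam a p c' < gamma_minus gam a p c)%E.
Proof.
move=> c c' c0 cc' c'c; have [p6|p6] := ltP p 6.
  exact: gamma_minus_subcritical hp hgam ha hKH hKGN hB hC _ _ p6 c0 cc' c'c.
have pE : p = 6 by apply/le_anti; rewrite p6 andbT; case/andP: hp.
subst p; exact: gamma_minus_critical hgam ha hKH hKGN hB hC _ _ c0 cc' c'c.
Qed.
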